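(* Let $D$ be a Young diagram with $|D|$ boxes, let $\{r_i^-\}_{i=1}^d$ be integers with $0\le r_i^-\le r_i$, and let $\Xi(t)$, $t\in I$, be a smooth one-parameter family of representations of the quiver $\mathfrak Q_D$ compatible with $D$ and the tuple $\{r_i^-\}_{i=1}^d$. Then there exists a unique, up to a symplectic transformation, curve $\Lambda(t)$, $t\in I$, satisfying condition (G) (defined in the context), in the Lagrange Grassmannian of a $2|D|$-dimensional symplectic space with Young diagram $D$, such that the quiver of curvatures of $\Lambda(t)$ is isomorphic to $\Xi(t)$ and its $i$th negative inertia index is equal to $r_i^-$ for every $1\le i\le d$. If, in addition, all rows of $D$ have different lengths, then, given a tuple of smooth functions $\{\rho_{a,b}(t):(a,b)\in\Delta\times\Delta,\ (a,b)\text{ an essential pair}\}$ on $I$ with $\rho_{a,b}=\rho_{b,a}$, there exists a unique, up to a symplectic transformation, curve $\Lambda(t)$ satisfying condition (G) in the Lagrange Grassmannian of a $2|D|$-dimensional symplectic space with Young diagram $D$ such that for every essential pair $(a,b)$ and every $t$ its $(a,b)$-curvature at $t$ coincides with $\rho_{a,b}(t)$ (i.e. $R_t(a,b)=\rho_{a,b}(t)$ for all essential pairs, for the normal mapping $R_t$ associated with some normal moving frame of $\Lambda$) and its $i$th negative inertia index is equal to $r_i^-$ for every $1\le i\le d$.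
   Context: **Curves.** $W$ is a real $2m$-dimensional vector space with symplectic form $\omega$; $L(W)$ is the set of Lagrangian subspaces; $\Lambda:I\to L(W)$ is a smooth curve on an interval $I$. For any smooth curve of subspaces $\Lambda(\cdot)$ of $W$, $\mathfrak S(\Lambda)$ is the set of smooth curves $\ell$ in $W$ with $\ell(t)\in\Lambda(t)$ for all $t$; the $i$th extension is $\Lambda^{(i)}(\tau)=\mathrm{span}\{\frac{d^j}{d\tau^j}\ell(\tau):\ell\in\mathfrak S(\Lambda),\,0\le j\le i\}$; the contractions are $\Lambda_{(0)}=\Lambda$ and $\Lambda_{(i)}(\tau)=\{v\in\Lambda_{(i-1)}(\tau):\exists\,\ell\in\mathfrak S(\Lambda_{(i-1)}),\ \ell(\tau)=v,\ \ell'(\tau)\in\Lambda_{(i-1)}(\tau)\}$. $(\Lambda_{(k)})^{(n)}(t)$ means the $n$th extension of the curve $t\mapsto\Lambda_{(k)}(t)$. Standing assumptions: $\dim\Lambda^{(i)}(t)$ is independent of $t$ for every $i$, and $\Lambda^{(p)}(t)=W$ for some integer $p$. The velocity $\dot\Lambda(t)$ is identified with the quadratic form $v\mapsto\omega(\ell'(t),\ell(t))$ on $\Lambda(t)$, $\ell\in\mathfrak S(\Lambda)$, $\ell(t)=v$. **Diagrams.** The Young diagram $D$ of the curve has $\dim\Lambda^{(i)}-\dim\Lambda^{(i-1)}$ boxes in its $i$th column ($\Lambda^{(0)}=\Lambda$). Any Young diagram $D$ is uniquely a union of $d$ rectangular diagrams $D_i$ ($r_i$ rows, $p_i$ columns),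 stacked from top to bottom, with $p_1>\dots>p_d$. The reduction $\Delta$ has $d$ rows, the $i$th of length $p_i$. Boxes of $\Delta$ are superboxes, rows are levels; $\Upsilon_i$ is the $i$th level. The $j$th superbox of the $i$th level corresponds to the $j$th column of $D_i$ and has size $r_i$. $a_i,\sigma_i$ are the first and last superboxes of $\Upsilon_i$; the $\sigma_i$ are special, $\mathcal S=\{\sigma_1,\dots,\sigma_d\}$; $\mathcal F_1$ is the first column of $\Delta$; $l,r$ are left and right shifts by one superbox. (If all rows of $D$ have different lengths, all $r_i=1$ and $\Delta=D$.) **Condition (G):** for every $1\le i\le d-1$ and every $t$, the rank of the restriction of $\dot\Lambda(t)$ to $(\Lambda_{(p_i-1)})^{(p_i-1)}(t)$ equals $\sum_{k=1}^ir_k$. For such a curve let $\Gamma_i^\pm$ be the positive and negative inertia indices of $\dot\Lambda(t)|_{(\Lambda_{(p_i-1)})^{(p_i-1)}(t)}$, $1\le i\le d$, $\Gamma_0^\pm=0$; $r_i^\pm=\Gamma_i^\pm-\Gamma_{i-1}^\pm$ (independent of $t$; $r_i^++r_i^-=r_i$) are the $i$th positive and negative inertia indices of $\Lambda$. $I_{r_i^+,r_i^-}$ is the diagonal $r_i\times r_i$ matrix with first $r_i^+$ diagonal entries $1$ and the others $-1$. **Normal mappings.** $R:\Delta\times\Delta\to\{\text{real matrices}\}$ is compatible with $D$ if $R(a,b)$ has size $s_2\times s_1$ whenever $a,b$ have sizes $s_1,s_2$; symmetric if $R(b,a)=R(a,b)^T$. For $1\le j<i\le d$ consider the tuple of pairs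 $$(a_j,a_i),(a_j,r(a_i)),(r(a_j),r(a_i)),(r(a_j),r^2(a_i)),\dots,(r^{p_i-1}(a_j),r^{p_i-1}(a_i)),(r^{p_i}(a_j),r^{p_i-1}(a_i)),\dots,(r^{p_j-1}(a_j),r^{p_i-1}(a_i)).\quad(\ast)$$ (Alternately shift the second and the first entry until the second entry is special; then shift only the first.) A symmetric compatible $R$ is quasi-normal if (1) among all $R(a,b)$ with $b$ not higher than $a$, the only possibly nonzero ones are $R(a,a)$, $R(a,r(a))$ and $R(r(a),a)$ for nonspecial $a$, and $R(a,b)$ for pairs appearing in the tuples $(\ast)$, $1\le j<i\le d$; (2) $R(a,r(a))$ is antisymmetric for every nonspecial $a$. It is normal if in addition, for all $j<i$, the matrices corresponding to the first $p_j-p_i-1$ pairs of $(\ast)$ vanish. A pair $(a,b)$ is essential if $R(a,b)\ne0$ for some normal mapping $R$. **Frames.** A Darboux frame $(\{e_\alpha\}_{\alpha\in D},\{f_\alpha\}_{\alpha\in D})$ satisfies $\omega(e_\alpha,e_\beta)=\omega(f_\alpha,f_\beta)=\omega(f_\alpha,e_\beta)-\delta_{\alpha,\beta}=0$. For a superbox $a$ with corresponding boxes $\alpha_1,\dots,\alpha_s$ of $D$ (top to bottom), $E_a=(e_{\alpha_1},\dots,e_{\alpha_s})$, $F_a=(f_{\alpha_1},\dots,f_{\alpha_s})$ (rows of vectors). A smooth moving Darboux frame is a normal moving frame of a curve $\Lambda$ satisfying condition (G) if $\Lambda(t)=\mathrm{span}\{E_a(t)\}_{a\in\Delta}$ and there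 are normal mappings $R_t$ (associated with the frame) with $E_a'=E_{l(a)}$ for $a\notin\mathcal F_1$; $E_a'=F_aI_{r_i^+,r_i^-}$ for $a\in\mathcal F_1\cap\Upsilon_i$; $F_a'=\sum_bE_bR_t(a,b)-F_{r(a)}$ for $a\notin\mathcal S$; $F_a'=\sum_bE_bR_t(a,b)$ for $a\in\mathcal S$. Known fact: normal moving frames exist, and any two are related by $\widetilde E_a=E_aU_i$, $\widetilde F_a=F_aI_{r_i^+,r_i^-}U_iI_{r_i^+,r_i^-}$ ($a\in\Upsilon_i$) with constant $U_i\in O(r_i^+,r_i^-)$. **Curvatures and quivers.** $V_a(t)=\mathrm{span}\{E_a(t)\}$, $a\in\Upsilon_i$, carries the pseudo-Euclidean structure whose Gram matrix in the basis $E_a(t)$ is $I_{r_i^+,r_i^-}$; both are independent of the normal frame. For an essential pair $(a,b)\in\Upsilon_i\times\Upsilon_j$ the $(a,b)$-curvature mapping $\mathfrak R_t(a,b):V_a(t)\to V_b(t)$ is the linear map with matrix $R_t(a,b)I_{r_i^+,r_i^-}$ in the bases $E_a(t),E_b(t)$; it is independent of the normal frame. For fixed $i$, all $V_a(t)$, $a\in\Upsilon_i$, $t\in I$, are identified with a single pseudo-Euclidean space $\mathcal X_i$ (sending $E_a(t_1)$ to $E_b(t_2)$). The quiver $\mathfrak Q_D$ has the levels of $\Delta$ as vertices, and its arrows from $\Upsilon_i$ to $\Upsilon_j$ are the essential pairs $(a,b)\in\Upsilon_i\times\Upsilon_j$. A representation of $\mathfrak Q_D$ (a vector space for each vertex,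 a linear map for each arrow) is compatible with $D$ and $\{r_i^-\}$ if the space at $\Upsilon_i$ is an $r_i$-dimensional pseudo-Euclidean space with negative inertia index $r_i^-$ and the maps satisfy $\mathcal R(a,b)^*=\mathcal R(b,a)$ and $\mathcal R(a,r(a))$ antisymmetric with respect to the pseudo-Euclidean structures. One-parameter families of representations have fixed spaces and maps depending on $t$. The quiver of curvatures of $\Lambda$ is the family given by the spaces $\mathcal X_i$ and the maps $\mathfrak R_t(a,b)\in\mathrm{Hom}(\mathcal X_i,\mathcal X_j)$. Two families are isomorphic if there is a tuple of isometries, independent of $t$, between corresponding spaces conjugating all corresponding maps. If all $r_i=1$, the scalars $R_t(a,b)$ are called $(a,b)$-curvatures (normal frames are then unique up to signs). *)

(* Defs.v *)
From HB Require Import structures.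
From mathcomp Require Import all_boot all_order all_algebra.
From mathcomp Require Import all_classical all_reals all_analysis.

Set Implicit Arguments.
Unset Strict Implicit.
Unset Printing Implicit Defensive.

Import Order.TTheory GRing.Theory Num.Theory.
Import numFieldNormedType.Exports.

Local Open Scope classical_set_scope.
Local Open Scope ring_scope.

(** * Smooth curves on an interval

  Derivatives are taken relative to the set [I], hence are one-sided at an end
  point that belongs to [I]; only the values on [I] matter. *)

Definition diff_quot (R : realType) (f : R -> R) (t s : R) : R :=
  (f s - f t) / (s - t).

Definition derive_in (R : realType) (I : set R) (f : R -> R) (t : R) : R :=
  lim (diff_quot f t @ within I (t^')).

Definition smooth_in (R : realType) (I : set R) (f : R -> R) : Prop :=
  forall (n : nat) (t : R), I t ->
    cvg (diff_quot (iter n (derive_in I) f) t @ within I (t^')).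

(* In a finite-dimensional space smoothness and derivatives are read on the
   coordinates in some basis, and do not depend on that basis. *)
Definition vcoord (R : realType) (V : vectType R) (k : 'I_(\dim {:V})) (v : V)
    : R :=
  coord (vbasis {:V}) k v.

Definition vsmooth_in (R : realType) (V : vectType R) (I : set R)
    (l : R -> V) : Prop :=
  forall k, smooth_in I (fun t => vcoord k (l t)).

Definition vderive_in (R : realType) (V : vectType R) (I : set R)
    (l : R -> V) (t : R) : V :=
  \sum_k derive_in I (fun s => vcoord k (l s)) t *: (vbasis {:V})`_k.

(** * Curves of subspaces: extensions and contractions *)

(* smallest subspace containing A *)
Definition vspan (R : realType) (V : vectType R) (A : set V) : {vspace V} :=
  xget 0%VS [set U : {vspace V} | (forall v, A v -> v \in U) /\
    (forall U' : {vspace V}, (forall v, A v -> v \in U') -> (U <= U')%VS)].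

(* smooth as a map to a Grassmannian: near every point of I the subspaces have
   a basis depending smoothly on t *)
Definition smooth_subspaces (R : realType) (V : vectType R) (I : set R)
    (L : R -> {vspace V}) : Prop :=
  forall t0, I t0 -> exists (U : set R) (n : nat) (X : R -> n.-tuple V),
    [/\ open U, U t0,
        forall k, vsmooth_in (I `&` U) (fun t => tnth (X t) k) &
        forall t, I t -> U t -> basis_of (L t) (X t)].

Definition sections (R : realType) (V : vectType R) (I : set R)
    (L : R -> {vspace V}) : set (R -> V) :=
  [set l | vsmooth_in I l /\ forall t, I t -> l t \in L t].

Definition extension (R : realType) (V : vectType R) (I : set R) (i : nat)
    (L : R -> {vspace V}) (t : R) : {vspace V} :=
  vspan [set v | exists (j : nat) (l : R -> V),
    [/\ (j <= i)%N, sections I L l & v = iter j (vderive_in I) l t]].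

(* The set below is already a linear subspace; [vspan] only turns it into a
   {vspace V}. *)
Definition contraction1 (R : realType) (V : vectType R) (I : set R)
    (L : R -> {vspace V}) (t : R) : {vspace V} :=
  vspan [set v | v \in L t /\ exists l : R -> V,
    [/\ sections I L l, l t = v & vderive_in I l t \in L t]].

Definition contraction (R : realType) (V : vectType R) (I : set R) (k : nat)
    (L : R -> {vspace V}) : R -> {vspace V} :=
  iter k (contraction1 I) L.

(** * Quadratic forms on subspaces *)

Definition polar (R : realType) (V : vectType R) (q : V -> R) (u v : V) : R :=
  (q (u + v) - q u - q v) / 2.

Definition qrank (R : realType) (V : vectType R) (q : V -> R) (U : {vspace V})
    : nat :=
  \rank (\matrix_(i < \dim U, j < \dim U) polar q (vbasis U)`_i (vbasis U)`_j).

(* negative inertia index: the largest dimension of a subspace of U on which q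
   is negative definite *)
Definition neg_index (R : realType) (V : vectType R) (q : V -> R)
    (U : {vspace V}) : nat :=
  \max_(k < (\dim U).+1 | `[< exists V' : {vspace V},
      [/\ (V' <= U)%VS, \dim V' = k &
          forall v, v \in V' -> v != 0 -> q v < 0] >]) k.

(* For a curve of Lagrangian subspaces the value does not depend on the
   section l. *)
Definition velocity (R : realType) (W : vectType R) (omega : {skew_symmetric W})
    (I : set R) (L : R -> {vspace W}) (t : R) (v : W) : R :=
  xget 0 [set x | exists l : R -> W,
    [/\ sections I L l, l t = v & x = omega (vderive_in I l t) (l t)]].

(** * Young diagrams and their reductions

  A Young diagram is the nonincreasing sequence of the lengths of its rows.
  Levels, columns and indices of superboxes are numbered from 0. *)

Record young_diagram := YoungDiagram {
  yrows :> seq nat;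
  yrowsP : sorted geq yrows && (0%N \notin yrows) }.

Definition ysize (D : young_diagram) : nat := sumn D.

Definition ycolumn (D : young_diagram) (i : nat) : nat :=
  count (fun x => i < x)%N D.

Definition depth (D : young_diagram) : nat := size (undup D).

(* D is the union of the rectangles with [lheight D i] rows and [llength D i]
   columns, i < depth D *)
Definition llength (D : young_diagram) (i : nat) : nat := nth 0%N (undup D) i.
Definition lheight (D : young_diagram) (i : nat) : nat :=
  count_mem (llength D i) D.

Lemma llength_gt0 (D : young_diagram) (i : 'I_(depth D)) : (0 < llength D i)%N.
Proof.
case/andP: (yrowsP D) => _ D0; rewrite lt0n; apply: contraNneq D0 => <-.
by rewrite -mem_undup mem_nth.
Qed.

Definition superbox (D : young_diagram) : finType :=
  {i : 'I_(depth D) & 'I_(llength D i)}.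

Definition SuperBox (D : young_diagram) (i : 'I_(depth D))
    (j : 'I_(llength D i)) : superbox D :=
  Tagged (fun i : 'I_(depth D) => 'I_(llength D i)) j.

Definition level (D : young_diagram) (a : superbox D) : 'I_(depth D) := tag a.
Definition column (D : young_diagram) (a : superbox D) : nat := tagged a.

(* The boxes of D are the pairs formed by a superbox a and an element of
   'I_(sbsize a). *)
Definition sbsize (D : young_diagram) (a : superbox D) : nat :=
  lheight D (tag a).
Definition box (D : young_diagram) : finType :=
  {a : superbox D & 'I_(sbsize a)}.
Definition Box (D : young_diagram) (a : superbox D) (k : 'I_(sbsize a))
    : box D :=
  Tagged (fun a : superbox D => 'I_(sbsize a)) k.

Definition special (D : young_diagram) (a : superbox D) : bool :=
  (column a).+1 == llength D (level a).

Definition sbfirst (D : young_diagram) (i : 'I_(depth D)) : superbox D :=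
  SuperBox (Ordinal (llength_gt0 i)).

(* The shifts leave fixed the superbox at the corresponding end of a level. *)
Definition sbright (D : young_diagram) (a : superbox D) : superbox D :=
  SuperBox (insubd (tagged a) (column a).+1).
Definition sbleft (D : young_diagram) (a : superbox D) : superbox D :=
  SuperBox (Ordinal (leq_ltn_trans (leq_pred (tagged a)) (ltn_ord (tagged a)))).

(** * Normal mappings *)

Definition compatible_map (R : realType) (D : young_diagram) : Type :=
  forall a b : superbox D, 'M[R]_(sbsize b, sbsize a).

(* For j < i: start from the first superboxes of the levels j and i, shift
   alternately the second and the first entry until the second one is special,
   then shift only the first entry. *)
Definition shift_pairs (D : young_diagram) (j i : 'I_(depth D))
    : seq (superbox D * superbox D) :=
  let aj k := iter k (@sbright D) (sbfirst j) in
  let ai k := iter k (@sbright D) (sbfirst i) in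
  let cj := llength D j in
  let ci := llength D i in
  flatten [seq [:: (aj k, ai k); (aj k, ai k.+1)] | k <- iota 0 ci.-1]
  ++ [seq (aj k, ai ci.-1) | k <- iota ci.-1 (cj - ci).+1].

Definition symmetric_map (R : realType) (D : young_diagram)
    (N : compatible_map R D) : Prop :=
  forall a b, N b a = (N a b)^T.

(* Level i is not higher than level j when j <= i. *)
Definition quasi_normal (R : realType) (D : young_diagram)
    (N : compatible_map R D) : Prop :=
  [/\ symmetric_map N,
      forall a b, (level a <= level b)%N -> N a b <> 0 ->
        [\/ a = b,
            ~~ special a /\ b = sbright a,
            ~~ special b /\ a = sbright b |
            (level a < level b)%N /\
              (a, b) \in shift_pairs (level a) (level b)] &
      forall a, ~~ special a -> (N a (sbright a))^T = - N a (sbright a)].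

Definition normal_map (R : realType) (D : young_diagram)
    (N : compatible_map R D) : Prop :=
  quasi_normal N /\
  forall (j i : 'I_(depth D)) (a b : superbox D), (j < i)%N ->
    (a, b) \in take (llength D j - llength D i - 1) (shift_pairs j i) ->
    N a b = 0.

Definition essential (R : realType) (D : young_diagram) (a b : superbox D)
    : Prop :=
  exists N : compatible_map R D, normal_map N /\ N a b <> 0.

(** * Curves in the Lagrange Grassmannian *)

Definition lagrangian_curve (R : realType) (W : vectType R)
    (omega : {skew_symmetric W}) (I : set R) (L : R -> {vspace W}) : Prop :=
  smooth_subspaces I L /\ forall t, I t -> orthov omega (L t) = L t.

Definition has_young_diagram (R : realType) (W : vectType R) (I : set R)
    (L : R -> {vspace W}) (D : young_diagram) : Prop :=
  [/\ forall i s t, I s -> I t ->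
        \dim (extension I i L s) = \dim (extension I i L t),
      exists p, forall t, I t -> extension I p L t = fullv &
      forall i t, I t ->
        \dim (extension I i.+1 L t) = (\dim (extension I i L t) + ycolumn D i)%N].

Definition level_space (R : realType) (W : vectType R) (I : set R)
    (L : R -> {vspace W}) (D : young_diagram) (i : nat) (t : R) : {vspace W} :=
  extension I (llength D i).-1 (contraction I (llength D i).-1 L) t.

Definition condition_G (R : realType) (W : vectType R)
    (omega : {skew_symmetric W}) (I : set R) (L : R -> {vspace W})
    (D : young_diagram) : Prop :=
  forall (i : 'I_(depth D)) t, (i.+1 < depth D)%N -> I t ->
    qrank (velocity omega I L t) (level_space I L D i t)
    = (\sum_(k < depth D | (k <= i)%N) lheight D k)%N.

(* [neg_gamma n] is the negative inertia index attached to the first n levels *)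
Definition neg_gamma (R : realType) (W : vectType R)
    (omega : {skew_symmetric W}) (I : set R) (L : R -> {vspace W})
    (D : young_diagram) (n : nat) (t : R) : nat :=
  if n is i.+1
  then neg_index (velocity omega I L t) (level_space I L D i t) else 0%N.

Definition neg_inertia (R : realType) (W : vectType R)
    (omega : {skew_symmetric W}) (I : set R) (L : R -> {vspace W})
    (D : young_diagram) (i : nat) (t : R) : int :=
  (neg_gamma omega I L D i.+1 t)%:Z - (neg_gamma omega I L D i t)%:Z.

(* the curves satisfying condition (G), with Young diagram D and with negative
   inertia indices rm *)
Definition G_curve (R : realType) (W : vectType R)
    (omega : {skew_symmetric W}) (I : set R) (D : young_diagram)
    (rm : 'I_(depth D) -> nat) (L : R -> {vspace W}) : Prop :=
  [/\ lagrangian_curve omega I L,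
      has_young_diagram I L D,
      condition_G omega I L D &
      forall (i : 'I_(depth D)) t, I t ->
        neg_inertia omega I L D i t = (rm i)%:Z].

(** * Normal moving frames *)

(* diagonal n x n matrix, the last m entries being -1 and the others 1 *)
Definition inertia_mx (R : realType) (n m : nat) : 'M[R]_n :=
  \matrix_(i, j) (if i == j then (if (i < n - m)%N then 1 else - 1) else 0).

Definition rowvec_mul (R : realType) (V : vectType R) (m n : nat)
    (X : 'I_m -> V) (A : 'M[R]_(m, n)) (l : 'I_n) : V :=
  \sum_k A k l *: X k.

Definition half_frame (R : realType) (V : vectType R) (D : young_diagram)
    : Type :=
  forall a : superbox D, 'I_(sbsize a) -> V.

Definition darboux (R : realType) (W : vectType R)
    (omega : {skew_symmetric W}) (D : young_diagram) (E F : half_frame W D)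
    : Prop :=
  forall (a b : superbox D) (k : 'I_(sbsize a)) (l : 'I_(sbsize b)),
    [/\ omega (E a k) (E b l) = 0, omega (F a k) (F b l) = 0 &
        omega (F a k) (E b l) = (Box k == Box l)%:R].

(* structural equations at t; the positive inertia index of level i is
   lheight D i - rm i *)
Definition structural_eqs (R : realType) (W : vectType R) (I : set R)
    (D : young_diagram) (rm : 'I_(depth D) -> nat)
    (E F : R -> half_frame W D) (N : compatible_map R D) (t : R) : Prop :=
  [/\ forall a k, (0 < column a)%N ->
        vderive_in I (fun s => E s a k) t = E t (sbleft a) k,
      forall a k, column a = 0%N ->
        vderive_in I (fun s => E s a k) t
        = rowvec_mul (F t a) (inertia_mx R (sbsize a) (rm (level a))) k,
      forall a k, ~~ special a ->
        vderive_in I (fun s => F s a k) t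
        = \sum_b rowvec_mul (E t b) (N a b) k - F t (sbright a) k &
      forall a k, special a ->
        vderive_in I (fun s => F s a k) t
        = \sum_b rowvec_mul (E t b) (N a b) k].

(* (E, F) is a normal moving frame, with associated normal mappings N t, of a
   curve L with negative inertia indices rm *)
Definition normal_moving_frame (R : realType) (W : vectType R)
    (omega : {skew_symmetric W}) (I : set R) (D : young_diagram)
    (rm : 'I_(depth D) -> nat) (L : R -> {vspace W})
    (E F : R -> half_frame W D) (N : R -> compatible_map R D) : Prop :=
  (forall a k, vsmooth_in I (fun t => E t a k) /\
               vsmooth_in I (fun t => F t a k)) /\
  forall t, I t ->
    [/\ darboux omega (E t) (F t),
        L t = (\sum_a \sum_k <[E t a k]>)%VS,
        normal_map (N t) &
        structural_eqs I rm E F (N t) t].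

(** * Representations of the quiver of a Young diagram *)

Record pseudo_euclidean (R : realType) := PseudoEuclidean {
  pe_space :> vectType R;
  pe_form : {symmetric pe_space};
  pe_nondeg : nondegenerate pe_form }.

(* The arrows are the essential pairs only: [qf_map] is meaningful on these. *)
Record quiver_family (R : realType) (D : young_diagram) := QuiverFamily {
  qf_space : 'I_(depth D) -> pseudo_euclidean R;
  qf_map : R -> forall a b : superbox D,
    'Hom(qf_space (level a), qf_space (level b)) }.

Definition smooth_family (R : realType) (D : young_diagram) (I : set R)
    (X : quiver_family R D) : Prop :=
  forall a b (v : qf_space X (level a)), essential R a b ->
    vsmooth_in I (fun t => qf_map X t a b v).

Definition compatible_family (R : realType) (D : young_diagram) (I : set R)
    (rm : 'I_(depth D) -> nat) (X : quiver_family R D) : Prop :=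
  [/\ forall i, \dim {: qf_space X i} = lheight D i,
      forall i, neg_index (fun v => pe_form (qf_space X i) v v)
                  {: qf_space X i} = rm i,
      forall t a b v w, I t -> essential R a b ->
        pe_form (qf_space X (level b)) (qf_map X t a b v) w
        = pe_form (qf_space X (level a)) v (qf_map X t b a w) &
      forall t a (v w : qf_space X (level a)),
        I t -> ~~ special a -> essential R a (sbright a) ->
        pe_form (qf_space X (level a)) (qf_map X t a (sbright a) v) w
        = - pe_form (qf_space X (level a)) v (qf_map X t a (sbright a) w)].

Definition isomorphic_families (R : realType) (D : young_diagram) (I : set R)
    (X Y : quiver_family R D) : Prop :=
  exists g : forall i, 'Hom(qf_space X i, qf_space Y i),
    [/\ forall i, bijective (g i),
        forall i, isometry (pe_form (qf_space Y i)) (pe_form (qf_space X i))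
                    (g i) &
        forall t a b v, I t -> essential R a b ->
          g (level b) (qf_map X t a b v) = qf_map Y t a b (g (level a) v)].

(** * The quiver of curvatures *)

Definition inertia_form (R : realType) (n m : nat) (u v : 'cV[R]_n) : R :=
  (u^T *m inertia_mx R n m *m v) 0 0.

Lemma inertia_mxT (R : realType) (n m : nat) :
  (inertia_mx R n m)^T = inertia_mx R n m.
Proof. by apply/matrixP => i j; rewrite !mxE eq_sym; case: eqP => // ->. Qed.

Lemma inertia_mxK (R : realType) (n m : nat) :
  inertia_mx R n m *m inertia_mx R n m = 1%:M.
Proof.
apply/matrixP => i j; rewrite !mxE (bigD1 i) //= big1 => [|k ki]; last first.
  by rewrite !mxE eq_sym (negPf ki) mul0r.
rewrite !mxE eqxx addr0; case: (i == j); last by rewrite mulr0.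
by case: ifP; rewrite ?mulr1 ?mulrNN ?mulr1.
Qed.

Lemma inertia_form_linearr (R : realType) (n m : nat) (u : 'cV[R]_n) :
  linear_for (idfun \; *%R) (@inertia_form R n m u).
Proof.
by move=> a v w; rewrite /inertia_form mulmxDr -scalemxAr !mxE.
Qed.

Lemma inertia_formC (R : realType) (n m : nat) (u v : 'cV[R]_n) :
  inertia_form m u v = (-1) ^+ false * idfun (inertia_form m v u).
Proof.
rewrite mul1r /inertia_form /= -[LHS]trace_mx11 -[RHS]trace_mx11 -mxtrace_tr.
by rewrite !trmx_mul trmxK inertia_mxT mulmxA.
Qed.

Lemma inertia_form_linearl (R : realType) (n m : nat) (v : 'cV[R]_n) :
  linear_for *%R ((@inertia_form R n m)^~ v).
Proof.
by move=> a u w; rewrite /= 3!(inertia_formC _ _ v) inertia_form_linearr !mul1r.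
Qed.

HB.instance Definition _ (R : realType) (n m : nat) :=
  bilinear_isBilinear.Build R 'cV[R]_n 'cV[R]_n R *%R (idfun \; *%R)
    (@inertia_form R n m)
    (@inertia_form_linearl R n m, @inertia_form_linearr R n m).

HB.instance Definition _ (R : realType) (n m : nat) :=
  isHermitianSesquilinear.Build R 'cV[R]_n false idfun (@inertia_form R n m)
    (@inertia_formC R n m).

Lemma inertia_form_nondeg (R : realType) (n m : nat) :
  nondegenerate (@inertia_form R n m : {symmetric 'cV[R]_n}).
Proof.
rewrite /nondegenerate -subv0; apply/subvP => u /mem_orthovP u0.
rewrite memv0; apply/eqP; have Ju0 : u^T *m inertia_mx R n m = 0.
  apply/rowP => k; have /= := u0 (delta_mx k 0) (memvf _).
  by rewrite /inertia_form -colE [LHS]mxE => ->; rewrite mxE.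
apply: trmx_inj; rewrite trmx0.
by rewrite -[LHS]mulmx1 -(inertia_mxK R n m) mulmxA Ju0 mul0mx.
Qed.

Definition inertia_space (R : realType) (n m : nat) : pseudo_euclidean R :=
  PseudoEuclidean (@inertia_form_nondeg R n m).

(* The spaces V_a(t), a in level i, are all identified with the space of column
   vectors of coordinates in the bases E_a(t), whose Gram matrix is
   [inertia_mx]. *)
Definition curvature_quiver (R : realType) (D : young_diagram)
    (rm : 'I_(depth D) -> nat) (N : R -> compatible_map R D)
    : quiver_family R D :=
  @QuiverFamily R D (fun i => inertia_space R (lheight D i) (rm i))
    (fun t a b => linfun
       (mulmx (N t a b *m inertia_mx R (sbsize a) (rm (level a))))).

(* Curvatures do not depend on the normal moving frame. *)
Definition has_curvature_quiver (R : realType) (W : vectType R)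
    (omega : {skew_symmetric W}) (I : set R) (D : young_diagram)
    (rm : 'I_(depth D) -> nat) (L : R -> {vspace W}) (X : quiver_family R D)
    : Prop :=
  exists E F N, normal_moving_frame omega I rm L E F N /\
    isomorphic_families I (curvature_quiver rm N) X.

Definition has_curvatures (R : realType) (W : vectType R)
    (omega : {skew_symmetric W}) (I : set R) (D : young_diagram)
    (rm : 'I_(depth D) -> nat) (L : R -> {vspace W})
    (rho : superbox D -> superbox D -> R -> R) : Prop :=
  exists E F N, normal_moving_frame omega I rm L E F N /\
    forall a b t, I t -> essential R a b -> N t a b = const_mx (rho a b t).

(* there is a curve satisfying P, unique on I up to a symplectic
   transformation *)
Definition exists_unique_curve (R : realType) (W : vectType R)
    (omega : {skew_symmetric W}) (I : set R)
    (P : (R -> {vspace W}) -> Prop) : Prop :=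
  (exists L, P L) /\
  forall L L', P L -> P L' -> exists g : 'End(W),
    isometry omega omega g /\ forall t, I t -> L' t = (g @: L t)%VS.

(* Main.v *)
(* The structural equations say that a normal moving frame X satisfies a linear
   differential equation X' = A X whose matrix A is built from the normal
   mappings and takes values in the symplectic Lie algebra. A compatible family
   determines the normal mappings on the essential pairs once an orthonormal
   basis is chosen in each of its spaces, and they vanish on the other pairs.
   Solving the equation from a Darboux basis gives a moving Darboux frame; in it
   the extensions and contractions of the curve spanned by the vectors E are
   spanned by subsets of the frame, because A maps each such subset into the next
   one, and the velocity is a diagonal quadratic form. Conversely, after a
   constant change of frame two curves with isomorphic quivers have frames X and
   Z satisfying the same equation, and then the linear map X(t) -> Z(t) is
   symplectic and constant. *)

Require Import Defs.
From HB Require Import structures.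
From mathcomp Require Import all_boot all_order all_algebra.
From mathcomp Require Import all_classical all_reals all_analysis.
From mathcomp Require Import ring lra zify.

Set Implicit Arguments.
Unset Strict Implicit.
Unset Printing Implicit Defensive.

Import Order.TTheory GRing.Theory Num.Theory.
Import numFieldNormedType.Exports.

Local Open Scope classical_set_scope.
Local Open Scope ring_scope.

(** * Calculus relative to an interval *)

(** The interval [I] may be open, closed or unbounded, so derivatives, primitives and solutions are
    all taken relative to [I], and every estimate is made on compact segments of it. Extensions and
    contractions quantify over all smooth sections, not only over the frame vectors. The upper
    bounds rest on one remark: when the coordinates of a section vanish identically outside a subset
    of the frame, its derivative acquires coordinates there only through the matrix [A]. The lower
    bounds need sections with a known derivative modulo the previous step. They exist because the
    shifts, and the passage from E to F in the first column, act with nonzero constant coefficients,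
    while the normal mappings only contribute vectors of E. A Darboux frame is its own dual up to a
    permutation and signs, so coordinates are values of [omega] and remain smooth without inverting
    any matrix. In the uniqueness part both curves come with normal frames, since the curvature
    predicates provide them; what has to be matched is the choice of pseudo-orthonormal bases, an
    ambiguity in a product of groups O(r_i^+, r_i^-). *)

Section DerivativesOnAnInterval.
Variables (R : realType) (I : set R).
Hypothesis I_itv : is_interval I.
Hypothesis I_nontriv : exists s t, [/\ I s, I t & s < t].
Implicit Types (f g : R -> R) (t : R).

Definition der_in f t (l : R) := diff_quot f t s @[s --> within I (t^')] --> l.

(** Every point of a nondegenerate interval is an accumulation point of it: moving from [t] towards
    another point of [I] stays in [I]. This properness makes limits unique, hence makes [derive_in]
    computable. *)
Lemma within_proper t : I t -> ProperFilter (within I (t^')).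
Proof.
move=> It; split; last exact: within_filter.
rewrite /within/= => -[e /= e0 He].
have [u [Iu ut]] : exists u, I u /\ u != t.
  have [a [b [Ia Ib ab]]] := I_nontriv.
  have [ta|] := eqVneq a t; last by exists a.
  by exists b; split=> //; rewrite gt_eqF// -ta.
pose h := Num.min (e / 2) `|u - t|.
have h0 : 0 < h by rewrite lt_min divr_gt0//= normr_gt0 subr_eq0.
have hu : h <= `|u - t| by rewrite ge_min lexx orbT.
have he : h < e by rewrite (@le_lt_trans _ _ (e/2))// ?ge_min ?lexx//; lra.
have [v [Iv vt]] : exists v, I v /\ `|v - t| = h.
  have [tu|ut'] := ltP t u.
    exists (t + h); rewrite addrAC subrr add0r gtr0_norm//; split=> //.
    apply: (I_itv It Iu); rewrite gtr0_norm in hu; last by rewrite subr_gt0.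
    by apply/andP; split; lra.
  exists (t - h); rewrite addrAC subrr add0r normrN gtr0_norm//; split=> //.
  apply: (I_itv Iu It); rewrite ler0_norm in hu; last by rewrite subr_le0.
  by apply/andP; split; lra.
apply: (He v) => //=.
  by rewrite /ball/= distrC vt.
by rewrite -subr_eq0 -normr_eq0 vt gt_eqF.
Qed.

Lemma der_in_derive f t l : I t -> der_in f t l -> derive_in I f t = l.
Proof.
move=> It fl; rewrite /derive_in; have ? := within_proper It.
by apply: cvg_lim.
Qed.

Lemma cvg_within_id t : s @[s --> within I (t^')] --> t.
Proof. by apply: cvg_trans (cvg_within _) _; exact: cvg_trans (cvg_within _) _. Qed.

Lemma der_in_ext f g t l : I t -> {in I, f =1 g} -> der_in f t l -> der_in g t l.
Proof.
move=> It fg; apply: cvg_trans; apply: near_eq_cvg.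
rewrite near_withinE; near=> s => Is.
by rewrite /diff_quot !fg// inE.
Unshelve. all: by end_near. Qed.

Lemma der_in_cvg f t l : der_in f t l -> f s @[s --> within I (t^')] --> f t.
Proof.
move=> fl.
have -> : f t = f t + l * (t - t) by rewrite subrr mulr0 addr0.
have : (fun s => f t + diff_quot f t s * (s - t)) s
    @[s --> within I (t^')] --> f t + l * (t - t).
  apply: cvgD; first exact: cvg_cst.
  by apply: cvgM => //; apply: cvgB; [exact: cvg_within_id|exact: cvg_cst].
apply: cvg_trans; apply: near_eq_cvg.
rewrite near_withinE; near=> s => Is.
rewrite /diff_quot divfK; first by rewrite addrC subrK.
by rewrite subr_eq0; near: s; exact: nbhs_dnbhs_neq.
Unshelve. all: by end_near. Qed.

Lemma der_in_cst c t : der_in (fun=> c) t 0.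
Proof.
rewrite /der_in /diff_quot.
by under eq_cvg do rewrite subrr mul0r; exact: cvg_cst.
Qed.

Lemma der_inD f g t l m :
  der_in f t l -> der_in g t m -> der_in (fun s => f s + g s) t (l + m).
Proof.
move=> fl gm; rewrite /der_in /diff_quot.
under eq_cvg do rewrite opprD addrACA mulrDl.
exact: cvgD.
Qed.

Lemma der_inM f g t l m : der_in f t l -> der_in g t m ->
  der_in (fun s => f s * g s) t (l * g t + f t * m).
Proof.
move=> fl gm; rewrite /der_in.
have E s : diff_quot (fun s => f s * g s) t s
    = diff_quot f t s * g s + f t * diff_quot g t s.
  by rewrite /diff_quot; ring.
under eq_cvg do rewrite E.
apply: cvgD; first by apply: cvgM => //; exact: der_in_cvg gm.
by apply: cvgM => //; exact: cvg_cst.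
Qed.

Lemma der_inZ c f t l : der_in f t l -> der_in (fun s => c * f s) t (c * l).
Proof.
by move=> fl; have := der_inM (der_in_cst c t) fl; rewrite mul0r add0r.
Qed.

Lemma der_in_sum (J : Type) (r : seq J) (P : pred J) (F : J -> R -> R) t dF :
  (forall j, P j -> der_in (F j) t (dF j)) ->
  der_in (fun s => \sum_(j <- r | P j) F j s) t (\sum_(j <- r | P j) dF j).
Proof.
move=> H; elim: r => [|j r IH].
  rewrite big_nil; under [X in der_in X]funext do rewrite big_nil.
  exact: der_in_cst.
rewrite big_cons; under [X in der_in X]funext do rewrite big_cons.
by case Pj: (P j) => //; apply: der_inD => //; exact: H.
Qed.

Lemma der_in_id t : I t -> der_in id t 1.
Proof.
move=> It; apply: (@cvg_trans _ (1 @[_ --> within I (t^')])); last exact: cvg_cst.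
apply: near_eq_cvg; rewrite near_withinE; near=> s => Is.
rewrite /diff_quot divff// subr_eq0.
by near: s; exact: nbhs_dnbhs_neq.
Unshelve. all: by end_near. Qed.

Lemma is_derive_der_in f t l : is_derive t 1 f l -> der_in f t l.
Proof.
move=> H; have [df fl] := H; apply: cvg_trans (cvg_app _ (cvg_within _)) _.
have : diff_quot f t s @[s --> t^'] --> 'D_1 f t.
  have := df; rewrite /derivable /derive => /cvg_ex[m hm].
  have -> : lim (h^-1 *: (((f \o shift t) (h *: 1)) - f t) @[h --> 0^'])
     = m by apply/cvg_lim.
  move/cvgrPdist_lt: hm => hm; apply/cvgrPdist_lt => e /hm.
  rewrite /= !near_withinE !near_simpl /= => -[d /= d0 Hd].
  exists d => //= s sd st.
  have := Hd (s - t); rewrite /= sub0r normrN distrC => /(_ sd).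
  rewrite subr_eq0 => /(_ st).
  by rewrite /diff_quot/= scaler1 subrK mulrC.
by rewrite fl.
Qed.

Definition cont_in f := forall t, I t -> f s @[s --> within I (t^')] --> f t.

Lemma interval_between s t u : I s -> I t -> s <= u <= t -> I u.
Proof. by move=> Is It; exact: I_itv. Qed.

Lemma cont_in_segment f s t : cont_in f -> I s -> I t ->
  {within `[s, t], continuous f}.
Proof.
move=> fc Is It; apply/subspace_continuousP => u /=; rewrite in_itv/= => sut.
have := fc _ (interval_between Is It sut).
move/cvgrPdist_lt => H; apply/cvgrPdist_lt => e e0; have := H e e0.
rewrite !near_withinE => -[d /= d0 Hd]; exists d => //= v vd /=.
rewrite in_itv/= => svt.
have [->|vu] := eqVneq v u; first by rewrite subrr normr0.
by apply: Hd => //; exact: interval_between svt.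
Qed.

(** Between [s] and [t] the derivative relative to [I] is the ordinary two-sided one, because a
    small enough increment stays in the segment; at the two ends only continuity is required by the
    classical mean value theorem. *)
Lemma der_in_MVT f (df : R -> R) s t : I s -> I t -> s < t ->
  (forall u, s <= u <= t -> der_in f u (df u)) ->
  exists2 c, s <= c <= t & f t - f s = df c * (t - s).
Proof.
move=> Is It st fd.
have contf : {within `[s, t], continuous f}.
  apply/subspace_continuousP => u /=; rewrite in_itv/= => sut.
  have /der_in_cvg := fd _ sut.
  move/cvgrPdist_lt => H; apply/cvgrPdist_lt => e e0; have := H e e0.
  rewrite !near_withinE => -[d /= d0 Hd]; exists d => //= v vd /=.
  rewrite in_itv/= => svt.
  have [->|vu] := eqVneq v u; first by rewrite subrr normr0.
  by apply: Hd => //; exact: interval_between svt.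
have [u|u] := @MVT R f df s t st _ contf; last first.
  by rewrite in_itv/= => /andP[su ut] ->; exists u => //; rewrite !ltW.
rewrite in_itv/= => /andP[su ut].
have du : h^-1 *: ((f \o shift u) (h *: 1) - f u) @[h --> 0^'] --> (df u : R).
  have sut : s <= u <= t by rewrite !ltW.
  have := fd _ sut; move/cvgrPdist_lt => H; apply/cvgrPdist_lt => e e0.
  have := H e e0; rewrite !near_withinE => -[d /= d0 Hd].
  exists (Num.min d (Num.min (u - s) (t - u))) => /=.
    by rewrite !lt_min d0 !subr_gt0 su.
  move=> h /=; rewrite sub0r normrN !lt_min => /and3P[hd h1 h2] h0.
  have := Hd (h + u); rewrite /diff_quot addrK /= !scaler1 mulrC.
  apply => //.
  - by rewrite opprD addrCA subrr addr0 normrN.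
  - by rewrite -subr_eq0 addrK.
  - move: h1 h2; rewrite !lter_norml => /andP[? ?] /andP[? ?].
    by apply: (interval_between Is It); apply/andP; split; lra.
by split; [apply/cvg_ex; exists (df u)|exact: cvg_lim].
Qed.

Lemma der_in_const f : (forall t, I t -> der_in f t 0) ->
  forall s t, I s -> I t -> f s = f t.
Proof.
move=> f0.
suff H s t : I s -> I t -> s < t -> f s = f t.
  move=> s t Is It; have [st|ts|->//] := ltgtP s t; first exact: H.
  by rewrite (H t s).
move=> Is It st; have [|c _] := @der_in_MVT f (fun=> 0) s t Is It st.
  by move=> u sut; apply: f0; exact: interval_between sut.
by rewrite mul0r => /eqP; rewrite subr_eq0 => /eqP.
Qed.

(** The mean value theorem is applied to [g + f] and to [g - f], whose derivatives are nonnegative.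
    A variable bound [dg] is allowed so that exponential weights can be integrated. *)
Lemma der_in_le f g (df dg : R -> R) s t : I s -> I t -> s <= t ->
  (forall u, s <= u <= t -> der_in f u (df u)) ->
  (forall u, s <= u <= t -> der_in g u (dg u)) ->
  (forall u, s <= u <= t -> `|df u| <= dg u) ->
  `|f t - f s| <= g t - g s.
Proof.
move=> Is It; rewrite le_eqVlt => /predU1P[->|st] fd gd fg.
  by rewrite !subrr normr0.
have ts : 0 <= t - s by rewrite subr_ge0 ltW.
have nfd u : s <= u <= t -> der_in (fun u => - 1 * f u) u (- 1 * df u).
  by move=> sut; apply: der_inZ; exact: fd.
rewrite ler_norml; apply/andP; split.
  have [c sct E] :=
    der_in_MVT Is It st (fun u h => der_inD (gd u h) (fd u h)).
  have : 0 <= (dg c + df c) * (t - s).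
    rewrite mulr_ge0//; have := fg _ sct; rewrite ler_norml => /andP[? ?].
    by lra.
  by rewrite -E; lra.
have [c sct E] :=
  der_in_MVT Is It st (fun u h => der_inD (gd u h) (nfd u h)).
have : 0 <= (dg c + - 1 * df c) * (t - s).
  rewrite mulr_ge0//; have := fg _ sct; rewrite ler_norml => /andP[? ?].
  by lra.
by rewrite -E; lra.
Qed.

Lemma der_in_lipschitz f (df : R -> R) (M : R) s t : I s -> I t ->
  (forall u, I u -> der_in f u (df u)) ->
  (forall u, s <= u <= t \/ t <= u <= s -> `|df u| <= M) ->
  `|f t - f s| <= M * `|t - s|.
Proof.
have H a b : I a -> I b -> a <= b -> (forall u, I u -> der_in f u (df u)) ->
    (forall u, a <= u <= b -> `|df u| <= M) -> `|f b - f a| <= M * `|b - a|.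
  move=> Ia Ib ab fd fM; rewrite (@ger0_norm _ (b - a)) ?subr_ge0//.
  have Iu u : a <= u <= b -> I u by exact: interval_between.
  have := @der_in_le f (fun u => M * u) df (fun=> M * 1) a b Ia Ib ab.
  rewrite -mulrBr; apply => // u aub.
  - by apply: fd; exact: Iu.
  - by apply: der_inZ; apply: der_in_id; exact: Iu.
  - by rewrite mulr1 fM.
move=> Is It fd fM; have [st|ts] := leP s t.
  by apply: H => // u u1; apply: fM; left.
by rewrite distrC (distrC t); apply: H => //; [exact: ltW|
  move=> u u1; apply: fM; right].
Qed.

(* The first [n.+1] derivatives exist on [I]. *)
Fixpoint cn (n : nat) (f : R -> R) : Prop :=
  (forall t, I t -> exists l, der_in f t l) /\
  (if n is m.+1 then cn m (derive_in I f) else True).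

(** Counting derivatives is what permits induction: the derivative of a product involves the factors
    themselves, which are controlled to one order more than the derivative needs. *)
Lemma smooth_cn f : smooth_in I f <-> forall n, cn n f.
Proof.
split=> [fs n|fs n].
  elim: n f fs => [|n IH] f fs.
    by split=> // t It; have /cvg_ex := fs 0%N t It.
  split; first by move=> t It; have /cvg_ex := fs 0%N t It.
  by apply: IH => m t It; have := fs m.+1 t It; rewrite iterSr.
elim: n f fs => [|n IH] f fs t It.
  by have [/(_ t It)[l fl] _] := fs 0%N; apply/cvg_ex; exists l.
by rewrite iterSr; apply: IH => // m; have [_] := fs m.+1.
Qed.

Lemma cnW n f : cn n.+1 f -> cn n f.
Proof.
elim: n f => [|n IH] f [fd fs]; first by split.
by split=> //; apply: IH.
Qed.

Lemma cn_der n f : cn n f -> forall t, I t -> der_in f t (derive_in I f t).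
Proof.
case: n => [|n] [fd _] t It; have [l fl] := fd t It;
  by rewrite (der_in_derive It fl).
Qed.

Lemma cn_ext n f g : {in I, f =1 g} -> cn n f -> cn n g.
Proof.
elim: n f g => [|n IH] f g fg [fd fs]; split => //.
- by move=> t It; have [l fl] := fd t It; exists l; exact: der_in_ext fl.
- by move=> t It; have [l fl] := fd t It; exists l; exact: der_in_ext fl.
apply: IH fs => t; rewrite inE => It; have [l fl] := fd t It.
by rewrite (der_in_derive It fl) (der_in_derive It (der_in_ext It fg fl)).
Qed.

Lemma cnS n f df : (forall t, I t -> der_in f t (df t)) -> cn n df -> cn n.+1 f.
Proof.
move=> fd dfs; split; first by move=> t It; exists (df t); exact: fd.
apply: cn_ext dfs => t; rewrite inE => It.
by rewrite (der_in_derive It (fd t It)).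
Qed.

Lemma cn_cst n c : cn n (fun=> c).
Proof.
elim: n c => [|n IH] c; first by split=> // t It; exists 0; exact: der_in_cst.
by apply: (@cnS _ _ (fun=> 0)) => // t It; exact: der_in_cst.
Qed.

Lemma cnD n f g : cn n f -> cn n g -> cn n (fun t => f t + g t).
Proof.
elim: n f g => [|n IH] f g fs gs.
  split=> // t It; eexists.
  by apply: der_inD; [exact: cn_der fs _ _|exact: cn_der gs _ _].
apply: (@cnS _ _ (fun t => derive_in I f t + derive_in I g t)).
  by move=> t It; apply: der_inD; [exact: cn_der fs _ _|exact: cn_der gs _ _].
by apply: IH; [case: fs|case: gs].
Qed.

Lemma cnM n f g : cn n f -> cn n g -> cn n (fun t => f t * g t).
Proof.
elim: n f g => [|n IH] f g fs gs.
  split=> // t It; eexists.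
  by apply: der_inM; [exact: cn_der fs _ _|exact: cn_der gs _ _].
apply: (@cnS _ _ (fun t => derive_in I f t * g t + f t * derive_in I g t)).
  by move=> t It; apply: der_inM; [exact: cn_der fs _ _|exact: cn_der gs _ _].
by apply: cnD; apply: IH; (try exact: cnW); [case: fs|case: gs].
Qed.

Lemma cn_sum n (J : Type) (r : seq J) (P : pred J) (F : J -> R -> R) :
  (forall j, P j -> cn n (F j)) -> cn n (fun t => \sum_(j <- r | P j) F j t).
Proof.
move=> H; elim: r => [|j r IH].
  by under [X in cn _ X]funext do rewrite big_nil; exact: cn_cst.
under [X in cn _ X]funext do rewrite big_cons.
by case Pj: (P j) => //; apply: cnD => //; exact: H.
Qed.

Lemma smooth_derivable f : smooth_in I f ->
  forall t, I t -> der_in f t (derive_in I f t).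
Proof. by move=> /smooth_cn /(_ 0%N); exact: cn_der. Qed.

Lemma smooth_derive f : smooth_in I f -> smooth_in I (derive_in I f).
Proof. by move=> /smooth_cn fs; apply/smooth_cn => n; case: (fs n.+1). Qed.

Lemma smooth_ext f g : {in I, f =1 g} -> smooth_in I f -> smooth_in I g.
Proof. by move=> fg /smooth_cn fs; apply/smooth_cn => n; exact: cn_ext (fs n). Qed.

Lemma smooth_cst c : smooth_in I (fun=> c).
Proof. by apply/smooth_cn => n; exact: cn_cst. Qed.

Lemma smoothM f g :
  smooth_in I f -> smooth_in I g -> smooth_in I (fun t => f t * g t).
Proof.
by move=> /smooth_cn fs /smooth_cn gs; apply/smooth_cn => n; exact: cnM.
Qed.

Lemma smooth_sum (J : Type) (r : seq J) (P : pred J) (F : J -> R -> R) :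
  (forall j, P j -> smooth_in I (F j)) ->
  smooth_in I (fun t => \sum_(j <- r | P j) F j t).
Proof.
move=> H; apply/smooth_cn => n; apply: cn_sum => j Pj.
by have /smooth_cn := H j Pj.
Qed.

(** Bootstrapping: a solution with a given order of regularity makes the right-hand side of that
    order, which raises the order of the solution by one. *)
Lemma smooth_linear_system (J : finType) (A : J -> J -> R -> R) (x : J -> R -> R) :
  (forall i j, smooth_in I (A i j)) ->
  (forall i t, I t -> der_in (x i) t (\sum_j A i j t * x j t)) ->
  forall i, smooth_in I (x i).
Proof.
move=> As xd i; apply/smooth_cn => n; elim: n i => [|n IH] i.
  by split=> // t It; eexists; exact: xd.
apply: cnS (xd i) _; apply: cn_sum => j _; apply: cnM => //.
by have /smooth_cn := As i j.
Qed.

(** * Curves in a finite-dimensional vector space *)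

Section VectorValued.
Variable V : vectType R.
Implicit Types (l m : R -> V) (v w : V).

Definition vder_in l t v := forall k, der_in (fun s => vcoord k (l s)) t (vcoord k v).

Lemma vcoordE v : v = \sum_k vcoord k v *: (vbasis {:V})`_k.
Proof. exact: coord_vbasis (memvf v). Qed.

Lemma vcoord_sum (c : 'I_(\dim {:V}) -> R) k :
  vcoord k (\sum_i c i *: (vbasis {:V})`_i) = c k.
Proof. by rewrite /vcoord coord_sum_free// (basis_free (vbasisP _)). Qed.

Lemma vcoord_eq v w : (forall k, vcoord k v = vcoord k w) -> v = w.
Proof.
by move=> H; rewrite (vcoordE v) (vcoordE w); apply: eq_bigr => k _; rewrite H.
Qed.

Lemma vder_in_derive l t v : I t -> vder_in l t v -> vderive_in I l t = v.
Proof.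
move=> It lv; rewrite [RHS]vcoordE; apply: eq_bigr => k _.
by rewrite (der_in_derive It (lv k)).
Qed.

Lemma vsmooth_derivable l : vsmooth_in I l ->
  forall t, I t -> vder_in l t (vderive_in I l t).
Proof.
by move=> ls t It k; rewrite vcoord_sum; exact: smooth_derivable (ls k) _ _.
Qed.

Lemma vsmooth_derive l : vsmooth_in I l -> vsmooth_in I (vderive_in I l).
Proof.
move=> ls k; apply: smooth_ext (smooth_derive (ls k)) => t _.
by rewrite /vderive_in vcoord_sum.
Qed.

Lemma vder_in_ext l m t v : I t -> {in I, l =1 m} -> vder_in l t v -> vder_in m t v.
Proof.
by move=> It lm lv k; apply: der_in_ext (lv k) => // s sI; rewrite lm.
Qed.

Lemma vder_in_scale f l t a v : der_in f t a -> vder_in l t v ->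
  vder_in (fun s => f s *: l s) t (a *: l t + f t *: v).
Proof.
move=> fa lv k; rewrite /vcoord linearD !linearZ.
under [X in der_in X]funext do rewrite linearZ.
exact: der_inM fa (lv k).
Qed.

Lemma vder_in_cst v t : vder_in (fun=> v) t 0.
Proof. by move=> k; rewrite /vcoord linear0; exact: der_in_cst. Qed.

Lemma vder_in_sum (J : Type) (r : seq J) (P : pred J) (F : J -> R -> V) t dF :
  (forall j, P j -> vder_in (F j) t (dF j)) ->
  vder_in (fun s => \sum_(j <- r | P j) F j s) t (\sum_(j <- r | P j) dF j).
Proof.
move=> H k; rewrite /vcoord linear_sum.
under [X in der_in X]funext do rewrite linear_sum.
by apply: der_in_sum => j Pj; exact: H.
Qed.

Lemma vsmooth_sum (J : Type) (r : seq J) (P : pred J) (F : J -> R -> V) :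
  (forall j, P j -> vsmooth_in I (F j)) ->
  vsmooth_in I (fun s => \sum_(j <- r | P j) F j s).
Proof.
move=> H k; rewrite /vcoord.
under [X in smooth_in _ X]funext do rewrite linear_sum.
by apply: smooth_sum => j Pj; exact: H.
Qed.

Lemma vsmooth_scale f l :
  smooth_in I f -> vsmooth_in I l -> vsmooth_in I (fun s => f s *: l s).
Proof.
move=> fs ls k; rewrite /vcoord.
under [X in smooth_in _ X]funext do rewrite linearZ.
exact: smoothM fs (ls k).
Qed.

Lemma vsmooth_cst v : vsmooth_in I (fun=> v).
Proof. by move=> k; exact: smooth_cst. Qed.

End VectorValued.

Section Bilinear.
Variables (V : vectType R) (B : {bilinear V -> V -> R | *%R & *%R}).
Implicit Types (l m : R -> V) (v w : V).

Lemma bilinear_coord v w : B v w = \sum_i \sum_j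
  (vcoord i v * vcoord j w) * B (vbasis {:V})`_i (vbasis {:V})`_j.
Proof.
rewrite {1}(vcoordE v) linear_sumlz; apply: eq_bigr => i _.
rewrite {1}(vcoordE w) linear_sumr; apply: eq_bigr => j _.
by rewrite linearZlr/= mulrA.
Qed.

Lemma vder_in_bilinear l m t v w : vder_in l t v -> vder_in m t w ->
  der_in (fun s => B (l s) (m s)) t (B v (m t) + B (l t) w).
Proof.
move=> lv mw; rewrite !bilinear_coord -big_split/=.
under [X in der_in X]funext do rewrite bilinear_coord.
apply: der_in_sum => i _; rewrite -big_split/=; apply: der_in_sum => j _.
rewrite -mulrDl mulrC; under [X in der_in X]funext do rewrite mulrC.
by apply: der_inZ; exact: der_inM.
Qed.

Lemma vsmooth_bilinear l m : vsmooth_in I l -> vsmooth_in I m ->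
  smooth_in I (fun s => B (l s) (m s)).
Proof.
move=> ls ms; under [X in smooth_in _ X]funext do rewrite bilinear_coord.
apply: smooth_sum => i _; apply: smooth_sum => j _.
by apply: smoothM; [exact: smoothM|exact: smooth_cst].
Qed.

End Bilinear.

Lemma smooth_linear_form (V : vectType R) (h : {linear V -> R^o}) (l : R -> V) :
  vsmooth_in I l -> smooth_in I (fun s => h (l s)).
Proof.
move=> ls.
apply: (@smooth_ext (fun s => \sum_k vcoord k (l s) * h (vbasis {:V})`_k)).
  move=> s _; rewrite [in RHS](vcoordE (l s)) linear_sum.
  by apply: eq_bigr => k _; rewrite linearZ.
by apply: smooth_sum => k _; apply: smoothM; [|exact: smooth_cst].
Qed.

End DerivativesOnAnInterval.

(** * Linear differential equations *)

Section LinearODE.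
Variables (R : realType) (I : set R).
Hypothesis I_itv : is_interval I.
Hypothesis I_nontriv : exists s t, [/\ I s, I t & s < t].
Implicit Types (f g : R -> R) (t : R).

Notation der_in := (der_in I).
Notation cont_in := (cont_in I).

Lemma primitive_right f (a : R) : continuous f ->
  exists P : R -> R, forall x, a < x -> is_derive x 1 P (f x).
Proof.
move=> fc; exists (fun x => \int[@lebesgue_measure R]_(t in `[a, x]) f t).
move=> x ax.
have xx1 : x < x + 1 by rewrite ltrDl.
have fi : (@lebesgue_measure R).-integrable `[a, x + 1] (EFin \o f).
  apply: continuous_compact_integrable; first exact: segment_compact.
  exact: continuous_subspaceT.
have [Fd Fe] := continuous_FTC1_closed xx1 fi ax (fc x).
by apply: (DeriveDef Fd); rewrite -derive1E; exact: Fe.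
Qed.

(** Local statements at [t] can thus be proved on a compact segment that also contains the base
    point [t0]. If [t] is an end of [I], it is also allowed to be an end of the segment, since
    nearness is relative to [I]. *)
Lemma near_segment t0 t : I t0 -> I t -> exists a b, [/\ I a, I b,
  a <= t0 <= b, a <= t <= b & \forall s \near within I (t^'), a <= s <= b].
Proof.
move=> It0 It.
have [b [Ib tb t0b nb]] : exists b, [/\ I b, t <= b, t0 <= b &
    \forall s \near within I (t^'), s <= b].
  have [[u [Iu tu]]|H] := pselect (exists u, I u /\ t < u).
    exists (Num.max u t0); rewrite !le_max (ltW tu) lexx orbT; split=> //.
      by rewrite /Num.max; case: ifP.
    rewrite near_withinE; exists (u - t) => /=; first by rewrite subr_gt0.
    move=> s /= st _ _; rewrite le_max; apply/orP; left.
    by move: st; rewrite distrC => /ltr_normlW; lra.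
  have I_max s : I s -> s <= t.
    by move=> Is; rewrite leNgt; apply/negP => ts; apply: H; exists s.
  exists t; split=> //; first exact: I_max.
  by rewrite near_withinE; near=> s => Is; exact: I_max.
have [a [Ia ta t0a na]] : exists a, [/\ I a, a <= t, a <= t0 &
    \forall s \near within I (t^'), a <= s].
  have [[u [Iu tu]]|H] := pselect (exists u, I u /\ u < t).
    exists (Num.min u t0); rewrite !ge_min (ltW tu) lexx orbT; split=> //.
      by rewrite /Num.min; case: ifP.
    rewrite near_withinE; exists (t - u) => /=; first by rewrite subr_gt0.
    move=> s /= st _ _; rewrite ge_min; apply/orP; left.
    by move: st => /ltr_normlW; lra.
  have I_min s : I s -> t <= s.
    by move=> Is; rewrite leNgt; apply/negP => ts; apply: H; exists s.
  exists t; split=> //; first exact: I_min.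
  by rewrite near_withinE; near=> s => Is; exact: I_min.
exists a, b; split; rewrite ?t0a ?ta//.
by near=> s; apply/andP; split; near: s.
Unshelve. all: by end_near. Qed.

Lemma norm_max_sub (a x y : R) : `|Num.max a x - Num.max a y| <= `|x - y|.
Proof.
have := ler_norm (x - y); have := ler_norm (y - x); rewrite distrC.
move: (`|_|) => n h1 h2; rewrite ler_norml.
by case: (ltP a x) => ?; case: (ltP a y) => ?; apply/andP; split; lra.
Qed.

Lemma norm_min_sub (a x y : R) : `|Num.min a x - Num.min a y| <= `|x - y|.
Proof.
have := ler_norm (x - y); have := ler_norm (y - x); rewrite distrC.
move: (`|_|) => n h1 h2; rewrite ler_norml.
by case: (ltP a x) => ?; case: (ltP a y) => ?; apply/andP; split; lra.
Qed.

(** Composing with the retraction [clamp] of the line onto the segment, which is 1-Lipschitz,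
    extends [f] to a continuous function on the whole line; the fundamental theorem of calculus then
    applies. *)
Lemma primitive_segment f a b : cont_in f -> I a -> I b -> a <= b ->
  exists P : R -> R, forall t, a <= t <= b -> der_in P t (f t).
Proof.
move=> fc Ia Ib ab.
pose clamp x := Num.max a (Num.min b x).
have clampI x : a <= clamp x <= b.
  by rewrite /clamp le_max lexx/= ge_max ab ge_min lexx.
have clampE x : a <= x <= b -> clamp x = x.
  by move=> /andP[ax xb]; rewrite /clamp min_r// max_r.
have clampL x y : `|clamp x - clamp y| <= `|x - y|.
  exact: le_trans (norm_max_sub _ _ _) (norm_min_sub _ _ _).
have cc : continuous (f \o clamp).
  move=> x; have := fc _ (interval_between I_itv Ia Ib (clampI x)).
  move/cvgrPdist_lt => H; apply/cvgrPdist_lt => e e0; have := H e e0.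
  rewrite near_withinE => -[d /= d0 Hd]; exists d => //= v vd /=.
  have [->|vu] := eqVneq (clamp v) (clamp x); first by rewrite subrr normr0.
  apply: Hd => //=; first exact: le_lt_trans (clampL _ _) vd.
  exact (interval_between I_itv Ia Ib (clampI v)).
(* Integration starts at [a - 1] because the primitive is differentiable only strictly to the right
   of its base point, and [a] has to be included. *)
have [P PE] := primitive_right (a - 1) cc.
exists P => t atb; apply: is_derive_der_in.
have : a - 1 < t by case/andP: atb; lra.
by move=> /PE /=; rewrite clampE.
Qed.

Lemma primitive_ex f t0 : cont_in f -> I t0 ->
  exists P : R -> R, P t0 = 0 /\ forall t, I t -> der_in P t (f t).
Proof.
move=> fc It0.
pose S a b := [set P : R -> R | forall t, a <= t <= b -> der_in P t (f t)].
pose P a b : R -> R := get (S a b).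
have PE a b : I a -> I b -> a <= b ->
    forall t, a <= t <= b -> der_in (P a b) t (f t).
  move=> Ia Ib ab; have [Q QE] := primitive_segment fc Ia Ib ab.
  by apply: (@getPex _ (S a b)); exists Q.
(* The value at [x] uses a primitive chosen on the segment between [t0] and [x]. Primitives chosen
   on different segments differ by a constant, which subtracting the value at [t0] removes. *)
pose F x := P (Num.min t0 x) (Num.max t0 x) x - P (Num.min t0 x) (Num.max t0 x) t0.
exists F; split; first by rewrite /F subrr.
move=> t It; have [a [b [Ia Ib at0b atb nab]]] := near_segment It0 It.
have ab : a <= b by case/andP: atb; exact: le_trans.
have E s : I s -> a <= s <= b -> F s = P a b s - P a b t0.
  move=> Is asb; rewrite /F.
  set m := Num.min _ _; set M := Num.max _ _.
  have Im : I m by rewrite /m /Num.min; case: ifP.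
  have IM : I M by rewrite /M /Num.max; case: ifP.
  have ms : m <= s by rewrite ge_min lexx orbT.
  have m0 : m <= t0 by rewrite ge_min lexx.
  have sM : s <= M by rewrite le_max lexx orbT.
  have M0 : t0 <= M by rewrite le_max lexx.
  have mM := le_trans ms sM.
  have am : a <= m by rewrite le_min; case/andP: asb => ->; case/andP: at0b => ->.
  have Mb : M <= b by rewrite ge_max; case/andP: asb => _ ->; case/andP: at0b => _ ->.
  have sub u : m <= u <= M -> a <= u <= b.
    by case/andP => mu uM; rewrite (le_trans am)// (le_trans uM).
  have L u v : m <= u -> u <= v -> v <= M ->
      `|(P m M v + -1 * P a b v) - (P m M u + -1 * P a b u)| <= 0.
    move=> mu uv vM.
    have Iu : I u by apply: (interval_between I_itv Im IM); rewrite mu (le_trans uv).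
    have Iv : I v by apply: (interval_between I_itv Im IM); rewrite (le_trans mu).
    rewrite -(subrr (0 : R)).
    apply: (@der_in_le _ _ I_itv (fun v => P m M v + -1 * P a b v) (fun=> 0)
      (fun u => f u + -1 * f u) (fun=> 0) u v Iu Iv uv) => w /andP[uw wv].
    - have mwM : m <= w <= M by rewrite (le_trans mu)// (le_trans wv).
      apply: der_inD; first exact: PE.
      by apply: der_inZ; apply: PE => //; exact: sub.
    - exact: der_in_cst.
    - by rewrite mulN1r subrr normr0.
  have [t0s|st0] := leP t0 s.
    by have := L t0 s m0 t0s sM; rewrite normr_le0 => /eqP; lra.
  by have := L s t0 ms (ltW st0) M0; rewrite normr_le0 => /eqP; lra.
have : der_in (fun s => P a b s - P a b t0) t (f t + 0).
  by apply: der_inD; [exact: PE|exact: der_in_cst].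
rewrite addr0; apply: cvg_trans; apply: near_eq_cvg.
have Ft := E t It atb.
near=> s; rewrite /diff_quot Ft E//; first by near: s; exact: withinT.
by near: s.
Unshelve. all: by end_near. Qed.


Lemma cont_inD f g : cont_in f -> cont_in g -> cont_in (fun t => f t + g t).
Proof. by move=> fc gc t It; apply: cvgD; [exact: fc|exact: gc]. Qed.

Lemma cont_inM f g : cont_in f -> cont_in g -> cont_in (fun t => f t * g t).
Proof. by move=> fc gc t It; apply: cvgM; [exact: fc|exact: gc]. Qed.

Lemma cont_in_cst (c : R) : cont_in (fun=> c).
Proof. by move=> t It; exact: cvg_cst. Qed.

Lemma cont_in_sum (J : Type) (r : seq J) (P : pred J) (F : J -> R -> R) :
  (forall j, P j -> cont_in (F j)) -> cont_in (fun t => \sum_(j <- r | P j) F j t).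
Proof.
move=> H; elim: r => [|j r IH].
  by under [X in cont_in X]funext do rewrite big_nil; exact: cont_in_cst.
under [X in cont_in X]funext do rewrite big_cons.
by case Pj: (P j) => //; apply: cont_inD => //; exact: H.
Qed.

Lemma cont_in_bounded f a b : cont_in f -> I a -> I b -> a <= b ->
  exists M : R, forall t, a <= t <= b -> `|f t| <= M.
Proof.
move=> fc Ia Ib ab.
have [|c cab cM] := @EVT_max R (fun t => `|f t|) a b ab.
  apply: (cont_in_segment I_itv) Ia Ib => t It.
  exact: cvg_norm (fc t It).
by exists `|f c| => t tab; apply: cM; rewrite in_itv.
Qed.

Lemma geometric_lim (u : nat -> R) (c : R) :
  (forall k, `|u k.+1 - u k| <= c / 2 ^+ k) ->
  forall n, `|limn u - u n| <= 2 * c / 2 ^+ n.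
Proof.
move=> uc.
have p2 n : 0 < 2 ^+ n :> R by rewrite exprn_gt0.
(* The subtracted term makes the induction on [m] close: it is the part of the geometric series not
   yet summed. *)
have um n m : `|u (n + m)%N - u n| <= 2 * c / 2 ^+ n - 2 * c / 2 ^+ (n + m).
  elim: m => [|m IH]; first by rewrite addn0 !subrr normr0.
  rewrite addnS; have := ler_normD (u (n + m).+1 - u (n + m)%N) (u (n + m)%N - u n).
  rewrite addrA subrK => /le_trans; apply.
  apply: le_trans (lerD (uc _) IH) _; rewrite exprS invfM.
  by move: (_ ^+ _)^-1 (_ ^+ _)^-1 => x y; lra.
have c0 : 0 <= c.
  by have := uc 0%N; rewrite expr0 divr1; apply: le_trans.
have um' n m : `|u (n + m)%N - u n| <= 2 * c / 2 ^+ n.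
  apply: le_trans (um n m) _.
  by rewrite lerBlDr lerDl divr_ge0// ?mulr_ge0// ltW.
have cz : (fun n => 2 * c / 2 ^+ n) n @[n --> \oo] --> (0 : R).
  have := @cvg_geometric R (2 * c) 2^-1; rewrite /geometric/=.
  under [X in X @ _]funext do rewrite exprVn.
  by apply; rewrite ger0_norm//; lra.
have ucvg : cvgn u.
  apply/cauchy_cvgP/cauchyP => e e0.
  have [N _ HN] : \forall n \near \oo, `|2 * c / 2 ^+ n| < e.
    by move/cvgr0Pnorm_lt : cz => /(_ _ e0).
  exists (u N), N => //= m /= Nm.
  rewrite /ball/= distrC -(subnKC Nm); apply: le_lt_trans (um' N _) _.
  by have := HN N (leqnn _); apply: le_lt_trans; exact: ler_norm.
move=> n; have L : (fun m => `|u m - u n|) m @[m --> \oo] --> `|limn u - u n|.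
  by apply: cvg_norm; apply: cvgB => //; exact: cvg_cst.
rewrite -(cvg_lim _ L)//; apply: limr_le; first by apply/cvg_ex; eexists; exact: L.
by exists n => // m /= nm; rewrite -(subnKC nm); exact: um'.
Qed.

Lemma geometric_eq0 (x c : R) : (forall n, `|x| <= c / 2 ^+ n) -> x = 0.
Proof.
move=> xc; apply/eqP; rewrite -normr_le0.
have cz : (fun n => c / 2 ^+ n) n @[n --> \oo] --> (0 : R).
  have := @cvg_geometric R c 2^-1; rewrite /geometric/=.
  under [X in X @ _]funext do rewrite exprVn.
  by apply; rewrite ger0_norm//; lra.
rewrite -(cvg_lim _ cz)//; apply: limr_ge; first by apply/cvg_ex; exists 0.
exact: nearW.
Qed.


(** Picard iteration on all of [I]. Linearity gives a Lipschitz constant on every compact segment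
    around [t0], whatever the size of the solution, so the iterates converge uniformly on each such
    segment and no solution stops before the end of [I]. The limit is continuous, hence its Picard
    image makes sense, and the two coincide. *)
Lemma linear_ode (J : finType) (A : J -> J -> R -> R) (x0 : J -> R) t0 :
  (forall i j, cont_in (A i j)) -> I t0 -> exists x : J -> R -> R,
  (forall i, x i t0 = x0 i) /\
  forall i t, I t -> der_in (x i) t (\sum_j A i j t * x j t).
Proof.
move=> Ac It0.
(* Choice turns the primitive into a total operator, so that the iterates can be defined before they
   are known to be continuous. *)
have /choice[prim primE] (f : R -> R) : exists P : R -> R, cont_in f ->
    P t0 = 0 /\ forall t, I t -> der_in P t (f t).
  have [fc|nfc] := pselect (cont_in f); last by exists (fun=> 0).
  by have [P PE] := primitive_ex fc It0; exists P.
pose rhs (y : J -> R -> R) i t := \sum_j A i j t * y j t.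
pose S := fix S n : J -> R -> R := if n is m.+1
  then fun i t => x0 i + prim (rhs (S m) i) t else fun i _ => x0 i.
have rhsc y i : (forall j, cont_in (y j)) -> cont_in (rhs y i).
  by move=> yc; apply: cont_in_sum => j _; apply: cont_inM.
have der_cont f df : (forall t, I t -> der_in f t (df t)) -> cont_in f.
  by move=> fd t It; exact: der_in_cvg (fd t It).
have primd y i : (forall j, cont_in (y j)) -> forall t, I t ->
    der_in (fun t => x0 i + prim (rhs y i) t) t (rhs y i t).
  move=> yc t It; have [_ H] := primE _ (rhsc y i yc).
  by rewrite -[rhs y i t]add0r; apply: der_inD; [exact: der_in_cst|exact: H].
have Sc n i : cont_in (S n i).
  elim: n i => [|n IH] i; first exact: cont_in_cst.
  by apply: (der_cont _ (rhs (S n) i)) => t It; exact: primd.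
have SD n i t : I t -> der_in (S n.+1 i) t (rhs (S n) i t) by exact: primd.
have St0 n i : S n i t0 = x0 i.
  by case: n => //= n; have [-> _] := primE _ (rhsc _ i (Sc n)); rewrite addr0.
have rhsB y z i t : rhs y i t - rhs z i t = rhs (fun j t => y j t - z j t) i t.
  by rewrite /rhs -sumrB; apply: eq_bigr => j _; rewrite mulrBr.
have rhs_le a b : I a -> I b -> a <= b -> exists2 L : R, 0 < L &
    forall y (c : R) i t, a <= t <= b -> (forall j, `|y j t| <= c) ->
      `|rhs y i t| <= L * c.
  move=> Ia Ib ab.
  have [M HM] : exists M : R, forall t, a <= t <= b ->
      `|\sum_i \sum_j `|A i j t| | <= M.
    apply: cont_in_bounded => //; apply: cont_in_sum => i _.
    by apply: cont_in_sum => j _ t It; exact: cvg_norm (Ac i j t It).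
  have M0 : 0 <= M.
    by apply: le_trans (HM a _); rewrite ?lexx ?ab.
  exists (M + 1); first lra.
  move=> y c i t tab yc; apply: le_trans (ler_norm_sum _ _ _) _.
  have c0 : 0 <= c by exact: le_trans (yc i).
  apply: (@le_trans _ _ (\sum_j `|A i j t| * c)).
    by apply: ler_sum => j _; rewrite normrM ler_wpM2l.
  rewrite -mulr_suml ler_wpM2r//.
  apply: le_trans (_ : M <= _); last lra.
  apply: le_trans (HM _ tab); apply: le_trans (ler_norm _).
  rewrite [leRHS](bigD1 i)//= lerDl sumr_ge0// => k _.
  by rewrite sumr_ge0.
pose x i t := limn (fun n => S n i t).
have xS a b : I a -> I b -> a <= t0 <= b -> exists2 K : R, 0 <= K &
    forall n i t, a <= t <= b -> `|x i t - S n i t| <= K / 2 ^+ n.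
  move=> Ia Ib at0b; have ab : a <= b by case/andP: at0b; exact: le_trans.
  have [L L0 HL] := rhs_le a b Ia Ib ab.
  have [C HC] : exists C : R, forall t, a <= t <= b ->
      `|\sum_i `|S 1%N i t + -1 * S 0%N i t| | <= C.
    apply: cont_in_bounded => //; apply: cont_in_sum => i _.
    move=> t It; apply: cvg_norm; apply: cont_inD It => //.
    by apply: cont_inM => //; exact: cont_in_cst.
  have C0 : 0 <= C by apply: le_trans (HC a _); rewrite ?lexx ?ab.
  have expd (c u : R) :
      der_in (fun u => expR (c * (u - t0))) u (c * expR (c * (u - t0))).
    apply: is_derive_der_in.
    apply: is_derive_eq (is_derive1_comp (is_derive_expR _) _) _.
    by rewrite subr0 /GRing.scale/= mulr1 mulrC.
  (* The weight makes the Picard operator a contraction of ratio 1/2. *)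
  have DE n i t : a <= t <= b ->
      `|S n.+1 i t - S n i t| <= C / 2 ^+ n * expR (2 * L * `|t - t0|).
    elim: n i t => [|n IH] i t tab.
      rewrite expr0 divr1; apply: (@le_trans _ _ C); last first.
        rewrite ler_peMr// -expR0 ler_expR mulr_ge0// mulr_ge0//; exact: ltW.
      apply: le_trans (HC _ tab); apply: le_trans (ler_norm _).
      rewrite [leRHS](bigD1 i)//= mulN1r lerDl sumr_ge0// => k _.
    have Itb u : a <= u <= b -> I u by exact: interval_between.
    have fd u : a <= u <= b -> der_in (fun u => S n.+2 i u + -1 * S n.+1 i u) u
        (rhs (S n.+1) i u + -1 * rhs (S n) i u).
      by move=> uab; apply: der_inD; [|apply: der_inZ]; apply: SD; exact: Itb.
    have le_df u : a <= u <= b -> `|rhs (S n.+1) i u + -1 * rhs (S n) i u| <=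
        C / 2 ^+ n.+1 * (2 * L * expR (2 * L * `|u - t0|)).
      move=> uab; rewrite mulN1r rhsB.
      apply: le_trans (HL _ _ _ _ uab (fun j => IH j u uab)) _.
      rewrite exprS invfM; move: (_ ^+ _)^-1 (expR _) => y z.
      by rewrite le_eqVlt; apply/orP; left; apply/eqP; field.
    have q0 : 0 <= C / 2 ^+ n.+1 by rewrite divr_ge0// exprn_ge0.
    case/andP: (at0b) (tab) => at0 t0b /andP[ata tb].
    have [t0t|tt0] := leP t0 t.
      have sub u : t0 <= u <= t -> a <= u <= b.
        by case/andP => ? ?; rewrite (le_trans at0)//= (le_trans _ tb).
      have := @der_in_le _ _ I_itv _ (fun u => C / 2 ^+ n.+1 * expR (2 * L * (u - t0)))
         _ _ t0 t It0 (Itb _ tab) t0t (fun u h => fd u (sub u h))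
         (fun u h => der_inZ (expd (2 * L) u)).
      rewrite !St0 !mulN1r !subrr subr0 mulr0 expR0 (@ger0_norm _ (t - t0)) ?subr_ge0//.
      move=> /(_ _)/le_trans; apply; last by rewrite mulr1 lerBlDr lerDl.
      move=> u tut; have := le_df _ (sub u tut).
      by rewrite (@ger0_norm _ (u - t0))// subr_ge0; case/andP: tut.
    have sub u : t <= u <= t0 -> a <= u <= b.
      by case/andP => ? ?; rewrite (le_trans ata)//= (le_trans _ t0b).
    have := @der_in_le _ _ I_itv _
      (fun u => - (C / 2 ^+ n.+1) * expR (- (2 * L) * (u - t0)))
       _ _ t t0 (Itb _ tab) It0 (ltW tt0) (fun u h => fd u (sub u h))
       (fun u h => der_inZ (expd (- (2 * L)) u)).
    rewrite !St0 !mulN1r !subrr sub0r normrN mulr0 expR0.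
    rewrite (@ler0_norm _ (t - t0)) ?subr_le0; last exact: ltW.
    rewrite !mulNr mulr1 opprK mulrN => /(_ _)/le_trans; apply; last first.
      by rewrite addrC lerBlDr lerDl.
    move=> u tut; have := le_df _ (sub u tut).
    rewrite (@ler0_norm _ (u - t0)); last by rewrite subr_le0; case/andP: tut.
    by rewrite !mulNr !mulrN opprK.
  (* On the segment the weight is at most [expR (2 * L * (b - a))]; the factor 2 is the sum of the
     geometric series of ratio 1/2. *)
  exists (2 * (C * expR (2 * L * (b - a)))).
    by rewrite !mulr_ge0// expR_ge0.
  move=> n i t tab; apply: geometric_lim => k.
  apply: le_trans (DE _ _ _ tab) _; rewrite mulrAC ler_wpM2r ?invr_ge0 ?exprn_ge0//.
  rewrite ler_wpM2l// ler_expR ler_wpM2l//; first by rewrite mulr_ge0// ltW.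
  case/andP: at0b tab => ? ? /andP[? ?].
  by rewrite ler_norml; apply/andP; split; lra.
have xc i : cont_in (x i).
  move=> t It; have [a [b [Ia Ib at0b atb nab]]] := near_segment It0 It.
  have [K K0 HK] := xS a b Ia Ib at0b.
  apply/cvgrPdist_lt => e e0.
  have [n Hn] : exists n, K / 2 ^+ n < e / 3.
    apply: contrapT => /forallNP H.
    have : e / 3 = 0.
      apply: (@geometric_eq0 _ K) => n; rewrite ger0_norm ?divr_ge0//; last exact: ltW.
      by rewrite leNgt; apply/negP; exact: H.
    by move=> e30; lra.
  have Sn := Sc n i t It; move/cvgrPdist_lt: Sn => /(_ (e / 3)) Sn.
  near=> s.
  have sab : a <= s <= b by near: s.
  have h1 := le_lt_trans (HK n i t atb) Hn.
  have h2 := le_lt_trans (HK n i s sab) Hn.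
  have h3 : `|S n i t - S n i s| < e / 3 by near: s; apply: Sn; rewrite divr_gt0.
  rewrite [ltRHS](_ : e = e / 3 + e / 3 + e / 3); last by lra.
  rewrite (_ : _ - _ = (x i t - S n i t) + (S n i t - S n i s) + (S n i s - x i s)).
    apply: le_lt_trans (ler_normD _ _) (ltrD _ _); last by rewrite distrC.
    exact: le_lt_trans (ler_normD _ _) (ltrD h1 h3).
  by ring.
exists x; split=> [i|i t It].
  rewrite /x; under [X in limn X]funext do rewrite St0.
  by rewrite lim_cst.
have xE s : s \in I -> x0 i + prim (rhs x i) s = x i s.
  rewrite inE => Is.
  have [a [b [Ia Ib at0b asb _]]] := near_segment It0 Is.
  have ab : a <= b by case/andP: at0b; exact: le_trans.
  have [K K0 HK] := xS a b Ia Ib at0b.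
  have [L L0 HL] := rhs_le a b Ia Ib ab.
  have [P0 Pd] := primE _ (rhsc x i xc).
  apply/esym/eqP; rewrite -subr_eq0; apply/eqP.
  (* Both [x] and its Picard image are compared with the iterate of order [n.+1]: [K] comes from the
     convergence of the iterates, and [L * K * |s - t0|] from integrating the difference of the
     right-hand sides. *)
  apply: (@geometric_eq0 _ (K + L * K * `|s - t0|)) => n.
  have h1 : `|x i s - S n.+1 i s| <= K / 2 ^+ n.
    apply: le_trans (HK _ _ _ asb) _; rewrite ler_wpM2l// lef_pV2 ?posrE ?exprn_gt0//.
    by rewrite ler_eXn2l//; lra.
  have h2 : `|S n.+1 i s + -1 * (x0 i + prim (rhs x i) s) -
      (S n.+1 i t0 + -1 * (x0 i + prim (rhs x i) t0))| <=
      L * (K / 2 ^+ n) * `|s - t0|.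
    apply: (@der_in_lipschitz _ _ I_itv
      (fun s => S n.+1 i s + -1 * (x0 i + prim (rhs x i) s))
      (fun u => rhs (S n) i u + -1 * rhs x i u)) => //.
      move=> u Iu; apply: der_inD; first exact: SD.
      by apply: der_inZ; exact: primd.
    move=> u H; have uab : a <= u <= b.
      case/andP: at0b asb => h3 h4 /andP[h5 h6].
      by case: H => /andP[h7 h8]; rewrite ?(le_trans h3 h7) ?(le_trans h5 h7)
        ?(le_trans h8 h4) ?(le_trans h8 h6).
    rewrite mulN1r rhsB; apply: HL => // j.
    by rewrite distrC; exact: HK.
  rewrite St0 P0 addr0 !mulN1r subrr subr0 in h2.
  have := lerD h1 h2; have := ler_normD (x i s - S n.+1 i s)
    (S n.+1 i s - (x0 i + prim (rhs x i) s)).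
  rewrite addrA subrK => h3 h4; apply: le_trans h3 _.
  by apply: le_trans h4 _; rewrite mulrDl !mulrA (mulrAC _ _ `|_|) lexx.
apply: (@der_in_ext _ _ _ _ t _ It xE).
exact: primd.
Unshelve. all: by end_near. Qed.

End LinearODE.

(** * Symplectic and pseudo-Euclidean linear algebra *)

Section LinearAlgebra.
Variables (R : realType) (V : vectType R).
Implicit Types (U P N : {vspace V}) (q : V -> R) (u v x y z : V).

(** A span is obtained by choice among the least subspaces containing [A], so it is computed by
    exhibiting one; least subspaces are unique by antisymmetry of inclusion. *)
Lemma vspan_eq (A : set V) U : (forall v, A v -> v \in U) ->
  (forall U', (forall v, A v -> v \in U') -> (U <= U')%VS) -> vspan A = U.
Proof.
move=> AU Umin; rewrite /vspan.
set S := [set U : {vspace V} | _].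
have SU : S U by split.
have [A1 A2] : S (xget 0%VS S) by apply: xgetPex; exists U.
by apply/eqP; rewrite eqEsubv A2//= Umin.
Qed.

(** A negative definite subspace meets [P] trivially, so its dimension is at most the codimension of
    [P] in [U], which is the dimension of [N]; and [N] attains it. Nonnegativity on [P] suffices, so
    a radical can be absorbed there. *)
Lemma neg_index_split q U P N : (N <= U)%VS -> (P <= U)%VS ->
  (\dim P + \dim N = \dim U)%N -> (forall v, v \in P -> 0 <= q v) ->
  (forall v, v \in N -> v != 0 -> q v < 0) -> neg_index q U = \dim N.
Proof.
move=> NU PU dPN qP qN; apply/eqP; rewrite eqn_leq; apply/andP; split.
  apply/bigmax_leqP => k /asboolP[V' [V'U <- qV']].
  have : (\dim (V' + P) <= \dim U)%N by rewrite dimvS// subv_add V'U.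
  rewrite dimv_disjoint_sum; first by rewrite -dPN addnC leq_add2l.
  apply/eqP; rewrite -subv0; apply/subvP => v; rewrite memv_cap => /andP[vV' vP].
  rewrite memv0; apply/negPn/negP => v0.
  by have := qV' v vV' v0; rewrite ltNge qP.
have dNU : (\dim N < (\dim U).+1)%N by rewrite ltnS dimvS.
apply: (@leq_bigmax_cond _ _ (fun k : 'I_(\dim U).+1 => k : nat) (Ordinal dNU)).
by apply/asboolP; exists N.
Qed.

(** The Gram matrix factors as [M *m E *m M^T] with [E] diagonal and invertible. The vectors [y],
    dual to the forms [phi], give a left inverse of [M], so the rank is that of [E] even when [q]
    has a radical on [U]. *)
Lemma qrank_diag (T : finType) q U (phi : T -> V -> R) (eps : T -> R) (y : T -> V) :
  (forall u v, u \in U -> v \in U ->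
     polar q u v = \sum_b eps b * phi b u * phi b v) ->
  (forall b, linear_for *%R (phi b)) ->
  (forall b, eps b != 0) -> (forall b, y b \in U) ->
  (forall b b', phi b (y b') = (b == b')%:R) -> qrank q U = #|T|.
Proof.
move=> qE phil eps0 yU phiy.
pose M : 'M[R]_(\dim U, #|T|) := \matrix_(i, k) phi (enum_val k) (vbasis U)`_i.
pose E : 'M[R]_(#|T|) := diag_mx (\row_k eps (enum_val k)).
pose C : 'M[R]_(#|T|, \dim U) := \matrix_(k, i) coord (vbasis U) i (y (enum_val k)).
have CM : C *m M = 1%:M.
  apply/matrixP => k l; rewrite !mxE.
  under eq_bigr do rewrite !mxE.
  pose f := GRing.isLinear.Build _ _ _ _ (phi (enum_val l)) (phil _).
  pose phiL : {linear V -> R^o} := HB.pack (phi (enum_val l)) f.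
  transitivity (phiL (y (enum_val k))).
    rewrite [in RHS](coord_vbasis (yU _)) linear_sum.
    by apply: eq_bigr => i _; rewrite linearZ.
  by rewrite /= phiy (inj_eq enum_val_inj) eq_sym.
have GE : \matrix_(i < \dim U, j < \dim U) polar q (vbasis U)`_i (vbasis U)`_j
    = M *m (E *m M^T).
  apply/matrixP => i j; rewrite !mxE qE ?vbasis_mem ?mem_nth ?size_tuple//.
  rewrite (reindex_omap enum_val (fun b => Some (enum_rank b))) => [|b _]; last first.
    by rewrite /= enum_rankK.
  apply: eq_big => [k|k _]; first by rewrite /= enum_valK eqxx.
  rewrite !mxE (bigD1 k)//= big1 ?addr0 => [|l lk]; last first.
    by rewrite !mxE eq_sym (negPf lk) mulr0n mul0r.
  by rewrite /E !mxE eqxx mulr1n; ring.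
rewrite /qrank GE.
have MT : row_free M^T by apply/row_freeP; exists C^T; rewrite -trmx_mul CM trmx1.
have EU : E \in unitmx.
  rewrite unitmxE det_diag unitfE; apply/prodf_neq0 => k _.
  by rewrite !mxE.
rewrite mulmxA mxrankMfree//.
have EF : row_free E by rewrite row_free_unit.
rewrite mxrankMfree//; apply/eqP.
by apply: (introT row_fullP); exists C.
Qed.

(** The common step of the symplectic and pseudo-Euclidean Gram-Schmidt processes, with [p] the
    projection onto the part already built. A vector outside the span gives a nonzero [y] orthogonal
    to it; nondegeneracy gives a partner [z], and projecting [z] does not change its pairing with
    [y]. *)
Lemma complement_pair (eps : bool) (form : {hermitian V for eps & idfun})
  (s : seq V) (p : V -> V) : nondegenerate form -> (size s < \dim {:V})%N ->
  (forall v, p v \in span s) ->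
  (forall v u, u \in s -> form (v - p v) u = 0) ->
  exists y z, [/\ forall u, u \in s -> form y u = 0,
    forall u, u \in s -> form z u = 0 & form y z != 0].
Proof.
move=> nd ss ps po.
have [v vs] : exists v, v \notin span s.
  apply: contrapT => /forallNP H.
  have : (fullv <= span s)%VS.
    by apply/subvP => v _; apply/negPn/negP; exact: H.
  by move=> /dimvS; rewrite leqNgt (leq_ltn_trans (dim_span s)).
have y0 : v - p v != 0.
  by apply: contra vs; rewrite subr_eq0 => /eqP ->; exact: ps.
have [z yz] : exists z, form (v - p v) z != 0.
  apply: contrapT => /forallNP H; move/negP: y0; apply.
  rewrite -memv0; move/eqP: nd => <-; apply/mem_orthovP => w _.
  by apply/eqP/negPn/negP; exact: H.
exists (v - p v), (z - p z); split; [exact: po|exact: po|].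
rewrite linearBr/= (_ : form (v - p v) (p z) = 0) ?subr0//.
rewrite (coord_span (X := in_tuple s) (ps z)) linear_sumr big1// => i _.
by rewrite linearZr/= po ?mulr0// mem_nth.
Qed.


(** * Symplectic bases *)

Section Darboux.
Variable omega : {skew_symmetric V}.
Hypothesis nd : nondegenerate omega.

Lemma skewC u v : omega u v = - omega v u.
Proof. by rewrite hermC/= expr1 mulN1r. Qed.

Lemma skew0 u : omega u u = 0.
Proof. by have := skewC u u; lra. Qed.

Definition darboux_pairs (s : seq (V * V)) := forall i j,
  (i < size s)%N -> (j < size s)%N ->
  [/\ omega (nth 0 s i).1 (nth 0 s j).1 = 0, omega (nth 0 s i).2 (nth 0 s j).2 = 0 &
      omega (nth 0 s i).2 (nth 0 s j).1 = (i == j)%:R].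

Lemma darboux_pairs_ex n : (2 * n <= \dim {:V})%N ->
  exists2 s, size s = n & darboux_pairs s.
Proof.
elim: n => [|n IH] nV; first by exists [::].
have [|s sn sD] := IH; first lia.
pose e (i : 'I_n) := (nth 0 s i).1; pose f (i : 'I_n) := (nth 0 s i).2.
pose l := map fst s ++ map snd s.
(* With the convention [omega f e = 1], the coefficient of [v] on [e i] is [omega (f i) v] and that
   on [f i] is [- omega (e i) v]. *)
pose p v := \sum_i omega (f i) v *: e i - \sum_i omega (e i) v *: f i.
have el i : e i \in l by rewrite mem_cat /e map_f ?mem_nth ?sn.
have fl i : f i \in l by rewrite mem_cat /f orbC map_f ?mem_nth ?sn.
have efD (i j : 'I_n) : [/\ omega (e i) (e j) = 0, omega (f i) (f j) = 0,
    omega (f i) (e j) = (i == j)%:R & omega (e i) (f j) = - (i == j)%:R].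
  have [||h1 h2 h3] := sD i j; rewrite ?sn//; split=> //.
  by have [||_ _ h4] := sD j i; rewrite ?sn// skewC h4 eq_sym.
have pl v : p v \in span l.
  by apply: rpredB; apply: rpred_sum => i _; apply: rpredZ; exact: memv_span.
have po v u : u \in l -> omega (v - p v) u = 0.
  rewrite mem_cat => ul; rewrite /p linearBl/= linearBl/= !linear_sumlz/=.
  case/orP: ul => /(nthP 0)[i]; rewrite size_map sn => i_n <-;
    rewrite (nth_map 0) ?sn//.
    rewrite (bigD1 (Ordinal i_n))//= big1 ?addr0 => [|j ji]; last first.
      by rewrite linearZl/=; have [-> _ _ _] := efD j (Ordinal i_n); rewrite mulr0.
    rewrite linearZl/=; have [-> _ _ _] := efD (Ordinal i_n) (Ordinal i_n).
    rewrite mulr0 (bigD1 (Ordinal i_n))//= big1 ?addr0 => [|j ji]; last first.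
      rewrite linearZl/=; have [_ _ -> _] := efD j (Ordinal i_n).
      by rewrite (negPf ji) mulr0.
    rewrite linearZl/=; have [_ _ -> _] := efD (Ordinal i_n) (Ordinal i_n).
    by rewrite eqxx mulr1 sub0r opprK skewC addNr.
  rewrite (bigD1 (Ordinal i_n))//= big1 ?addr0 => [|j ji]; last first.
    rewrite linearZl/=; have [_ _ _ ->] := efD j (Ordinal i_n).
    by rewrite (negPf ji) oppr0 mulr0.
  rewrite linearZl/=; have [_ _ _ ->] := efD (Ordinal i_n) (Ordinal i_n).
  rewrite eqxx mulrN1 big1 => [|j ji]; last first.
    by rewrite linearZl/=; have [_ -> _ _] := efD j (Ordinal i_n); rewrite mulr0.
  by rewrite subr0 opprK skewC addNr.
have [|y [z [yl zl yz]]] := complement_pair nd _ pl po.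
  by rewrite size_cat !size_map sn; lia.
exists ((z, (omega y z)^-1 *: y) :: s) => /=; first by rewrite sn.
move=> [|i] [|j] //= i_n j_n.
- split; first exact: skew0.
    by rewrite linearZl/= linearZr/= skew0 !mulr0.
  by rewrite linearZl/= mulVf.
- have ej : (nth 0 s j).1 \in l by rewrite mem_cat map_f ?mem_nth.
  have fj : (nth 0 s j).2 \in l by rewrite mem_cat map_f ?mem_nth ?orbT.
  by split; rewrite ?linearZl/= ?zl// (yl _ ej, yl _ fj) mulr0.
- have ei : (nth 0 s i).1 \in l by rewrite mem_cat map_f ?mem_nth.
  have fi : (nth 0 s i).2 \in l by rewrite mem_cat map_f ?mem_nth ?orbT.
  split; rewrite skewC ?linearZl/= ?zl ?oppr0//.
  by rewrite (yl _ fi) mulr0 oppr0.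
- exact: sD.
Qed.

Lemma darboux_basis_ex (T : finType) : \dim {:V} = (2 * #|T|)%N ->
  exists e f : T -> V, forall a b,
  [/\ omega (e a) (e b) = 0, omega (f a) (f b) = 0 & omega (f a) (e b) = (a == b)%:R].
Proof.
move=> dV; have [|s sn sD] := @darboux_pairs_ex #|T|; first by rewrite dV.
exists (fun a => (nth 0 s (enum_rank a)).1), (fun a => (nth 0 s (enum_rank a)).2).
move=> a b; have [||-> -> ->] := sD (enum_rank a) (enum_rank b); rewrite ?sn//.
by rewrite (inj_eq val_inj) (inj_eq enum_rank_inj).
Qed.

End Darboux.

(** * Pseudo-orthonormal bases and the law of inertia *)

Section PseudoOrthonormal.
Variable b : {symmetric V}.
Hypothesis nd : nondegenerate b.

Lemma symC u v : b u v = b v u.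
Proof. by rewrite hermC/= expr0 mul1r. Qed.

Definition pseudo_orthonormal (s : seq V) :=
  pairwise (fun u v => b u v == 0) s && all (fun u => `|b u u| == 1) s.

Lemma pseudo_orthonormal_ortho s i j : pseudo_orthonormal s ->
  (i < size s)%N -> (j < size s)%N -> i != j -> b s`_i s`_j = 0.
Proof.
case/andP=> /(pairwiseP 0) so _ i_s j_s; rewrite neq_ltn => /orP[ij|ji].
  by apply/eqP; exact: so.
by rewrite symC; apply/eqP; exact: so.
Qed.

Lemma pseudo_orthonormal_norm s i : pseudo_orthonormal s ->
  (i < size s)%N -> `|b s`_i s`_i| = 1.
Proof. by case/andP=> _ /allP sn i_s; apply/eqP/sn/mem_nth. Qed.

Lemma pseudo_orthonormal_sum s (c : 'I_(size s) -> R) (j : 'I_(size s)) :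
  pseudo_orthonormal s ->
  b (\sum_i c i *: s`_i) s`_j = c j * b s`_j s`_j.
Proof.
move=> so; rewrite linear_sumlz (bigD1 j)//= big1 ?addr0 => [|i ij]; last first.
  by rewrite linearZl/= pseudo_orthonormal_ortho ?mulr0//.
by rewrite linearZl.
Qed.

Lemma pseudo_orthonormal_free s : pseudo_orthonormal s -> free s.
Proof.
move=> so; rewrite -[s]in_tupleE; apply/freeP => k k0 i.
have := pseudo_orthonormal_sum k i so.
rewrite k0 linear0l => /esym/eqP; rewrite mulf_eq0 => /orP[/eqP//|/eqP bi].
by have := pseudo_orthonormal_norm so (ltn_ord i); rewrite bi normr0 => /esym/eqP;
  rewrite oner_eq0.
Qed.

Lemma pseudo_orthonormal_ex n : (n <= \dim {:V})%N ->
  exists2 s, size s = n & pseudo_orthonormal s.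
Proof.
elim: n => [|n IH] nV; first by exists [::].
have [|s sn so] := IH; first exact: ltnW.
pose p v := \sum_(i < size s) (b v s`_i / b s`_i s`_i) *: s`_i.
have ps v : p v \in span s.
  by apply: rpred_sum => i _; apply: rpredZ; apply: memv_span; exact: mem_nth.
have po v u : u \in s -> b (v - p v) u = 0.
  move=> /(nthP 0)[i i_s <-].
  rewrite linearBl/= (pseudo_orthonormal_sum _ (Ordinal i_s))//= divfK ?subrr//.
  have := pseudo_orthonormal_norm so i_s.
  by apply: contra_eq_neq => ->; rewrite normr0 eq_sym oner_eq0.
have [|y [z [ys zs yz]]] := complement_pair nd _ ps po; first by rewrite sn.
(* If [y] and [z] are both isotropic, the square of [y + z] is twice [b y z], hence nonzero. *)
have [x xs xx] : exists2 x, forall u, u \in s -> b x u = 0 & b x x != 0.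
  have [yy|yy] := eqVneq (b y y) 0; last by exists y.
  have [zz|zz] := eqVneq (b z z) 0; last by exists z.
  exists (y + z) => [u us|]; first by rewrite linearDl/= ys// zs// addr0.
  rewrite linearDl/= !linearDr/= yy zz (symC z y) addr0 add0r -mulr2n.
  by rewrite mulrn_eq0.
pose w := (Num.sqrt `|b x x|)^-1 *: x.
exists (w :: s); first by rewrite /= sn.
case/andP: so => so1 so2; rewrite /pseudo_orthonormal pairwise_cons/= so1 so2 !andbT.
apply/andP; split.
  apply/allP => u us; rewrite linearZl/= (xs u us).
  by rewrite mulr0.
rewrite linearZl/= linearZr/= mulrA -invfM -expr2 sqr_sqrtr//.
by rewrite normrM normfV normr_id mulVf// normr_eq0.
Qed.

Lemma pseudo_orthonormal_filter (a : pred V) s :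
  pseudo_orthonormal s -> pseudo_orthonormal [seq x <- s | a x].
Proof.
case/andP => so sn; rewrite /pseudo_orthonormal all_filter pairwise_filter//=.
by apply: sub_all sn => x /= ->; rewrite implybT.
Qed.

Lemma pseudo_orthonormal_quad s v : pseudo_orthonormal s -> v \in span s ->
  b v v = \sum_(i < size s) coord (in_tuple s) i v ^+ 2 * b s`_i s`_i.
Proof.
move=> so vs; rewrite {1 2}(coord_span (X := in_tuple s) vs).
rewrite linear_sumr; apply: eq_bigr => i _.
by rewrite linearZr/= pseudo_orthonormal_sum// mulrA expr2.
Qed.

(** Sylvester's law: in a pseudo-orthonormal basis the vectors of square 1 and of square -1 span
    complementary subspaces on which the form is positive and negative definite, so the number of
    the latter is the negative index. *)
Lemma pseudo_orthonormal_iso (n m : nat) : \dim {:V} = n ->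
  neg_index (fun v => b v v) {:V} = m ->
  exists g : 'Hom('cV[R]_n, V), bijective g /\
    forall u v : 'cV[R]_n, b (g u) (g v) = inertia_form m u v.
Proof.
move=> Vn nim.
have [|s0 s0n so0] := @pseudo_orthonormal_ex n; first by rewrite Vn.
pose pos := [seq v <- s0 | b v v == 1]; pose neg := [seq v <- s0 | b v v == -1].
have posO := pseudo_orthonormal_filter (fun v => b v v == 1) so0.
have negO := pseudo_orthonormal_filter (fun v => b v v == -1) so0.
have szpn : (size pos + size neg = n)%N.
  rewrite !size_filter -s0n -(count_predC (fun v => b v v == 1) s0); congr (_ + _)%N.
  apply: eq_in_count => v vs /=; case/andP: so0 => _ /allP/(_ v vs).
  by rewrite eqr_norml ler01 andbT => /orP[/eqP ->|/eqP ->]; rewrite eqxx;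
    [rewrite -subr_eq0 opprK|rewrite -subr_eq0 -opprD oppr_eq0];
    rewrite -mulr2n pnatr_eq0.
have dimp : \dim (span pos) = size pos by apply/eqP; exact: pseudo_orthonormal_free.
have dimn : \dim (span neg) = size neg by apply/eqP; exact: pseudo_orthonormal_free.
have neg1 i : (i < size neg)%N -> b neg`_i neg`_i = -1.
  by move=> i_s; have := mem_nth 0 i_s; rewrite mem_filter => /andP[/eqP].
have pos1 i : (i < size pos)%N -> b pos`_i pos`_i = 1.
  by move=> i_s; have := mem_nth 0 i_s; rewrite mem_filter => /andP[/eqP].
have mE : m = size neg.
  rewrite -nim -dimn; apply: (@neg_index_split _ _ (span pos)); rewrite ?subvf//.
  - by rewrite dimp dimn szpn Vn.
  - move=> v /(pseudo_orthonormal_quad posO) ->; apply: sumr_ge0 => i _.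
    by rewrite pos1// mulr1 sqr_ge0.
  - move=> v vn v0; rewrite (pseudo_orthonormal_quad negO vn) lt_neqAle.
    have le0 : \sum_(i < size neg) coord (in_tuple neg) i v ^+ 2 * b neg`_i neg`_i <= 0.
      by apply: sumr_le0 => i _; rewrite neg1// mulrN1 oppr_le0 sqr_ge0.
    rewrite le0 andbT; apply: contra v0 => /eqP S0.
    have c0 i : coord (in_tuple neg) i v = 0.
      have S1 : \sum_(i < size neg) coord (in_tuple neg) i v ^+ 2 = 0.
        apply: oppr_inj; rewrite oppr0 -[RHS]S0 -sumrN; apply: eq_bigr => j _.
        by rewrite neg1// mulrN1.
      by apply/eqP; rewrite -sqrf_eq0; apply/eqP;
        apply: (psumr_eq0P _ S1) => // j _; exact: sqr_ge0.
    rewrite (coord_span (X := in_tuple neg) vn) big1// => i _.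
    by rewrite c0 scale0r.
(* The positive vectors come first, as in the diagonal of [inertia_mx]. *)
pose s := pos ++ neg.
have ssz : size s = n by rewrite size_cat szpn.
have snn i : (i < n)%N -> b s`_i s`_i = if (i < n - m)%N then 1 else -1.
  move=> i_n; rewrite nth_cat mE -szpn addnK; case: ltnP => [/pos1//|pi].
  by apply: neg1; rewrite ltn_subLR// szpn.
have so : pseudo_orthonormal s.
  rewrite /pseudo_orthonormal pairwise_cat all_cat.
  case/andP: posO => -> ->; case/andP: negO => -> ->; rewrite !andbT /=.
  apply/allrelP => u v; rewrite !mem_filter => /andP[/eqP u1 us] /andP[/eqP v1 vs].
  have [i i_s iu] := nthP 0 us; have [j j_s jv] := nthP 0 vs.
  rewrite -iu -jv pseudo_orthonormal_ortho//; apply: contraPneq u1 => ij.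
  by rewrite -iu ij jv v1 => /eqP; rewrite -subr_eq0 -opprD oppr_eq0 -mulr2n pnatr_eq0.
pose g0 (u : 'cV[R]_n) : V := \sum_i u i 0 *: s`_i.
have g0l : linear g0.
  move=> a u v; rewrite /g0 scaler_sumr -big_split/=; apply: eq_bigr => i _.
  by rewrite !mxE scalerDl scalerA.
pose gl := GRing.isLinear.Build _ _ _ _ g0 g0l.
pose gL : {linear 'cV[R]_n -> V} := HB.pack g0 gl.
have gE (u : 'cV[R]_n) : linfun gL u = g0 u by rewrite lfunE.
have gform (u v : 'cV[R]_n) : b (g0 u) (g0 v) = inertia_form m u v.
  rewrite /g0 linear_sumlz /inertia_form -mulmxA mxE; apply: eq_bigr => i _.
  rewrite linearZl/= linear_sumr !mxE; congr (_ * _).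
  rewrite (bigD1 i)//= big1 ?addr0 => [|j ji]; last first.
    by rewrite linearZr/= (pseudo_orthonormal_ortho so) ?mulr0 ?ssz// eq_sym.
  rewrite linearZr/= snn// (bigD1 i)//= big1 ?addr0 => [|j ji]; last first.
    by rewrite !mxE eq_sym (negPf ji) mul0r.
  by rewrite !mxE eqxx mulrC.
exists (linfun gL); split; last by move=> u v; rewrite !gE gform.
have kg : lker (linfun gL) == 0%VS.
  rewrite -subv0; apply/subvP => u; rewrite memv_ker gE => /eqP gu.
  rewrite memv0 -memv0 -(eqP (@inertia_form_nondeg R n m)).
  by apply/mem_orthovP => v _; rewrite /= -gform gu linear0l.
have ig : limg (linfun gL) = fullv.
  apply/eqP; rewrite eqEdim subvf/= Vn.
  have := limg_ker_dim (linfun gL) fullv.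
  by rewrite (eqP kg) capv0 dimv0 add0n dimvf /dim/= muln1 => ->.
exists (linfun gL)^-1%VF; first exact: lker0_lfunK.
by move=> v; apply: limg_lfunVK; rewrite ig memvf.
Qed.

End PseudoOrthonormal.

End LinearAlgebra.

(** * Extensions and contractions of curves adapted to a moving frame *)

Lemma extension_ext (R : realType) (V : vectType R) (I : set R) n
    (L L' : R -> {vspace V}) t : (forall s, I s -> L s = L' s) ->
  extension I n L t = extension I n L' t.
Proof.
move=> LL'; rewrite /extension; suff -> : sections I L = sections I L' by [].
by apply/seteqP; split=> l [ls lL]; split=> // s Is; have := lL s Is; rewrite LL'.
Qed.

Lemma contraction1_ext (R : realType) (V : vectType R) (I : set R)
    (L L' : R -> {vspace V}) t : I t -> (forall s, I s -> L s = L' s) ->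
  contraction1 I L t = contraction1 I L' t.
Proof.
move=> It LL'; rewrite /contraction1 LL'//.
suff -> : sections I L = sections I L' by [].
by apply/seteqP; split=> l [ls lL]; split=> // s Is; have := lL s Is; rewrite LL'.
Qed.

Section Frames.
Variables (R : realType) (I : set R) (W : vectType R) (omega : {skew_symmetric W}).
Hypothesis I_itv : is_interval I.
Hypothesis I_nontriv : exists s t, [/\ I s, I t & s < t].
Variables (B : finType) (X Y : B -> R -> W) (A : B -> B -> R -> R).
Hypothesis X_smooth : forall b, vsmooth_in I (X b).
Hypothesis Y_smooth : forall b, vsmooth_in I (Y b).
Hypothesis XY_dual : forall t, I t -> forall b b', omega (Y b t) (X b' t) = (b == b')%:R.
Hypothesis dimW : \dim {:W} = #|B|.
Hypothesis X_der : forall t b, I t -> vder_in I (X b) t (\sum_g A b g t *: X g t).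

(** [Y] is the frame dual to [X] with respect to [omega], so this is the coordinate of [v] on
    [X b t]. *)
Definition fcoord b t (v : W) : R := omega (Y b t) v.

Lemma fcoord_sum t (k : B -> R) b : I t -> fcoord b t (\sum_g k g *: X g t) = k b.
Proof.
move=> It; rewrite /fcoord linear_sumr (bigD1 b)//= big1 ?addr0 => [|g gb].
  by rewrite linearZr/= XY_dual// eqxx mulr1.
by rewrite linearZr/= XY_dual// eq_sym (negPf gb) mulr0.
Qed.

Lemma frame_decomp t v : I t -> v = \sum_b fcoord b t v *: X b t.
Proof.
move=> It; pose T : #|B|.-tuple W := [tuple X (enum_val i) t | i < #|B|].
have TE (k : 'I_#|B| -> R) :
    \sum_i k i *: T`_i = \sum_b k (enum_rank b) *: X b t.
  rewrite [RHS](reindex (@enum_val B predT)) /=; last exact/onW_bij/enum_val_bij.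
  by apply: eq_bigr => i _; rewrite -[T`_i](tnth_nth 0) tnth_mktuple enum_valK.
have fT : free T.
  apply/freeP => k; rewrite TE => k0 i.
  have := @fcoord_sum t (fun b => k (enum_rank b)) (enum_val i) It.
  by rewrite k0 /fcoord linear0r enum_valK => <-.
have bT : basis_of fullv T by rewrite basisEfree fT subvf size_tuple dimW leqnn.
have := coord_basis bT (memvf v); rewrite TE => vE; rewrite vE.
by apply: eq_bigr => b _; rewrite fcoord_sum.
Qed.

Definition fspan (S : {set B}) t : {vspace W} := (\sum_(b in S) <[X b t]>)%VS.

Lemma mem_fspan (S : {set B}) t v : I t ->
  v \in fspan S t <-> forall b, b \notin S -> fcoord b t v = 0.
Proof.
move=> It; split.
  move=> /memv_sumP[w wS ->] b bS; rewrite /fcoord linear_sumr big1// => g gS.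
  have /vlineP[k ->] := wS g gS.
  rewrite linearZr/= XY_dual//; case: eqP => [bg|_]; last by rewrite mulr0.
  by rewrite bg gS in bS.
move=> H; rewrite (frame_decomp v It); apply: rpred_sum => b _.
have [bS|bS] := boolP (b \in S); last by rewrite H// scale0r rpred0.
by rewrite rpredZ//; apply: subvP (memv_line _); apply: sumv_sup bS _.
Qed.

Lemma mem_fspan_frame (S : {set B}) t b : b \in S -> X b t \in fspan S t.
Proof. by move=> bS; apply: subvP (memv_line _); apply: sumv_sup bS _. Qed.

Lemma fspanS (S T : {set B}) t : S \subset T -> (fspan S t <= fspan T t)%VS.
Proof.
move=> ST; apply/subv_sumP => b bS; apply: (sumv_sup b) => //.
exact: (fintype.subsetP ST).
Qed.

(** The spans of [S] and of its complement have at most as many dimensions as generators, and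
    together they fill [W]; both bounds are therefore attained. *)
Lemma dim_fspan (S : {set B}) t : I t -> \dim (fspan S t) = #|S|.
Proof.
move=> It.
have le T : (\dim (fspan T t) <= #|T|)%N.
  rewrite -sum1_card; apply: leq_trans (dimv_leq_sum _ _ _) _.
  by apply: leq_sum => b _; rewrite dim_vline leq_b1.
apply/eqP; rewrite eqn_leq le/= -(leq_add2r #|~: S|) cardsC -dimW.
apply: (@leq_trans (\dim (fspan S t + fspan (~: S) t))).
  apply: dimvS; apply/subvP => v _; rewrite (frame_decomp v It).
  apply: rpred_sum => b _; apply: rpredZ.
  have [bS|bS] := boolP (b \in S).
    by apply: subvP (addvSl _ _) _ _; exact: mem_fspan_frame.
  by apply: subvP (addvSr _ _) _ _; apply: mem_fspan_frame; rewrite finset.in_setC.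
apply: leq_trans (dimv_add_leqif _ _) _; rewrite leq_add2l; exact: le.
Qed.

Lemma fcoord_smooth b l : vsmooth_in I l -> smooth_in I (fun t => fcoord b t (l t)).
Proof. by move=> ls; exact: vsmooth_bilinear. Qed.

(** The Leibniz rule in the moving frame. Where a coordinate of the section vanishes identically,
    its derivative term disappears and the value is read off [A] alone; all computations of
    extensions, contractions and velocity use it in this way. *)
Lemma fcoord_vderive l t b : I t -> vsmooth_in I l ->
  fcoord b t (vderive_in I l t) =
  derive_in I (fun s => fcoord b s (l s)) t + \sum_g fcoord g t (l t) * A g b t.
Proof.
move=> It ls.
have dl : vder_in I l t (\sum_g (derive_in I (fun s => fcoord g s (l s)) t *: X g t
    + fcoord g t (l t) *: \sum_d A g d t *: X d t)).
  apply: (@vder_in_ext _ _ _ (fun s => \sum_g fcoord g s (l s) *: X g s)) => //.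
    by move=> s; rewrite inE => Is; rewrite -frame_decomp.
  apply: vder_in_sum => g _; apply: vder_in_scale; last exact: X_der.
  apply: smooth_derivable It => //; exact: fcoord_smooth.
rewrite (vder_in_derive I_itv I_nontriv It dl) big_split/= /fcoord linearDr/=.
congr (_ + _); first exact: fcoord_sum.
under eq_bigr do rewrite scaler_sumr.
rewrite exchange_big/=.
under eq_bigr do (under eq_bigr do rewrite scalerA; rewrite -scaler_suml).
exact: fcoord_sum.
Qed.

Lemma derive_in0 t : I t -> derive_in I (fun=> 0) t = 0 :> R.
Proof. by move=> It; apply: der_in_derive => //; exact: der_in_cst. Qed.

Lemma derive_in_ext (f g : R -> R) t : I t -> {in I, f =1 g} -> smooth_in I f ->
  derive_in I f t = derive_in I g t.
Proof.
move=> It fg fs; apply/esym/der_in_derive => //; apply: der_in_ext fg _ => //.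
exact: smooth_derivable.
Qed.

Lemma fspan_derive (S S' : {set B}) l : sections I (fspan S) l -> S \subset S' ->
  (forall t b g, I t -> b \in S -> g \notin S' -> A b g t = 0) ->
  sections I (fspan S') (vderive_in I l).
Proof.
move=> [ls lS] SS' AS; split; first exact: vsmooth_derive.
move=> t It; apply/mem_fspan => // b bS'; rewrite fcoord_vderive//.
have bS : b \notin S by apply: contra bS'; exact: (fintype.subsetP SS').
rewrite -(@derive_in_ext (fun=> 0))//; [|move=> s|exact: smooth_cst]; last first.
  by rewrite inE => Is; apply/esym; move: b bS {bS'}; apply/mem_fspan => //; exact: lS.
rewrite derive_in0// add0r big1// => g _.
have [gS|gS] := boolP (g \in S); first by rewrite AS// mulr0.
have -> : fcoord g t (l t) = 0 by move: g gS; apply/mem_fspan => //; exact: lS.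
by rewrite mul0r.
Qed.

(** The second hypothesis bounds the extensions from above: one derivative leads from [S n] at most
    into [S n.+1]. The third bounds them from below: every new vector [X b] is, up to a nonzero
    constant and modulo the span of [S n], the derivative of a single vector of [S n]. The bound [N]
    serves filtrations that have this form for finitely many steps only. *)
Lemma extension_fspan N (S : nat -> {set B}) :
  (forall n, (n < N)%N -> S n \subset S n.+1) ->
  (forall n t b g, (n < N)%N -> I t -> b \in S n -> g \notin S n.+1 -> A b g t = 0) ->
  (forall n b, (n < N)%N -> b \in S n.+1 -> b \notin S n -> exists2 g, g \in S n &
     exists2 k : R, k != 0 & forall t d, I t -> d \notin S n ->
       A g d t = k * (d == b)%:R) ->
  forall n t, (n <= N)%N -> I t -> extension I n (fspan (S 0%N)) t = fspan (S n) t.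
Proof.
move=> Smono Sder Snew n t nN It.
have Smono' m n' : (m <= n')%N -> (n' <= N)%N -> S m \subset S n'.
  elim: n' => [|n' IH]; first by rewrite leqn0 => /eqP->.
  rewrite leq_eqVlt => /orP[/eqP -> //|]; rewrite ltnS => mn nN'.
  by apply: fintype.subset_trans (IH mn (ltnW nN')) (Smono _ nN').
have sec j l : (j <= N)%N -> sections I (fspan (S 0%N)) l ->
    sections I (fspan (S j)) (iter j (vderive_in I) l).
  elim: j => [//|j IH] jN ls /=.
  have := IH (ltnW jN) ls; move=> /fspan_derive; apply; first exact: Smono.
  by move=> s b g Is bS gS; apply: (Sder j).
(* The step preceding [S m], empty for [m = 0], so that the base case of the next claim is an exact
   equality with a frame vector. *)
pose Sp m := if m is m'.+1 then S m' else finset.set0.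
have SpS m : (m <= N)%N -> Sp m \subset S m.
  by case: m => [|m] mN; [exact: finset.sub0set|exact: Smono].
have SpA m s b g : (m <= N)%N -> I s -> b \in Sp m -> g \notin S m -> A b g s = 0.
  by case: m => [|m] mN Is; [rewrite finset.in_set0|exact: Sder].
(* Modulo the span of the previous step, a derivative of some section is a
   constant multiple of the frame vector [X b]. *)
have lead m b : (m <= N)%N -> b \in S m -> exists (k : R) j l, [/\ k != 0, (j <= m)%N,
    sections I (fspan (S 0%N)) l & forall s, I s -> forall g, g \notin Sp m ->
      fcoord g s (iter j (vderive_in I) l s) = k * (g == b)%:R].
  elim: m b => [|m IH] b mN bS.
    exists 1, 0%N, (X b); split=> //.
      by split=> // s Is; exact: mem_fspan_frame.
    by move=> s Is g _; rewrite /= /fcoord XY_dual// mul1r.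
  have [bSm|bSm] := boolP (b \in S m).
    have [k [j [l [k0 jm ls lE]]]] := IH b (ltnW mN) bSm.
    exists k, j, l; split=> // [|s Is g gS]; first exact: leqW.
    apply: lE => //; apply: contra gS; apply: (fintype.subsetP (SpS _ _)); exact: ltnW.
  have [c cS [k1 k10 Ac]] := Snew m b mN bS bSm.
  have [k [j [l [k0 jm ls lE]]]] := IH c (ltnW mN) cS.
  exists (k * k1), j.+1, l; split=> //; first by rewrite mulf_neq0.
  move=> s Is d /= dS.
  have dSp : d \notin Sp m.
    by apply: contra dS; apply: (fintype.subsetP (SpS _ _)); exact: ltnW.
  have dc : d == c = false by apply: contraNF dS => /eqP ->.
  have [sj _] := sec j l (leq_trans jm (ltnW mN)) ls.
  rewrite fcoord_vderive// -(@derive_in_ext (fun=> 0))//; [|move=> u|exact: smooth_cst];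
    last by rewrite inE => Iu; rewrite lE// dc mulr0.
  rewrite derive_in0// add0r (bigD1 c)//= big1 ?addr0 => [|g gc].
    (* If [c] belonged to the earlier step, [A c b] would have to vanish although it equals the
       nonzero [k1]. *)
    have [cSp|cSp] := boolP (c \in Sp m); last by rewrite lE// eqxx mulr1 Ac// mulrA.
    have [db|db] := eqVneq d b; last by rewrite Ac// (negPf db) !mulr0.
    have := SpA m s c d (ltnW mN) Is cSp dS.
    by rewrite Ac// db eqxx mulr1 => /eqP; rewrite (negPf k10).
  have [gSp|gSp] := boolP (g \in Sp m).
    by rewrite (SpA m)// ?mulr0// ltnW.
  by rewrite lE// (negPf gc) mulr0 mul0r.
apply: vspan_eq => [v [j [l [jn ls ->]]]|U' HU].
  have [_ H] := sec j l (leq_trans jn nN) ls.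
  by apply: subvP (H t It); apply: fspanS; exact: Smono'.
have step m : (m <= n)%N -> (fspan (Sp m) t <= U')%VS -> (fspan (S m) t <= U')%VS.
  move=> mn SpU; apply/subv_sumP => b bS.
  have [k [i [l [k0 im ls lE]]]] := lead m b (leq_trans mn nN) bS.
  (* The error made in replacing the derivative by [k *: X b t] lies in the previous step, which is
     already inside [U']. *)
  pose r := iter i (vderive_in I) l t - k *: X b t.
  have rU : r \in U'.
    apply: subvP SpU _ _; apply/mem_fspan => // g gS.
    rewrite /r /fcoord linearBr/= linearZr/= XY_dual//.
    by have := lE t It g gS; rewrite /fcoord => ->; rewrite subrr.
  have -> : X b t = k^-1 *: (iter i (vderive_in I) l t - r).
    by rewrite /r subKr scalerA mulVf// scale1r.
  rewrite -memvE rpredZ// rpredB//; apply: HU; exists i, l; split=> //.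
  exact: leq_trans im mn.
suff H m : (m <= n)%N -> (fspan (S m) t <= U')%VS by exact: H.
elim: m => [|m IH] mn; apply: step => //; last exact: IH (ltnW mn).
by rewrite /fspan/= big_set0 sub0v.
Qed.

(** Each [b] of [S] outside [T] leaks into some direction [d] outside [S] that receives nothing from
    the rest of [S]. So the [d]-coordinate of the derivative of a section is a nonzero multiple of
    its [b]-coordinate, which must vanish. Conversely, for [b] in [T] the frame vector itself is a
    section with derivative in the span. *)
Lemma contraction1_fspan (S T : {set B}) t : I t -> T \subset S ->
  (forall s b g, I s -> b \in T -> g \notin S -> A b g s = 0) ->
  (forall b, b \in S -> b \notin T -> exists2 d, d \notin S & exists2 k : R, k != 0 &
     forall s g, I s -> g \in S -> A g d s = k * (g == b)%:R) ->
  contraction1 I (fspan S) t = fspan T t.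
Proof.
move=> It TS AT AS; apply: vspan_eq => [v [vS [l [ls lt lS]]]|U' HU].
  apply/mem_fspan => // b bT; have [bS|bS] := boolP (b \in S); last first.
    by move: vS => /mem_fspan -/(_ It b bS).
  have [d dS [k k0 Ad]] := AS b bS bT.
  have lS' s g : I s -> g \notin S -> fcoord g s (l s) = 0.
    by case: ls => _ H Is; have := H s Is => /mem_fspan - /(_ Is g).
  have := lS => /mem_fspan - /(_ It d dS); case: (ls) => ls' _.
  rewrite fcoord_vderive// -(@derive_in_ext (fun=> 0))//; [|move=> u|exact: smooth_cst];
    last by rewrite inE => Iu; rewrite lS'.
  rewrite derive_in0// add0r (bigD1 b)//= big1 ?addr0 => [|g gb].
    by rewrite lt Ad// eqxx mulr1 => /eqP; rewrite mulf_eq0 (negPf k0) orbF => /eqP.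
  have [gS|gS] := boolP (g \in S); last by rewrite lS'// mul0r.
  by rewrite Ad// (negPf gb) !mulr0.
apply/subv_sumP => b bT; rewrite -memvE; apply: HU; split.
  by apply: mem_fspan_frame; exact: (fintype.subsetP TS).
exists (X b); split=> //.
  split=> // s Is; apply: mem_fspan_frame; exact: (fintype.subsetP TS).
rewrite (vder_in_derive I_itv I_nontriv It (@X_der t b It)).
apply: rpred_sum => g _.
have [gS|gS] := boolP (g \in S); first by apply: rpredZ; exact: mem_fspan_frame.
by rewrite AT// scale0r rpred0.
Qed.

End Frames.

(** * Boxes of a Young diagram *)

Section YoungDiagrams.
Variable D : young_diagram.
Implicit Types (x y : box D) (i j : 'I_(depth D)).

Lemma llength_lt i j : (i < j)%N -> (llength D j < llength D i)%N.
Proof.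
have sD : sorted gtn (undup D).
  rewrite gtn_sorted_uniq_geq undup_uniq/=.
  apply: (subseq_sorted _ (undup_subseq D)); last by case/andP: (yrowsP D).
  by move=> a b c /=; rewrite /geq => ba cb; exact: leq_trans cb ba.
move=> ij; apply: (sorted_ltn_nth _ 0%N sD) => //; try exact: ltn_ord.
by move=> a b c /= ba cb; exact: ltn_trans cb ba.
Qed.

Lemma llength_leq i j : (llength D i <= llength D j)%N = (j <= i)%N.
Proof.
apply/idP/idP; last by rewrite leq_eqVlt => /orP[/eqP/val_inj ->//|/llength_lt/ltnW].
by apply: contraTT; rewrite -!ltnNge; exact: llength_lt.
Qed.

Lemma sum_rows (f : nat -> nat) :
  (\sum_(r <- D) f r = \sum_(i < depth D) lheight D i * f (llength D i))%N.
Proof.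
rewrite -(big_undup_iterop_count addn _ xpredT) (big_nth 0%N) big_mkord.
by apply: eq_bigr => i _; rewrite Monoid.iteropE iter_addn_0 mulnC.
Qed.

(** Boxes are nested dependent pairs; level, column and index determine a box, and comparing these
    coordinates avoids type casts. *)
Definition blev x : 'I_(depth D) := level (tag x).
Definition bcol x : nat := column (tag x).
Definition bidx x : nat := tagged x.

Lemma bcol_lt x : (bcol x < llength D (blev x))%N.
Proof. exact: ltn_ord. Qed.

Lemma box_inj x y : blev x = blev y -> bcol x = bcol y -> bidx x = bidx y -> x = y.
Proof.
case: x => [[i c] k]; case: y => [[i' c'] k'].
rewrite /blev /bcol /bidx /level /column /= => ii; case: _ / ii c' k' => c' k' cc.
have -> : c = c' by exact: val_inj.
by move=> kk; congr (Tagged _ _); exact: val_inj.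
Qed.

Lemma card_boxes (P : 'I_(depth D) -> nat -> nat -> bool) :
  #|[set x : box D | P (blev x) (bcol x) (bidx x)]%SET| =
  (\sum_(i < depth D) \sum_(c < llength D i) \sum_(k < lheight D i) P i c k)%N.
Proof.
rewrite -sum1_card big_mkcond/=.
rewrite (eq_bigr (fun x => nat_of_bool (P (blev x) (bcol x) (bidx x)))); last first.
  by move=> x _; rewrite finset.inE; case: P.
rewrite sig_big_dep/=.
rewrite [RHS](sig_big_dep (fun=> true) (fun _ _ => true) (fun (a : superbox D)
  (k : 'I_(sbsize a)) => nat_of_bool (P (tag a) (tagged a) k))).
exact: eq_bigl.
Qed.

Definition boxl x : box D := @Box D (sbleft (tag x)) (tagged x).
Definition boxr x : box D := @Box D (sbright (tag x)) (tagged x).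

Lemma bcol_boxl x : bcol (boxl x) = (bcol x).-1. Proof. by []. Qed.

Lemma bcol_boxr x : ~~ special (tag x) -> bcol (boxr x) = (bcol x).+1.
Proof.
move=> xs; rewrite /bcol/= /column/= val_insubd ifT//.
by rewrite ltn_neqAle; apply/andP; split; [exact: xs|exact: ltn_ord].
Qed.

Lemma special_boxl x : (0 < bcol x)%N -> ~~ special (tag (boxl x)).
Proof.
move=> x0; rewrite /special /=.
have := bcol_lt x; rewrite -(prednK x0) ltn_neqAle => /andP[+ _]; exact.
Qed.

Lemma boxlK x : (0 < bcol x)%N -> boxr (boxl x) = x.
Proof.
move=> x0; apply: box_inj => //.
by rewrite bcol_boxr ?special_boxl// bcol_boxl prednK.
Qed.

Lemma boxrK x : ~~ special (tag x) -> boxl (boxr x) = x.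
Proof. by move=> xs; apply: box_inj => //; rewrite bcol_boxl bcol_boxr. Qed.

Lemma card_box : #|box D| = ysize D.
Proof.
have -> : #|box D| = #|[set x : box D | true]%SET| by rewrite cardsE; exact: eq_card.
rewrite (card_boxes (fun _ _ _ => true)) /ysize sumnE (sum_rows id).
apply: eq_bigr => i _.
by rewrite sum_nat_const sum_nat_const !card_ord mulnC muln1.
Qed.

Lemma card_column n : #|[set x : box D | bcol x == n]%SET| = ycolumn D n.
Proof.
rewrite (card_boxes (fun _ c _ => c == n)) /ycolumn -sum1_count [RHS]big_mkcond/=.
rewrite (sum_rows (fun x : nat => if (n < x)%N then 1%N else 0%N)).
apply: eq_bigr => i _; rewrite exchange_big/= sum_nat_const card_ord; congr (_ * _)%N.
case: ltnP => [ni|ni].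
  rewrite (bigD1 (Ordinal ni))//= eqxx big1 ?addn0// => c.
  by rewrite -val_eqE/= => /negPf ->.
by rewrite big1// => c _; rewrite ltn_eqF// (leq_trans (ltn_ord c)).
Qed.

Lemma card_first_column i (P : 'I_(depth D) -> nat -> bool) :
  #|[set x : box D | [&& (blev x <= i)%N, bcol x == 0%N & P (blev x) (bidx x)]]%SET| =
  (\sum_(j < depth D | (j <= i)%N) \sum_(k < lheight D j) P j k)%N.
Proof.
rewrite (card_boxes (fun j c k => [&& (j <= i)%N, c == 0%N & P j k])).
rewrite [RHS]big_mkcond; apply: eq_bigr => j _; case: ifP => ji; last first.
  by rewrite big1// => c _; rewrite big1.
rewrite (bigD1 (Ordinal (llength_gt0 j)))//= [X in (_ + X)%N]big1 ?addn0// => c.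
by rewrite -val_eqE/= => /negPf ->; rewrite big1.
Qed.

End YoungDiagrams.

(** If every vector is recovered from its pairings with [Y], then [X] spans [W] and, by the
    dimension, is a basis; uniqueness of the coordinates of [X g] gives the duality. *)
Lemma dual_of_decomp (R : realType) (W : vectType R) (omega : {skew_symmetric W})
    (B : finType) (X Y : B -> W) : \dim {:W} = #|B| ->
  (forall v, v = \sum_b omega (Y b) v *: X b) ->
  forall b g, omega (Y b) (X g) = (b == g)%:R.
Proof.
move=> dimW XE b g.
pose S : #|B|.-tuple W := [tuple X (enum_val i) | i < #|B|].
have TE (k : B -> R) : \sum_(i < #|B|) k (enum_val i) *: S`_i = \sum_b k b *: X b.
  rewrite [RHS](reindex (@enum_val B predT)) /=; last exact/onW_bij/enum_val_bij.
  by apply: eq_bigr => i _; rewrite -[S`_i](tnth_nth 0) tnth_mktuple.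
have bS : basis_of fullv S.
  rewrite basisEdim size_tuple dimW leqnn andbT; apply/subvP => v _.
  rewrite (XE v) -TE; apply: rpred_sum => i _; apply: rpredZ.
  by apply: memv_span; rewrite mem_nth ?size_tuple.
have := coord_sum_free (fun i : 'I_#|B| => omega (Y (enum_val i)) (X g)) (enum_rank b)
  (basis_free bS).
rewrite (TE (fun b => omega (Y b) (X g))) -XE enum_rankK => <-.
have -> : X g = S`_(enum_rank g) by rewrite -[S`_ _](tnth_nth 0) tnth_mktuple enum_rankK.
rewrite coord_free ?(basis_free bS)//.
by rewrite (inj_eq enum_rank_inj) eq_sym.
Qed.

(** * Darboux frames *)

(* A Darboux frame ({e_x}, {f_x}) is indexed by [T + T], with e_x at [inl x] and
   f_x at [inr x]. *)
Section DarbouxFlow.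
Variables (R : realType) (I : set R) (W : vectType R) (omega : {skew_symmetric W}).
Hypothesis I_itv : is_interval I.
Hypothesis I_nontriv : exists s t, [/\ I s, I t & s < t].
Hypothesis nd : nondegenerate omega.
Variable T : finType.

Definition bconj (b : T + T) : T + T :=
  match b with inl x => inr x | inr x => inl x end.
Definition bsgn (b : T + T) : R := if b is inl _ then 1 else -1.

Lemma bconjK : involutive bconj. Proof. by case. Qed.

Lemma bsgn_conj b : bsgn (bconj b) = - bsgn b.
Proof. by case: b => x /=; rewrite ?opprK. Qed.

(** The dual vector of e_x is f_x and that of f_x is -e_x, by the sign convention [omega f e = 1].
    All the Darboux relations become a single duality. *)
Definition bdual (X : T + T -> W) b : W := bsgn b *: X (bconj b).

Definition darboux_frame (X : T + T -> W) :=
  forall b g, omega (bdual X b) (X g) = (b == g)%:R.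

Hypothesis dimW : \dim {:W} = #|((T + T)%type : finType)|.

Lemma darboux_frame_decomp X v : darboux_frame X ->
  v = \sum_b omega (bdual X b) v *: X b.
Proof.
move=> dX.
by apply: (@frame_decomp R setT W omega _ (fun b _ => X b) (fun b _ => bdual X b)
  _ dimW 0 v).
Qed.

(* The bivector [\sum_b bsgn b X_b (x) X_(bconj b)] is constant along the flow, so
   it stays the inverse of [omega]: no uniqueness theorem for the equation is
   needed. *)
Lemma darboux_flow (X : T + T -> R -> W) (A : T + T -> T + T -> R -> R) t0 :
  (forall b t, I t -> vder_in I (X b) t (\sum_g A b g t *: X g t)) ->
  (forall b g t, I t -> bsgn b * A (bconj b) g t = bsgn g * A (bconj g) b t) ->
  I t0 -> darboux_frame (fun b => X b t0) ->
  forall t, I t -> darboux_frame (fun b => X b t).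
Proof.
move=> XA Asp It0 D0 t It; apply: (@dual_of_decomp R W omega _ (fun b => X b t)) => // v.
pose h u v s := \sum_b bsgn b * (omega u (X b s) * omega v (X (bconj b) s)).
have hd u w s : I s -> der_in I (h u w) s 0.
  move=> Is.
  have D1 b : der_in I (fun s => bsgn b * (omega u (X b s) * omega w (X (bconj b) s))) s
     (bsgn b * ((\sum_g A b g s * omega u (X g s)) * omega w (X (bconj b) s) +
       omega u (X b s) * (\sum_g A (bconj b) g s * omega w (X g s)))).
    have D2 z c : der_in I (fun s => omega z (X c s)) s
        (\sum_g A c g s * omega z (X g s)).
      have := vder_in_bilinear (B := omega) (vder_in_cst I z s) (XA c s Is).
      rewrite linear0l add0r linear_sumr.
      by under eq_bigr do rewrite linearZr/=.
    by apply: der_inZ; exact: der_inM.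
  have := der_in_sum (r := index_enum _) (P := xpredT) (fun b _ => D1 b).
  (* The two halves of the Leibniz rule cancel: reindexing the first by [bconj] changes its sign,
     and the symplectic symmetry of [A] brings the second to the same form. *)
  rewrite [X in der_in _ _ _ X](_ : _ = 0)//.
  under eq_bigr do rewrite mulrDr.
  rewrite big_split/= (reindex_inj (can_inj bconjK))/=.
  rewrite [X in _ + X](_ : _ = \sum_b \sum_g bsgn b * A (bconj b) g s *
      (omega u (X g s) * omega w (X b s))); last first.
    under eq_bigr do rewrite !mulr_sumr.
    rewrite exchange_big/=; apply: eq_bigr => b _; apply: eq_bigr => g _.
    by rewrite (Asp b g s Is); ring.
  rewrite -big_split/=; apply: big1 => b _.
  rewrite bconjK bsgn_conj mulr_suml mulr_sumr -big_split/=; apply: big1 => g _.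
  by ring.
have hE u w : h u w t = - omega u w.
  have <- : h u w t0 = h u w t by apply: (der_in_const I_itv (hd u w)).
  rewrite [in RHS](darboux_frame_decomp w D0) linear_sumr -sumrN.
  apply: eq_bigr => b _; rewrite [X in _ = - X]linearZr/= /bdual.
  by rewrite [X in _ = - (X * _)]linearZl/= (skewC omega w); ring.
(* By nondegeneracy, the decomposition of [v] at time [t] may be tested by pairing with every [u],
   where it becomes the identity [hE]. *)
apply/eqP; rewrite -subr_eq0 -memv0 -(eqP nd); apply/mem_orthovP => u _.
rewrite skewC linearBr/=; apply/eqP; rewrite oppr_eq0 subr_eq0; apply/eqP.
rewrite -[LHS]opprK -hE linear_sumr -sumrN; apply: eq_bigr => b _.
rewrite [RHS]linearZr/= /bdual.
by rewrite [X in _ = X * _]linearZl/= (skewC omega v); ring.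
Qed.

End DarbouxFlow.

(** * The curve spanned by half of a normal frame *)

Lemma eq_inl (T : eqType) (x y : T) : (inl x == inl y :> T + T) = (x == y).
Proof. by []. Qed.

Lemma eq_inr (T : eqType) (x y : T) : (inr x == inr y :> T + T) = (x == y).
Proof. by []. Qed.

Lemma sum_geq_sub (n m : nat) : (m <= n)%N -> (\sum_(k < n) (n - m <= k) = m)%N.
Proof.
move=> mn; rewrite -(big_mkord xpredT (fun k => nat_of_bool (n - m <= k)%N)).
rewrite (@big_cat_nat _ _ _ (n - m)%N)//= ?leq_subr//.
rewrite big_nat_cond big1 ?add0n => [|k /andP[/andP[_ kj] _]]; last first.
  by rewrite leqNgt kj.
rewrite big_nat_cond (eq_bigr (fun=> 1%N)) => [|k /andP[/andP[-> _] _]//].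
by rewrite -big_nat_cond sum_nat_const_nat muln1 subKn.
Qed.

(** * The matrix of the structural equations *)

Section StructureMatrix.
Variables (R : realType) (D : young_diagram) (rm : 'I_(depth D) -> nat).
Implicit Types (x y : box D) (b g : box D + box D) (N : compatible_map R D).

Definition bsign x : R := if (bidx x < lheight D (blev x) - rm (blev x))%N then 1 else -1.

Lemma bsign_neq0 x : bsign x != 0.
Proof. by rewrite /bsign; case: ifP; rewrite ?oppr_eq0 oner_eq0. Qed.

(** Row [b] holds the coordinates of the derivative of the frame vector [b]. The guards on the
    column and on [special] are essential because the shifts fix the boxes at the ends of a
    level. *)
Definition structure_coef N b g : R :=
  match b, g with
  | inl x, inl y => ((0 < bcol x)%N && (y == boxl x))%:R
  | inl x, inr y => bsign x * ((bcol x == 0%N) && (y == x))%:R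
  | inr x, inl y => N (tag x) (tag y) (tagged y) (tagged x)
  | inr x, inr y => - (~~ special (tag x) && (y == boxr x))%:R
  end.

(* The structure matrix lies in the symplectic Lie algebra. *)
Lemma structure_coef_sp N b g : symmetric_map N ->
  bsgn R b * structure_coef N (bconj b) g = bsgn R g * structure_coef N (bconj g) b.
Proof.
move=> Nsym; case: b => x; case: g => y /=.
- by rewrite (Nsym (tag x) (tag y)) mxE.
- rewrite mul1r mulN1r; congr (- (nat_of_bool _)%:R).
  apply/idP/idP => /andP[xs /eqP ->].
    by rewrite bcol_boxr// boxrK// eqxx.
  by rewrite special_boxl// boxlK// eqxx.
- rewrite mul1r mulN1r; congr (- (nat_of_bool _)%:R).
  apply/idP/idP => /andP[xs /eqP ->].
    by rewrite special_boxl// boxlK// eqxx.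
  by rewrite bcol_boxr// boxrK// eqxx.
- have [->//|yx] := eqVneq x y.
  by rewrite !andbF !mulr0.
Qed.

End StructureMatrix.

Section CurveOfFrame.
Variables (R : realType) (I : set R) (W : vectType R) (omega : {skew_symmetric W}).
Hypothesis I_itv : is_interval I.
Hypothesis I_nontriv : exists s t, [/\ I s, I t & s < t].
Variables (D : young_diagram) (rm : 'I_(depth D) -> nat).
Hypothesis rm_le : forall i, (rm i <= lheight D i)%N.
Hypothesis dimW : \dim {:W} = #|((box D + box D)%type : finType)|.
Variables (X : box D + box D -> R -> W) (N : R -> compatible_map R D).
Variable L : R -> {vspace W}.
Hypothesis X_smooth : forall b, vsmooth_in I (X b).
Hypothesis X_darboux : forall t, I t -> darboux_frame omega (fun b => X b t).
Hypothesis X_der : forall t b, I t ->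
  vder_in I (X b) t (\sum_g structure_coef rm (N t) b g *: X g t).
Implicit Types (x y : box D) (b g : box D + box D) (i : 'I_(depth D)).

Definition level_boxes (P : pred (box D)) : {set box D + box D} :=
  [set b | if b is inl x then P x else false]%SET.

Hypothesis LE : forall t, I t -> L t = fspan X (level_boxes predT) t.

Let A b g t := structure_coef rm (N t) b g.
Let Y b t := bdual (fun b => X b t) b.

Let Y_smooth b : vsmooth_in I (Y b).
Proof. by apply: vsmooth_scale => //; exact: smooth_cst. Qed.

Let XY_dual t : I t -> forall b b', omega (Y b t) (X b' t) = (b == b')%:R.
Proof. exact: X_darboux. Qed.

Lemma card_level_boxes P : #|level_boxes P| = #|[set x | P x]%SET|.
Proof.
rewrite -(card_imset _ (@inl_inj (box D) (box D))); apply: eq_card => b.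
rewrite finset.inE; apply/idP/finset.imsetP; last first.
  by move=> [x]; rewrite finset.inE => Px ->.
by case: b => // x Px; exists x => //; rewrite finset.inE.
Qed.

Lemma mem_level_boxes P x : (inl x \in level_boxes P) = P x.
Proof. by rewrite finset.inE. Qed.

Lemma mem_level_boxes_r P x : (inr x \in level_boxes P) = false.
Proof. by rewrite finset.inE. Qed.

Lemma level_boxes_sub P : level_boxes P \subset level_boxes predT.
Proof. by apply/fintype.subsetP => -[x|x]; rewrite !finset.inE. Qed.

(** Pairing with e_x reads, up to sign, the coordinate on f_x. Orthogonality to the vectors e
    therefore means that all coordinates on the vectors f vanish, which is membership in the
    curve. *)
Lemma frame_curve_lagrangian : lagrangian_curve omega I L.
Proof.
split=> [t0 It0|t It].
  exists setT, #|box D|,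
    (fun t => [tuple X (inl (enum_val i)) t | i < #|box D|]).
  split=> [||k|t It _]; [exact: openT|by []| |].
    rewrite setIT; under [X in vsmooth_in _ X]funext do rewrite tnth_mktuple.
    exact: X_smooth.
  rewrite basisEdim LE// size_tuple (dim_fspan XY_dual dimW)// card_level_boxes.
  rewrite andbC cardsE leqnn; apply/subv_sumP => -[x|x]; rewrite finset.inE// => _.
  rewrite -memvE; apply: memv_span; apply/mapP; exists (enum_rank x).
    by rewrite mem_enum.
  by rewrite enum_rankK.
rewrite LE//; apply/eqP; rewrite eqEsubv; apply/andP; split; apply/subvP => v.
  move=> /mem_orthovP vL; apply/(mem_fspan XY_dual dimW _ _ It) => -[x|x].
    by rewrite mem_level_boxes.
  move=> _; rewrite /fcoord /Y /bdual linearZl/= skewC vL ?oppr0 ?mulr0//.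
  by apply: mem_fspan_frame; rewrite mem_level_boxes.
move=> vL; apply/mem_orthovP => u uL.
rewrite (frame_decomp XY_dual dimW v It) linear_sumlz big1// => -[x|x] _; last first.
  have /(mem_fspan XY_dual dimW _ _ It) -> := vL; first by rewrite scale0r linear0l.
  by rewrite mem_level_boxes_r.
have /(mem_fspan XY_dual dimW _ _ It)/(_ (inr x)) := uL.
rewrite mem_level_boxes_r /fcoord /Y /bdual/= => /(_ isT).
rewrite linearZl/= mulN1r => /eqP; rewrite oppr_eq0 => /eqP ux.
by rewrite linearZl/= ux mulr0.
Qed.

Definition extension_boxes n : {set box D + box D} :=
  [set b | if b is inr x then (bcol x < n)%N else true]%SET.

(** The first derivative brings in the vectors f of the first column, with coefficient [bsign]; each
    later one moves f one column to the right, with coefficient -1. The normal mapping only adds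
    vectors e, already present. *)
Lemma extension_curve n t : I t -> extension I n L t = fspan X (extension_boxes n) t.
Proof.
move=> It; have S0 : extension_boxes 0 = level_boxes predT.
  by apply/setP => -[x|x]; rewrite !finset.inE.
rewrite (@extension_ext _ _ _ _ _ (fspan X (extension_boxes 0))) => [|s Is]; last first.
  by rewrite LE// S0.
apply: (@extension_fspan _ _ _ omega I_itv I_nontriv _ X Y A) It => //.
- by move=> m _; apply/fintype.subsetP => -[x|x]; rewrite !finset.inE// => /ltnW.
- move=> m s [x|x] [y|y] _ _; rewrite !finset.inE//= /A/= => xm ym.
    have [x0|] := eqVneq (bcol x) 0%N; rewrite /= ?mulr0//.
    by case: eqP => [yx|]; rewrite ?mulr0//; move: ym; rewrite yx x0.
  case: (boolP (special _)) => //= xs; rewrite ?oppr0//.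
  case: eqP => [yx|]; rewrite ?oppr0//.
  by move: ym; rewrite yx bcol_boxr// ltnS xm.
- move=> m [x|x] _; rewrite !finset.inE// ltnS -leqNgt => xm mx.
  have {xm mx} xm : bcol x = m by apply/eqP; rewrite eqn_leq xm.
  case: m xm => [|m] xm.
    exists (inl x); first by rewrite finset.inE.
    exists (bsign R rm x); first exact: bsign_neq0.
    move=> s [y|y] _; rewrite finset.inE// => _; rewrite /A/= xm eqxx.
    by rewrite eq_inr.
  have x0 : (0 < bcol x)%N by rewrite xm.
  exists (inr (boxl x)); first by rewrite finset.inE bcol_boxl xm.
  exists (-1); first by rewrite oppr_eq0 oner_eq0.
  move=> s [y|y] _; rewrite finset.inE// => _.
  rewrite /A/= special_boxl//= boxlK// mulN1r.
  by rewrite eq_inr.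
Qed.

Lemma card_extension_boxes n :
  #|extension_boxes n.+1| = (#|extension_boxes n| + ycolumn D n)%N.
Proof.
rewrite -card_column -(card_imset _ (@inr_inj (box D) (box D))) -cardsUI.
rewrite [X in (_ = _ + #|pred_of_set X|)%N](_ : _ = finset.set0); last first.
  apply/setP => b; rewrite !finset.inE; apply/negbTE/andP => -[bn /finset.imsetP[x]].
  by rewrite finset.inE => /eqP xn bx; move: bn; rewrite bx xn ltnn.
rewrite cards0 addn0; apply: eq_card => -[x|x]; rewrite !finset.inE//.
rewrite ltnS leq_eqVlt orbC; congr (_ || _).
apply/idP/finset.imsetP => [xn|[y]]; first by exists x => //; rewrite finset.inE.
by rewrite finset.inE => yn [->].
Qed.

Lemma frame_curve_young : has_young_diagram I L D.
Proof.
have dimE n t : I t -> \dim (extension I n L t) = #|extension_boxes n|.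
  by move=> It; rewrite extension_curve// (dim_fspan XY_dual dimW).
split=> [n s t Is It||n t It]; rewrite ?dimE//; last exact: card_extension_boxes.
exists (\max_(x : box D) (bcol x).+1) => t It; apply/eqP.
rewrite eqEdim subvf/= dimE// dimW; apply: eq_leq; apply/esym; rewrite -cardsT.
apply: eq_card => -[x|x]; rewrite !finset.inE//.
exact: (@leq_bigmax _ (fun x => (bcol x).+1)).
Qed.

(** Differentiation moves e one column to the left. In the contraction by columns at least [k], the
    column [k] is the one that leaves: towards column [k - 1], or towards f when [k] is 0. *)
Lemma contraction_curve k t : I t ->
  Defs.contraction I k L t = fspan X (level_boxes (fun x => (k <= bcol x)%N)) t.
Proof.
elim: k t => [|k IH] t It; first by rewrite /Defs.contraction/= LE.
rewrite /Defs.contraction iterS.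
rewrite (@contraction1_ext _ _ _ _ (fspan X (level_boxes (fun x => (k <= bcol x)%N))))//.
apply: (@contraction1_fspan _ _ _ omega I_itv I_nontriv _ X Y A) => //.
- by apply/fintype.subsetP => -[x|x]; rewrite !finset.inE// => /ltnW.
- move=> s [x|x] [y|y] Is; rewrite !finset.inE//= /A/= => kx.
    move=> ky; case: eqP => [yx|]; rewrite ?andbF// (leq_ltn_trans _ kx)//.
    by move: ky; rewrite yx bcol_boxl -ltnS prednK ?kx// (leq_ltn_trans _ kx).
  by rewrite gtn_eqF ?mulr0// (leq_ltn_trans _ kx).
- move=> [x|x]; rewrite !finset.inE// => kx; rewrite -ltnNge ltnS => xk.
  have {kx xk} xk : bcol x = k by apply/eqP; rewrite eqn_leq xk.
  case: k xk {IH} => [|k] xk.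
    exists (inr x); first by rewrite finset.inE.
    exists (bsign R rm x); first exact: bsign_neq0.
    move=> s [y|y] Is; rewrite finset.inE// => _; rewrite /A/=.
    have [<-|yx] := eqVneq x y; first by rewrite xk !eqxx.
    by rewrite andbF eq_inl eq_sym (negPf yx) !mulr0.
  exists (inl (boxl x)); first by rewrite finset.inE bcol_boxl xk ltnn.
  exists 1; first exact: oner_neq0.
  move=> s [y|y] Is; rewrite finset.inE// => ky; rewrite /A/= mul1r.
  have y0 : (0 < bcol y)%N by exact: leq_ltn_trans ky.
  rewrite y0/= eq_inl; congr (nat_of_bool _)%:R; apply/eqP/eqP => [xy|->//].
  by rewrite -(boxlK y0) -xy boxlK ?xk.
Qed.

(** With [k] one less than the length of level [i], contracting [k] times leaves the columns of
    index at least [k], which only the levels up to [i] possess. Extending [k] times moves back one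
    column per step and fills exactly these levels, without ever producing a vector f. *)
Lemma level_space_curve i t : I t ->
  level_space I L D i t = fspan X (level_boxes (fun x => (blev x <= i)%N)) t.
Proof.
move=> It; rewrite /level_space; set k := (llength D i).-1.
pose S n := level_boxes (fun x => (k <= bcol x + n)%N && (k < llength D (blev x))%N).
have kE x : (k < llength D (blev x))%N = (blev x <= i)%N.
  by rewrite /k prednK ?llength_gt0// llength_leq.
rewrite (@extension_ext _ _ _ _ _ (fspan X (S 0%N))) => [|s Is]; last first.
  rewrite contraction_curve//; congr (fspan X _ s).
  apply/setP => -[x|x]; rewrite !finset.inE//.
  by rewrite addn0; apply/esym/andb_idr => kx; exact: leq_ltn_trans (bcol_lt x).
rewrite [in RHS](_ : level_boxes _ = S k); last first.
  by apply/setP => -[x|x]; rewrite !finset.inE// leq_addl kE.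
apply: (@extension_fspan _ _ _ omega I_itv I_nontriv _ X Y A X_smooth Y_smooth
  XY_dual dimW X_der k S) It => //.
- move=> m _; apply/fintype.subsetP => -[x|x]; rewrite !finset.inE// => /andP[km ->].
  by rewrite andbT addnS leqW.
- move=> m s [x|x] [y|y] mk Is; rewrite !finset.inE//= /A/= => /andP[kx kl].
    move=> ky; case: (posnP (bcol x)) => //= x0; case: eqP => [yx|//].
    by move: ky; rewrite yx bcol_boxl kl andbT addnS -addSn prednK// kx.
  by rewrite gtn_eqF ?mulr0//; lia.
- move=> m [x|x] mk; rewrite !finset.inE// => /andP[kx kl].
  rewrite kl andbT -ltnNge => xk.
  have xs : ~~ special (tag x).
    by rewrite /special neq_ltn; apply/orP; left; rewrite -[column _]/(bcol x);
    apply: leq_trans kl; rewrite ltnS; lia.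
  exists (inl (boxr x)).
    by rewrite finset.inE bcol_boxr// addSn -addnS kx.
  exists 1; first exact: oner_neq0.
  move=> s [y|y] Is; rewrite finset.inE /A/= bcol_boxr//= => _.
    by rewrite boxrK// mul1r eq_inl.
  by rewrite mulr0 mul1r.
Qed.

(** The f-coordinates of a section vanish identically, so those of its derivative come from [A]:
    they are [bsign] times the first-column coordinates of [v]. The result depends on [v] only, and
    the set from which [velocity] chooses is a singleton. *)
Lemma velocity_curve t v : I t -> v \in L t -> velocity omega I L t v =
  \sum_(x | bcol x == 0%N) bsign R rm x * fcoord omega Y (inl x) t v ^+ 2.
Proof.
move=> It vL; set q := RHS.
suff H l : sections I L l -> l t = v -> omega (vderive_in I l t) (l t) = q.
  rewrite /velocity; set S := [set x | _].
  suff SE : S = [set q].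
    have : S (xget 0 S) by apply: xgetPex; exists q; rewrite SE.
    by rewrite {1}SE.
  apply/seteqP; split=> [r [l [ls lt ->]]|r ->]; first exact: H.
  (* The section through [v] whose coordinates in the moving frame are frozen at time [t]. *)
  pose l s := \sum_x fcoord omega Y (inl x) t v *: X (inl x) s.
  have ls : sections I L l.
    split=> [|s Is].
      by apply: (vsmooth_sum I_itv I_nontriv) => x _; apply: vsmooth_scale => //;
        exact: smooth_cst.
    rewrite LE//; apply: rpred_sum => x _; apply: rpredZ; apply: mem_fspan_frame.
    by rewrite mem_level_boxes.
  have lt : l t = v.
    rewrite [RHS](frame_decomp XY_dual dimW v It) big_sumType/= [X in _ + X]big1 ?addr0//.
    move=> x _; have := vL; rewrite LE// => /(mem_fspan XY_dual dimW _ _ It) ->.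
      by rewrite scale0r.
    by rewrite mem_level_boxes_r.
  by exists l; split=> //; rewrite H.
move=> ls lt.
have dlr x : fcoord omega Y (inr x) t (vderive_in I l t) =
    (bcol x == 0%N)%:R * (bsign R rm x * fcoord omega Y (inl x) t v).
  have l0 s y : I s -> fcoord omega Y (inr y) s (l s) = 0.
    move=> Is; have [_ /(_ s Is)] := ls; rewrite LE// => /(mem_fspan XY_dual dimW _ _ Is).
    by apply; rewrite mem_level_boxes_r.
  case: (ls) => lsm _.
  rewrite (fcoord_vderive I_itv I_nontriv Y_smooth XY_dual dimW X_der)//.
  rewrite -(@derive_in_ext _ _ I_itv I_nontriv (fun=> 0))//;
    [|move=> s|exact: smooth_cst];
    last by rewrite inE => Is; rewrite l0.
  rewrite derive_in0// add0r big_sumType/= [X in _ + X]big1 ?addr0 => [|y _]; last first.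
    by rewrite l0// mul0r.
  rewrite (bigD1 x)//= big1 ?addr0 => [|y yx]; last first.
    by rewrite [x == y]eq_sym (negPf yx) andbF !mulr0.
  by rewrite lt eqxx andbT; ring.
rewrite lt [in LHS](frame_decomp XY_dual dimW v It) linear_sumr big_sumType/=.
rewrite [X in _ + X]big1 ?addr0 => [|x _]; last first.
  have := vL; rewrite LE// => /(mem_fspan XY_dual dimW _ _ It) ->.
    by rewrite scale0r linear0r.
  by rewrite mem_level_boxes_r.
rewrite /q [RHS]big_mkcond; apply: eq_bigr => x _.
have -> : omega (vderive_in I l t) (fcoord omega Y (inl x) t v *: X (inl x) t) =
    fcoord omega Y (inl x) t v * fcoord omega Y (inr x) t (vderive_in I l t).
  rewrite linearZr/= /fcoord /Y /bdual/= [X in _ = _ * X]linearZl/= mulN1r.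
  by rewrite -skewC.
by rewrite dlr; case: eqP => _ /=; ring.
Qed.


Lemma level_space_sub i t v : I t -> v \in level_space I L D i t -> v \in L t.
Proof.
move=> It; rewrite level_space_curve// LE//; apply: subvP.
by apply: fspanS; exact: level_boxes_sub.
Qed.

Lemma level_space_coord0 i t v x : I t -> v \in level_space I L D i t ->
  ~~ (blev x <= i)%N -> fcoord omega Y (inl x) t v = 0.
Proof.
move=> It; rewrite level_space_curve// => /(mem_fspan XY_dual dimW _ _ It) vi xi.
by rewrite vi// mem_level_boxes.
Qed.

Lemma velocity_level_space i t v : I t -> v \in level_space I L D i t ->
  velocity omega I L t v = \sum_(x | (blev x <= i)%N && (bcol x == 0%N))
    bsign R rm x * fcoord omega Y (inl x) t v ^+ 2.
Proof.
move=> It vi; rewrite velocity_curve//; last exact: level_space_sub vi.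
rewrite [RHS]big_mkcondl/=; apply: eq_bigr => x _; case: ifPn => // xi.
by rewrite (level_space_coord0 It vi xi) expr0n mulr0.
Qed.

Lemma frame_curve_rank i t : I t ->
  qrank (velocity omega I L t) (level_space I L D i t) =
  (\sum_(k < depth D | (k <= i)%N) lheight D k)%N.
Proof.
move=> It; pose T := {x : box D | (blev x <= i)%N && (bcol x == 0%N)}.
rewrite (@qrank_diag _ _ T _ _ (fun (x : T) v => fcoord omega Y (inl (val x)) t v)
  (fun x : T => bsign R rm (val x)) (fun x : T => X (inl (val x)) t)).
- rewrite card_sig.
  rewrite -(@eq_card _ [set x : box D | [&& (blev x <= i)%N, bcol x == 0%N & true]]%SET);
    last by move=> x; rewrite finset.inE andbT.
  rewrite (card_first_column i (fun _ _ => true)).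
  by apply: eq_bigr => j _; rewrite sum1_card card_ord.
- move=> u v ui vi; rewrite /polar.
  rewrite (velocity_level_space It (rpredD ui vi)) (velocity_level_space It ui).
  rewrite (velocity_level_space It vi).
  rewrite -!sumrB mulr_suml.
  rewrite (reindex_omap (val : T -> box D) insub) => [|x xi]; last first.
    by rewrite insubT.
  apply: eq_big => [x|x _].
    by rewrite valK eqxx andbT (valP x).
  by rewrite /fcoord linearDr/=; field.
- by move=> x a u v; rewrite /fcoord linearDr/= linearZr.
- by move=> x; exact: bsign_neq0.
- move=> x; rewrite level_space_curve//; apply: mem_fspan_frame.
  by rewrite mem_level_boxes; case/andP: (valP x).
- by move=> b b'; rewrite /fcoord (XY_dual It) eq_inl (inj_eq val_inj).
Qed.

Lemma frame_curve_neg_index i t : I t ->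
  neg_index (velocity omega I L t) (level_space I L D i t) =
  (\sum_(k < depth D | (k <= i)%N) rm k)%N.
Proof.
move=> It.
pose ng x := (lheight D (blev x) - rm (blev x) <= bidx x)%N.
pose Ni x := [&& (blev x <= i)%N, bcol x == 0%N & ng x].
(* This also takes all boxes outside the first column, where the velocity vanishes; the form need
   only be nonnegative there. *)
pose Pi x := (blev x <= i)%N && ~~ Ni x.
have bsE x : bsign R rm x = if ng x then -1 else 1.
  by rewrite /bsign /ng ltnNge; case: leqP.
have subN : (fspan X (level_boxes Ni) t <= level_space I L D i t)%VS.
  rewrite level_space_curve//; apply: fspanS.
  by apply/fintype.subsetP => -[x|x]; rewrite !finset.inE// => /and3P[].
have subP : (fspan X (level_boxes Pi) t <= level_space I L D i t)%VS.
  rewrite level_space_curve//; apply: fspanS.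
  by apply/fintype.subsetP => -[x|x]; rewrite !finset.inE// => /andP[].
rewrite (@neg_index_split _ _ _ _ (fspan X (level_boxes Pi) t)
  (fspan X (level_boxes Ni) t))//.
- rewrite (dim_fspan XY_dual dimW)// card_level_boxes.
  rewrite (card_first_column i (fun j k => (lheight D j - rm j <= k)%N)).
  by apply: eq_bigr => j _; exact: sum_geq_sub.
- rewrite !(dim_fspan XY_dual dimW)// level_space_curve// (dim_fspan XY_dual dimW)//.
  rewrite !card_level_boxes -cardsUI [X in (_ + #|pred_of_set X|)%N](_ : _ = finset.set0).
    rewrite cards0 addn0; apply: eq_card => x; rewrite !finset.inE /Pi.
    by have [/and3P[->]|_] := boolP (Ni x); rewrite ?orbT// andbT orbF.
  by apply/setP => x; rewrite !finset.inE /Pi; case: (Ni x); rewrite ?andbF.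
- move=> v vP; have vi := subvP subP _ vP.
  rewrite (velocity_level_space It vi); apply: sumr_ge0 => x /andP[xi x0].
  rewrite bsE; case: ifP => xn; last by rewrite mul1r sqr_ge0.
  move: vP => /(mem_fspan XY_dual dimW _ _ It) -> ; first by rewrite expr0n mulr0.
  by rewrite mem_level_boxes /Pi /Ni xi x0 xn.
- move=> v vN v0; have vi := subvP subN _ vN.
  have vN0 := vN; move: vN0 => /(mem_fspan XY_dual dimW _ _ It) vN0.
  have vE x : (blev x <= i)%N && (bcol x == 0%N) ->
      bsign R rm x * fcoord omega Y (inl x) t v ^+ 2 = - fcoord omega Y (inl x) t v ^+ 2.
    move=> /andP[xi x0]; rewrite bsE; case: ifP => xn; first by rewrite mulN1r.
    by rewrite vN0 ?expr0n ?mulr0 ?oppr0// mem_level_boxes /Ni xn !andbF.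
  rewrite (velocity_level_space It vi) (eq_bigr _ vE) sumrN oppr_lt0.
  rewrite lt_neqAle sumr_ge0 ?andbT => [|x _]; last exact: sqr_ge0.
  apply: contra v0; rewrite eq_sym psumr_eq0 => [/allP S0|x _]; last exact: sqr_ge0.
  rewrite (frame_decomp XY_dual dimW v It) big1// => -[x|x] _; last first.
    by rewrite vN0 ?scale0r// mem_level_boxes_r.
  have [xN|xN] := boolP (Ni x); last by rewrite vN0 ?scale0r// mem_level_boxes.
  have := S0 x; rewrite mem_index_enum => /(_ isT); case/and3P: xN => -> -> _ /=.
  by rewrite sqrf_eq0 => /eqP ->; rewrite scale0r.
Qed.

Lemma frame_curve_G : G_curve omega I rm L.
Proof.
split; [exact: frame_curve_lagrangian|exact: frame_curve_young| |].
  by move=> i t _; exact: frame_curve_rank.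
move=> i t It; rewrite /neg_inertia /neg_gamma frame_curve_neg_index//.
(* The first level is separate because [neg_gamma] is 0 there by convention; otherwise the sums of
   two consecutive levels are subtracted. *)
case: i => -[|i] i_lt /=.
  rewrite subr0; congr Posz; rewrite (bigD1 (Ordinal i_lt))//= big1 ?addn0// => j.
  by rewrite leqn0 -val_eqE/= => /andP[/eqP ->]; rewrite eqxx.
rewrite (frame_curve_neg_index (Ordinal (ltnW i_lt)) It).
apply/eqP; rewrite subr_eq addrC -PoszD; apply/eqP; congr Posz.
rewrite (bigD1 (Ordinal i_lt))//= addnC; congr (_ + _)%N; apply: eq_bigl => j.
by rewrite -val_eqE/= andbC -ltn_neqAle ltnS.
Qed.

End CurveOfFrame.

(** * Existence and uniqueness of curves with prescribed normal mappings *)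

Section MovingFrames.
Variables (R : realType) (I : set R) (W : vectType R) (omega : {skew_symmetric W}).
Hypothesis I_itv : is_interval I.
Hypothesis I_nontriv : exists s t, [/\ I s, I t & s < t].
Variables (D : young_diagram) (rm : 'I_(depth D) -> nat).
Implicit Types (x y : box D) (L : R -> {vspace W}).

Definition frame_of (E F : half_frame W D) (b : box D + box D) : W :=
  match b with inl x => E (tag x) (tagged x) | inr x => F (tag x) (tagged x) end.

Lemma Box_tagged x : Box (tagged x) = x.
Proof. by case: x. Qed.

Lemma sum_boxes (V : zmodType) (f : forall a : superbox D, 'I_(sbsize a) -> V) :
  \sum_(x : box D) f (tag x) (tagged x) = \sum_a \sum_k f a k.
Proof. by rewrite sig_big_dep. Qed.

Lemma darbouxP (E F : half_frame W D) :
  darboux omega E F <-> darboux_frame omega (frame_of E F).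
Proof.
split=> [DEF [x|x] [y|y]|DEF a b k l]; rewrite /bdual/=.
- have [_ _ FE] := DEF (tag x) (tag y) (tagged x) (tagged y).
  by rewrite scale1r FE !Box_tagged -(eq_inl x y).
- have [_ FF _] := DEF (tag x) (tag y) (tagged x) (tagged y).
  by rewrite scale1r FF.
- have [EE _ _] := DEF (tag x) (tag y) (tagged x) (tagged y).
  by rewrite scaleN1r linearNl/= EE oppr0.
- have [_ _ FE] := DEF (tag y) (tag x) (tagged y) (tagged x).
  by rewrite scaleN1r linearNl/= skewC opprK FE !Box_tagged eq_sym -(eq_inr x y).
- split.
  + have := DEF (inr (Box k)) (inl (Box l)).
    by rewrite /bdual/= scaleN1r linearNl/= => /eqP; rewrite oppr_eq0 => /eqP.
  + by have := DEF (inl (Box k)) (inr (Box l)); rewrite /bdual/= scale1r.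
  + by have := DEF (inl (Box k)) (inl (Box l)); rewrite /bdual/= scale1r eq_inl.
Qed.

Lemma sum_deltaZ (T : finType) (f : T -> W) (P : pred T) (y : T) :
  (forall z, P z = (z == y)) -> \sum_z (P z)%:R *: f z = f y :> W.
Proof.
move=> Py; rewrite (bigD1 y)//= Py eqxx scale1r big1 ?addr0// => z zy.
by rewrite Py (negPf zy) scale0r.
Qed.

Lemma structure_rhsE (E F : half_frame W D) (N : compatible_map R D)
    a (k : 'I_(sbsize a)) :
  \sum_g structure_coef rm N (inl (Box k)) g *: frame_of E F g =
  if (0 < column a)%N then E (sbleft a) k
  else rowvec_mul (F a) (inertia_mx R (sbsize a) (rm (level a))) k.
Proof.
rewrite big_sumType/=; case: posnP => a0.
  rewrite big1 ?add0r => [|y _]; last by rewrite scale0r.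
  rewrite (bigD1 (Box k))//= [X in _ + X]big1 ?addr0 => [|y yk]; last first.
    by rewrite (negPf yk) mulr0 scale0r.
  rewrite eqxx mulr1 /rowvec_mul (bigD1 k)//= big1 ?addr0 => [|l lk].
    by rewrite mxE eqxx.
  by rewrite mxE (negPf lk) scale0r.
rewrite [X in _ + X]big1 ?addr0 => [|y _]; last first.
  by rewrite mulr0 scale0r.
by rewrite (@sum_deltaZ _ (fun y => E (tag y) (tagged y)) _ (boxl (Box k))).
Qed.

Lemma structure_rhsF (E F : half_frame W D) (N : compatible_map R D)
    a (k : 'I_(sbsize a)) :
  \sum_g structure_coef rm N (inr (Box k)) g *: frame_of E F g =
  \sum_b rowvec_mul (E b) (N a b) k - (if special a then 0 else F (sbright a) k).
Proof.
rewrite big_sumType/=; congr (_ + _).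
  by rewrite (sum_boxes (V := W) (fun (c : superbox D) l => N a c l k *: E c l)).
under eq_bigr do rewrite scaleNr.
rewrite sumrN; congr (- _); case: ifP => sa.
  by rewrite big1// => y _; rewrite scale0r.
exact: (@sum_deltaZ _ (fun y => F (tag y) (tagged y)) _ (boxr (Box k))).
Qed.

Lemma structural_eqsP (E F : R -> half_frame W D) (N : compatible_map R D) t :
  structural_eqs I rm E F N t <-> forall b,
    vderive_in I (fun s => frame_of (E s) (F s) b) t =
    \sum_g structure_coef rm N b g *: frame_of (E t) (F t) g.
Proof.
split=> [[E1 E2 F1 F2] [x|x]|H].
- rewrite -[in RHS](Box_tagged x) structure_rhsE.
  by case: posnP => x0; [rewrite -E2|rewrite -E1].
- rewrite -[in RHS](Box_tagged x) structure_rhsF.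
  by case: ifPn => xs; [rewrite subr0 -F2|rewrite -F1].
split=> a k ak.
- by have := H (inl (Box k)); rewrite structure_rhsE ak.
- by have := H (inl (Box k)); rewrite structure_rhsE ak ltnn.
- by have := H (inr (Box k)); rewrite structure_rhsF (negPf ak).
- by have := H (inr (Box k)); rewrite structure_rhsF ak subr0.
Qed.

Lemma span_frameE (E F : R -> half_frame W D) t :
  (\sum_a \sum_k <[E t a k]>)%VS =
  fspan (fun b t => frame_of (E t) (F t) b) (@level_boxes D predT) t.
Proof.
rewrite /fspan [RHS]big_mkcond big_sumType/=.
rewrite [X in (_ + X)%VS]big1 ?addv0 => [|x _]; last first.
  by rewrite mem_level_boxes_r.
rewrite sig_big_dep/=; apply: eq_bigr => x _.
by rewrite mem_level_boxes.
Qed.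

Lemma normal_moving_frameP L (E F : R -> half_frame W D) (N : R -> compatible_map R D) :
  normal_moving_frame omega I rm L E F N <->
  (forall b, vsmooth_in I (fun t => frame_of (E t) (F t) b)) /\
  forall t, I t -> [/\ darboux_frame omega (frame_of (E t) (F t)),
    L t = fspan (fun b t => frame_of (E t) (F t) b) (@level_boxes D predT) t,
    normal_map (N t) & forall b, vder_in I (fun t => frame_of (E t) (F t) b) t
      (\sum_g structure_coef rm (N t) b g *: frame_of (E t) (F t) g)].
Proof.
split=> -[sm H].
  have sm' b : vsmooth_in I (fun t => frame_of (E t) (F t) b).
    by case: b => x; have [] := sm (tag x) (tagged x).
  split=> // t It; have [dar LE nN st] := H t It; split=> //.
  - exact/darbouxP.
  - by rewrite LE (span_frameE E F).
  - move/structural_eqsP : st => st b; rewrite -st.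
    exact: vsmooth_derivable.
split=> [a k|t It].
  by split; [have := sm (inl (Box k))|have := sm (inr (Box k))].
have [dar LE nN st] := H t It; split=> //.
- exact/darbouxP.
- by rewrite LE -(span_frameE E F).
- by apply/structural_eqsP => b; exact: vder_in_derive.
Qed.

Hypothesis rm_le : forall i, (rm i <= lheight D i)%N.
Hypothesis nd : nondegenerate omega.
Hypothesis dimW : \dim {:W} = (2 * ysize D)%N.

Lemma dim_boxes : \dim {:W} = #|((box D + box D)%type : finType)|.
Proof. by rewrite dimW card_sum card_box mul2n addnn. Qed.

Lemma moving_frame_G L (E F : R -> half_frame W D) (N : R -> compatible_map R D) :
  normal_moving_frame omega I rm L E F N -> G_curve omega I rm L.
Proof.
move=> /normal_moving_frameP[sm H].
apply: (@frame_curve_G R I W omega I_itv I_nontriv D rm rm_le dim_boxes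
  (fun b t => frame_of (E t) (F t) b) N) => //.
- by move=> t It; have [] := H t It.
- by move=> t b It; have [_ _ _ /(_ b)] := H t It.
- by move=> t It; have [] := H t It.
Qed.

Lemma structure_coef_smooth (N : R -> compatible_map R D)
    (b g : box D + box D) :
  (forall a c k l, smooth_in I (fun t => N t a c k l)) ->
  smooth_in I (fun t => structure_coef rm (N t) b g).
Proof.
move=> Ns; case: b => x; case: g => y /=.
- exact: smooth_cst.
- exact: smooth_cst.
- exact: Ns.
- exact: smooth_cst.
Qed.

Lemma normal_frame_ex (N : R -> compatible_map R D) :
  (forall a c k l, smooth_in I (fun t => N t a c k l)) ->
  (forall t, I t -> normal_map (N t)) ->
  exists L E F, normal_moving_frame omega I rm L E F N.
Proof.
move=> Ns Nn; have [t0 [_ [It0 _ _]]] := I_nontriv.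
have [|e [f ef]] := @darboux_basis_ex _ _ omega nd (box D).
  by rewrite dimW card_box.
pose X0 b := match b with inl x => e x | inr x => f x end.
have D0 : darboux_frame omega X0.
  move=> [x|x] [y|y]; rewrite /bdual/= ?scale1r ?scaleN1r ?linearNl/=.
  - by have [_ _ ->] := ef x y; rewrite eq_inl.
  - by have [_ ->] := ef x y.
  - by have [-> _ _] := ef x y; rewrite oppr0.
  - by rewrite skewC opprK; have [_ _ ->] := ef y x; rewrite eq_inr eq_sym.
pose A b g t := structure_coef rm (N t) b g.
have As b g : smooth_in I (A b g) by exact: structure_coef_smooth.
(* All coordinates of all frame vectors form one scalar system, whose matrix is the tensor product
   of [A] with the identity of [W]. *)
pose J : finType := ((box D + box D) * 'I_(\dim {:W}))%type.
pose A' (p q : J) t := (p.2 == q.2)%:R * A p.1 q.1 t.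
have As' p q : smooth_in I (A' p q) by apply: smoothM => //; exact: smooth_cst.
have [|z [z0 zd]] := @linear_ode _ _ I_itv J A' (fun p => vcoord p.2 (X0 p.1)) t0 _ It0.
  move=> p q t It; apply: der_in_cvg; exact: smooth_derivable (As' p q) _ It.
have zs p : smooth_in I (z p) by apply: (smooth_linear_system I_itv I_nontriv As').
pose X b t : W := \sum_k z (b, k) t *: (vbasis {:W})`_k.
have Xc b t k : vcoord k (X b t) = z (b, k) t by rewrite vcoord_sum.
have Xs b : vsmooth_in I (X b).
  by move=> k; under [X in smooth_in _ X]funext do rewrite Xc; exact: zs.
have Xd b t : I t -> vder_in I (X b) t (\sum_g A b g t *: X g t).
  move=> It k.
  rewrite (_ : vcoord k (\sum_g A b g t *: X g t) = \sum_q A' (b, k) q t * z q t).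
    by rewrite (_ : (fun s => vcoord k (X b s)) = z (b, k)); [exact: zd|apply/funext].
  rewrite /vcoord linear_sum/=.
  transitivity (\sum_g \sum_l A' (b, k) (g, l) t * z (g, l) t); last first.
    by rewrite pair_big; apply: eq_bigr => -[].
  apply: eq_bigr => g _; rewrite linearZ/= -/(vcoord k (X g t)) Xc.
  rewrite [RHS](bigD1 k)//= [X in _ + X]big1 ?addr0 => [|l lk].
    by rewrite /A'/= eqxx mul1r.
  by rewrite /A'/= eq_sym (negPf lk) !mul0r.
have Xt0 b : X b t0 = X0 b.
  by apply: vcoord_eq => k; rewrite Xc z0.
have XD t : I t -> darboux_frame omega (fun b => X b t).
  apply: (darboux_flow I_itv nd dim_boxes (t0 := t0) (A := A)) => //.
    by move=> b g s Is; apply: structure_coef_sp; have [[]] := Nn s Is.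
  by rewrite (_ : (fun b => X b t0) = X0)//; apply/funext => b; exact: Xt0.
pose E t : half_frame W D := fun a k => X (inl (Box k)) t.
pose F t : half_frame W D := fun a k => X (inr (Box k)) t.
have EFX b t : frame_of (E t) (F t) b = X b t.
  by case: b => x; rewrite /= /E /F Box_tagged.
exists (fun t => fspan X (@level_boxes D predT) t), E, F.
apply/normal_moving_frameP; split=> [b|t It].
  by under [X in vsmooth_in _ X]funext do rewrite EFX; exact: Xs.
have XE : (fun b t => frame_of (E t) (F t) b) = X.
  by apply/funext => b; apply/funext => s; exact: EFX.
split; [|by rewrite XE|exact: Nn|].
  by rewrite (_ : frame_of (E t) (F t) = fun b => X b t); [exact: XD|apply/funext => b].
move=> b; under [X in vder_in _ X _ _]funext do rewrite EFX.
by under eq_bigr do rewrite EFX; exact: Xd.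
Qed.

(* The linear map sending [X b t] to [Z b t] does not depend on [t]. *)
Lemma frame_transport (B : finType) (X Y Z : B -> R -> W) (A : B -> B -> R -> R) v s t :
  (forall b, vsmooth_in I (Y b)) -> \dim {:W} = #|B| ->
  (forall t, I t -> forall b b', omega (Y b t) (X b' t) = (b == b')%:R) ->
  (forall b t, I t -> vder_in I (X b) t (\sum_g A b g t *: X g t)) ->
  (forall b t, I t -> vder_in I (Z b) t (\sum_g A b g t *: Z g t)) ->
  I s -> I t ->
  \sum_b fcoord omega Y b s v *: Z b s = \sum_b fcoord omega Y b t v *: Z b t.
Proof.
move=> Ys dB XY Xd Zd Is It; apply: vcoord_eq => k.
suff Zc u : I u -> vder_in I (fun u => \sum_b fcoord omega Y b u v *: Z b u) u 0.
  apply: (der_in_const I_itv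
    (f := fun u => vcoord k (\sum_b fcoord omega Y b u v *: Z b u))) => // u Iu.
  by have := Zc u Iu k; rewrite /vcoord linear0.
move=> Iu.
(* The coordinates of a fixed vector satisfy the adjoint equation, by [fcoord_vderive] for a
   constant section. It cancels against the equation for [Z]. *)
have cd b : der_in I (fun u => fcoord omega Y b u v) u
    (- \sum_g fcoord omega Y g u v * A g b u).
  have := smooth_derivable I_itv I_nontriv
    (fcoord_smooth (omega := omega) I_itv I_nontriv Ys (b := b)
      (vsmooth_cst (v := v) I_itv I_nontriv)) Iu.
  have := fcoord_vderive I_itv I_nontriv Ys XY dB (fun t b => Xd b t) b Iu
     (vsmooth_cst (v := v) I_itv I_nontriv).
  rewrite (vder_in_derive I_itv I_nontriv Iu (vder_in_cst _ _ _)) /fcoord linear0r.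
  by move=> /esym/eqP; rewrite addr_eq0 => /eqP ->.
have := vder_in_sum (r := index_enum B) (P := xpredT)
  (fun b _ => vder_in_scale (cd b) (Zd b u Iu)).
rewrite [X in vder_in _ _ _ X](_ : _ = 0)// big_split/=.
under eq_bigr do rewrite scaleNr scaler_suml.
rewrite sumrN exchange_big/=; apply/eqP; rewrite addrC subr_eq0; apply/eqP.
apply: eq_bigr => b _; rewrite scaler_sumr; apply: eq_bigr => g _.
by rewrite scalerA.
Qed.

Lemma normal_frame_unique L L' (E F E' F' : R -> half_frame W D)
    (N N' : R -> compatible_map R D) :
  normal_moving_frame omega I rm L E F N ->
  normal_moving_frame omega I rm L' E' F' N' ->
  (forall t a b, I t -> N t a b = N' t a b) ->
  exists g : 'End(W), isometry omega omega g /\ forall t, I t -> L' t = (g @: L t)%VS.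
Proof.
move=> /normal_moving_frameP[sm H] /normal_moving_frameP[sm' H'] NN'.
have [t0 [_ [It0 _ _]]] := I_nontriv.
pose X b t := frame_of (E t) (F t) b; pose Z b t := frame_of (E' t) (F' t) b.
pose Y b t := bdual (fun b => X b t) b.
have Ys b : vsmooth_in I (Y b).
  by apply: vsmooth_scale => //; [exact: smooth_cst|exact: sm].
have XY t : I t -> forall b b', omega (Y b t) (X b' t) = (b == b')%:R.
  by move=> It; have [] := H t It.
pose g0 v := \sum_b fcoord omega Y b t0 v *: Z b t0.
have g0l : linear g0.
  move=> a u v; rewrite /g0 scaler_sumr -big_split/=; apply: eq_bigr => b _.
  by rewrite /fcoord linearDr/= linearZr/= scalerDl scalerA.
pose gl := GRing.isLinear.Build _ _ _ _ g0 g0l.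
pose gL : {linear W -> W} := HB.pack g0 gl.
have [G gE] : exists G : 'End(W), forall t v, I t ->
    G v = \sum_b fcoord omega Y b t v *: Z b t.
  exists (linfun gL) => t v It; rewrite lfunE /= /g0.
  apply: (frame_transport (X := X) (A := fun b g t => structure_coef rm (N t) b g)) => //.
  - exact: dim_boxes.
  - by move=> b s Is; have [_ _ _ /(_ b)] := H s Is.
  - move=> b s Is; have [_ _ _ /(_ b)] := H' s Is.
    rewrite (_ : structure_coef rm (N' s) b = structure_coef rm (N s) b)//.
    by apply/funext => -[y|y]; case: b => x //=; rewrite NN'.
have gX t b : I t -> G (X b t) = Z b t.
  move=> It; rewrite (gE t)// (bigD1 b)//= big1 ?addr0 => [|c cb].
    by rewrite /fcoord XY// eqxx scale1r.
  by rewrite /fcoord XY// (negPf cb) scale0r.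
exists (G); split=> [u v|t It].
  (* The values of [omega] on a Darboux frame do not depend on the frame, so a linear map between
     two such frames is symplectic. *)
  have pair (X' : box D + box D -> W) b c : darboux_frame omega X' ->
      omega (X' b) (X' c) = bsgn R (bconj b) * (bconj b == c)%:R.
    move=> dX; rewrite -dX /bdual bconjK linearZl/= mulrA.
    by case: (b) => x /=; rewrite ?mulrNN !mulr1 mul1r.
  rewrite (frame_decomp XY dim_boxes u It0) (frame_decomp XY dim_boxes v It0).
  rewrite !linear_sum/=; apply: eq_bigr => c _.
  rewrite !linear_sumlz; apply: eq_bigr => b _.
  have gZ k d : G (k *: X d t0) = k *: Z d t0 by rewrite linearZ/= gX.
  rewrite !gZ [LHS]linearZlr/= [RHS]linearZlr/=; congr (_ * _).
  have [dX _ _ _] := H t0 It0; have [dZ _ _ _] := H' t0 It0.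
  by rewrite (pair (fun b => X b t0))// (pair (fun b => Z b t0)).
have [_ -> _ _] := H t It; have [_ -> _ _] := H' t It.
rewrite /fspan limg_sum; apply: eq_bigr => b _.
by rewrite limg_line gX.
Qed.

End MovingFrames.

(** * Normal mappings and quivers of curvatures *)

Section NormalMaps.
Variables (R : realType) (D : young_diagram).
Implicit Types (N : compatible_map R D) (a b : superbox D).

Lemma normal_map_nonessential N a b : normal_map N -> ~ essential R a b -> N a b = 0.
Proof.
move=> nN ess; apply: contrapT => N0; apply: ess; by exists N.
Qed.

Lemma essentialC a b : essential R a b -> essential R b a.
Proof.
move=> [N [nN N0]]; exists N; split=> //; have [[Ns _ _] _] := nN.
by rewrite (Ns a b) => Nt; apply: N0; rewrite -(trmxK (N a b)) Nt trmx0.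
Qed.

(** The vanishing conditions of normality concern only the position of a pair, so at an essential
    pair they are inherited from the normal mapping that witnesses it. Symmetry and antisymmetry are
    all that remains to be asked. *)
Lemma essential_normal_map N : symmetric_map N ->
  (forall a b, ~ essential R a b -> N a b = 0) ->
  (forall a, ~~ special a -> essential R a (sbright a) ->
     (N a (sbright a))^T = - N a (sbright a)) ->
  normal_map N.
Proof.
move=> Ns Ne Na; split=> [|j i a b ji ab].
  split=> // [a b ab N0|a sa].
    have [[N' [nN' N'0]]|/Ne//] := pselect (essential R a b).
    by have [[_ H _] _] := nN'; exact: H.
  have [ess|/Ne N0] := pselect (essential R a (sbright a)); first exact: Na.
  by rewrite N0 trmx0 oppr0.
apply: contrapT => N0; have [[N' [nN' N'0]]|/Ne//] := pselect (essential R a b).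
by have [_ H] := nN'; apply: N'0; exact: H ab.
Qed.

(** When all rows have different lengths, superboxes have size 1, and an antisymmetric 1 by 1 matrix
    is zero. Prescribed scalar curvatures are thus never subject to antisymmetry. *)
Lemma essential_right_uniq a : uniq D -> ~~ special a -> ~ essential R a (sbright a).
Proof.
move=> uD sa [N [[[_ _ Na] _] N0]]; apply: N0.
have s1 : lheight D (level a) = 1%N.
  by rewrite /lheight count_uniq_mem// -mem_undup mem_nth.
have skew0 (A : 'M[R]_(lheight D (level a))) : A^T = - A -> A = 0.
  move: A; rewrite s1 => A AT; apply/matrixP => k l.
  have := congr1 (fun B : 'M[R]_1 => B k l) AT.
  rewrite !mxE !ord1 => /eqP; rewrite -subr_eq0 opprK -mulr2n mulrn_eq0.
  by move=> /eqP.
exact: (skew0 _ (Na a sa)).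
Qed.

End NormalMaps.

Section RowVectors.
Variables (R : realType) (V : vectType R).

Lemma rowvec_mulA (m n p : nat) (X : 'I_m -> V) (A : 'M[R]_(m, n)) (C : 'M[R]_(n, p)) l :
  rowvec_mul (rowvec_mul X A) C l = rowvec_mul X (A *m C) l.
Proof.
rewrite /rowvec_mul; under eq_bigr do rewrite scaler_sumr.
rewrite exchange_big/=; apply: eq_bigr => k _.
rewrite mxE scaler_suml; apply: eq_bigr => j _.
by rewrite scalerA mulrC.
Qed.

Lemma rowvec_mul1 (m : nat) (X : 'I_m -> V) l : rowvec_mul X (1%:M : 'M[R]_m) l = X l.
Proof.
rewrite /rowvec_mul (bigD1 l)//= mxE eqxx scale1r big1 ?addr0// => k kl.
by rewrite mxE (negPf kl) scale0r.
Qed.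

Lemma rowvec_mulB (m n : nat) (X Y : 'I_m -> V) (A : 'M[R]_(m, n)) l :
  rowvec_mul (fun k => X k - Y k) A l = rowvec_mul X A l - rowvec_mul Y A l.
Proof. by rewrite /rowvec_mul -sumrB; apply: eq_bigr => k _; rewrite scalerBr. Qed.

Lemma rowvec_mul_sum (J : finType) (m n : nat) (X : J -> 'I_m -> V) (A : 'M[R]_(m, n)) l :
  rowvec_mul (fun k => \sum_j X j k) A l = \sum_j rowvec_mul (X j) A l.
Proof.
rewrite /rowvec_mul; under eq_bigr do rewrite scaler_sumr.
by rewrite exchange_big.
Qed.

Lemma rowvec_mul_span (m n : nat) (X : 'I_m -> V) (A : 'M[R]_(m, n)) l :
  rowvec_mul X A l \in (\sum_k <[X k]>)%VS.
Proof.
apply: rpred_sum => k _; apply: rpredZ.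
by apply: subvP (memv_line _); apply: sumv_sup (subvv _).
Qed.

Lemma bilinear_mx_inj (m n : nat) (A C : 'M[R]_(m, n)) :
  (forall (u : 'cV[R]_m) (v : 'cV[R]_n),
    (u^T *m A *m v) 0 0 = (u^T *m C *m v) 0 0) -> A = C.
Proof.
move=> H; apply/matrixP => i j; have := H (delta_mx i 0) (delta_mx j 0).
by rewrite !trmx_delta -!rowE -!colE !mxE.
Qed.

Lemma linear_colE (m n : nat) (h : {linear 'cV[R]_m -> 'cV[R]_n}) (u : 'cV[R]_m) :
  h u = (\matrix_(i, j) h (delta_mx j 0) i 0) *m u.
Proof.
rewrite [in LHS](matrix_sum_delta u) linear_sum; apply/colP => i.
rewrite summxE mxE; apply: eq_bigr => j _.
by rewrite big_ord1 linearZ/= !mxE mulrC.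
Qed.

End RowVectors.

(** * Constant changes of normal frame *)

Section ChangeOfFrame.
Variables (R : realType) (I : set R) (W : vectType R) (omega : {skew_symmetric W}).
Hypothesis I_itv : is_interval I.
Hypothesis I_nontriv : exists s t, [/\ I s, I t & s < t].
Variables (D : young_diagram) (rm : 'I_(depth D) -> nat).
Let J (i : 'I_(depth D)) := inertia_mx R (lheight D i) (rm i).

Lemma rowvec_vderive (m n : nat) (X : R -> 'I_m -> W) (A : 'M[R]_(m, n)) l t :
  (forall k, vsmooth_in I (fun s => X s k)) -> I t ->
  vderive_in I (fun s => rowvec_mul (X s) A l) t =
  rowvec_mul (fun k => vderive_in I (fun s => X s k) t) A l.
Proof.
move=> Xs It; apply: vder_in_derive => //; rewrite /rowvec_mul.
apply: vder_in_sum => k _.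
rewrite -[A k l *: vderive_in _ _ _]add0r -(scale0r (X t k)).
by apply: vder_in_scale; [exact: der_in_cst|exact: vsmooth_derivable].
Qed.

(** For [U] preserving [J], the matrix [J *m U *m J] is the inverse transpose of [U]; this is what
    keeps E and F dual. The hypothesis relating [N'] to [N] says that [U] intertwines the curvature
    maps [N *m J]. *)
Lemma change_frame (L : R -> {vspace W}) (E F : R -> half_frame W D)
    (N N' : R -> compatible_map R D) (U : forall i : 'I_(depth D), 'M[R]_(lheight D i)) :
  normal_moving_frame omega I rm L E F N ->
  (forall i, (U i)^T *m J i *m U i = J i) ->
  (forall t a b, I t -> U (level b) *m N' t a b *m J (level a) =
     N t a b *m J (level a) *m U (level a)) ->
  (forall t, I t -> normal_map (N' t)) ->
  normal_moving_frame omega I rm L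
    (fun t a => rowvec_mul (E t a) (U (level a)))
    (fun t a => rowvec_mul (F t a) (J (level a) *m U (level a) *m J (level a))) N'.
Proof.
move=> [sm H] UJ UN nN'.
have JJ i : J i *m J i = 1%:M by exact: inertia_mxK.
have JUU i : J i *m (U i)^T *m J i *m U i = 1%:M.
  by rewrite -!mulmxA [(U i)^T *m _]mulmxA UJ JJ.
have JUJJ i : J i *m U i *m J i *m J i = J i *m U i by rewrite -mulmxA JJ mulmx1.
have UJU i : U i *m (J i *m (U i)^T *m J i) = 1%:M by apply: mulmx1C; rewrite JUU.
have JT i : (J i)^T = J i by exact: inertia_mxT.
split=> [a k|t It].
  by split; apply: vsmooth_sum => // j _; apply: vsmooth_scale => //;
    [exact: smooth_cst|case: (sm a j)|exact: smooth_cst|case: (sm a j)].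
have [dar LE nN [E1 E2 F1 F2]] := H t It; split.
- move=> a b k l; split; rewrite /rowvec_mul linear_sumlz/=.
  + rewrite big1// => i _; rewrite linear_sumr big1// => j _.
    by rewrite linearZl/= linearZr/=; have [-> _ _] := dar a b i j; rewrite !mulr0.
  + rewrite big1// => i _; rewrite linear_sumr big1// => j _.
    by rewrite linearZl/= linearZr/=; have [_ -> _] := dar a b i j; rewrite !mulr0.
  under eq_bigr do rewrite linear_sumr.
  have [ab|ab] := eqVneq a b; last first.
    have BB (i : 'I_(sbsize a)) (j : 'I_(sbsize b)) : (Box i == Box j) = false.
      by apply: contra_neqF ab => /eqP/(congr1 tag).
    rewrite BB big1// => i _; rewrite big1// => j _.
    by rewrite linearZl/= linearZr/=; have [_ _ ->] := dar a b i j; rewrite BB !mulr0.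
  case: b / ab l => l.
  have BB (i j : 'I_(sbsize a)) : (Box i == Box j) = (i == j) by rewrite eq_Tagged.
  transitivity (((J (level a) *m U (level a) *m J (level a))^T *m U (level a)) k l).
    rewrite mxE; apply: eq_bigr => i _; rewrite (bigD1 i)//= big1 ?addr0 => [|j ji].
      rewrite linearZl/= linearZr/=; have [_ _ ->] := dar a a i i.
      by rewrite eqxx mulr1 [_^T k i]mxE.
    rewrite linearZl/= linearZr/=; have [_ _ ->] := dar a a i j.
    by rewrite BB eq_sym (negPf ji) !mulr0.
  by rewrite !trmx_mul JT mulmxA JUU BB mxE.
- rewrite LE; apply: eq_bigr => a _; apply/eqP; rewrite eqEsubv; apply/andP; split.
    apply/subv_sumP => k _; rewrite -memvE.
    rewrite -[E t a k](rowvec_mul1 (E t a)) -(UJU (level a)) -rowvec_mulA.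
    exact: rowvec_mul_span.
  by apply/subv_sumP => k _; rewrite -memvE; exact: rowvec_mul_span.
- exact: nN'.
have Esm a k : vsmooth_in I (fun s => E s a k) by case: (sm a k).
have Fsm a k : vsmooth_in I (fun s => F s a k) by case: (sm a k).
(* The intertwining relation in the form in which it enters the derivative of the new F. *)
have UN' a b : U (level b) *m N' t a b =
    N t a b *m (J (level a) *m U (level a) *m J (level a)).
  by rewrite !mulmxA -UN// -[RHS]mulmxA JJ mulmx1.
split=> a k ak; rewrite rowvec_vderive//.
- by apply: eq_bigr => i _; rewrite E1.
- transitivity (rowvec_mul (F t a) (J (level a) *m U (level a)) k).
    by rewrite -rowvec_mulA; apply: eq_bigr => i _; rewrite E2.
  by rewrite rowvec_mulA; congr (rowvec_mul _ _ _); rewrite [RHS]JUJJ.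
- under [X in rowvec_mul X]funext do rewrite F1//.
  rewrite rowvec_mulB rowvec_mul_sum; congr (_ - _).
  by apply: eq_bigr => b _; rewrite !rowvec_mulA UN'.
- under [X in rowvec_mul X]funext do rewrite F2//.
  rewrite rowvec_mul_sum.
  by apply: eq_bigr => b _; rewrite !rowvec_mulA UN'.
Qed.

End ChangeOfFrame.

(** * Realization of prescribed curvatures *)

Section Realization.
Variables (R : realType) (I : set R) (D : young_diagram).
Variables (rm : 'I_(depth D) -> nat) (W : vectType R) (omega : {skew_symmetric W}).
Hypothesis I_itv : is_interval I.
Hypothesis I_nontriv : exists s t, [/\ I s, I t & s < t].
Hypothesis rm_le : forall i, (rm i <= lheight D i)%N.
Hypothesis nd : nondegenerate omega.
Hypothesis dimW : \dim {:W} = (2 * ysize D)%N.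
Let J (i : 'I_(depth D)) := inertia_mx R (lheight D i) (rm i).

Lemma scalar_realization (rho : superbox D -> superbox D -> R -> R) : uniq D ->
  (forall a b, essential R a b -> smooth_in I (rho a b)) ->
  (forall a b t, I t -> essential R a b -> rho a b t = rho b a t) ->
  exists_unique_curve omega I (fun L =>
    G_curve omega I rm L /\ has_curvatures omega I rm L rho).
Proof.
move=> uD rhos rhoC; split.
  pose N t : compatible_map R D := fun a b =>
    if `[< essential R a b >] then const_mx (rho a b t) else 0.
  have [|t It|L [E [F LEF]]] := @normal_frame_ex _ _ _ _ I_itv I_nontriv _ rm nd dimW N.
  - move=> a b k l; rewrite /N; case: asboolP => ess.
      by under [X in smooth_in _ X]funext do rewrite mxE; exact: rhos.
    by under [X in smooth_in _ X]funext do rewrite mxE; exact: smooth_cst.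
  - apply: essential_normal_map.
    + move=> a b; rewrite /N; case: asboolP => [ess|ess]; case: asboolP => [ess'|ess'].
      * by rewrite rhoC// trmx_const.
      * by case: ess'; exact: essentialC.
      * by case: ess; exact: essentialC.
      * by rewrite trmx0.
    + by move=> a b ess; rewrite /N asboolF.
    + by move=> a sa /(essential_right_uniq uD sa).
  exists L; split; first exact: moving_frame_G LEF.
  exists E, F, N; split=> // a b t It ess.
  by rewrite /N asboolT.
move=> L L' [_ [E [F [N [LEF Nrho]]]]] [_ [E' [F' [N' [LEF' Nrho']]]]].
apply: (normal_frame_unique I_itv I_nontriv dimW LEF LEF') => t a b It.
have [ess|ess] := pselect (essential R a b); first by rewrite Nrho// Nrho'.
have [_ /(_ t It)[_ _ nN _]] := LEF; have [_ /(_ t It)[_ _ nN' _]] := LEF'.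
by rewrite !normal_map_nonessential.
Qed.

Lemma family_iso_inverse (X : quiver_family R D)
    (g : forall i : 'I_(depth D), 'Hom('cV[R]_(lheight D i), qf_space X i)) :
  (forall i, bijective (g i)) ->
  (forall i u, (g i)^-1%VF (g i u) = u) /\ (forall i v, g i ((g i)^-1%VF v) = v).
Proof.
move=> gb; split=> i v.
  by apply: lker0_lfunK; apply/lker0P; exact: bij_inj.
by apply: limg_lfunVK; have [h _ hK] := gb i; rewrite -(hK v) memv_img ?memvf.
Qed.

(** The composite of one isomorphism with the inverse of the other is an isometry [U] of the
    standard space at each level, independent of [t]. Changing the second frame by [U] gives it the
    normal mappings of the first, and two frames with equal normal mappings differ by a symplectic
    map. *)
Lemma family_realization_unique (X : quiver_family R D) L L' :
  has_curvature_quiver omega I rm L X -> has_curvature_quiver omega I rm L' X ->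
  exists g : 'End(W), isometry omega omega g /\ forall t, I t -> L' t = (g @: L t)%VS.
Proof.
move=> [E [F [N [LEF [g [gb giso gX]]]]]] [E' [F' [N' [LEF' [g' [gb' giso' gX']]]]]].
have [gK' g'K] := family_iso_inverse gb'.
pose h (i : 'I_(depth D)) : {linear 'cV[R]_(lheight D i) -> 'cV[R]_(lheight D i)} :=
  ((g' i)^-1 \o g i)%VF.
pose U (i : 'I_(depth D)) : 'M[R]_(lheight D i) := \matrix_(k, l) h i (delta_mx l 0) k 0.
have hU i u : (g' i)^-1%VF (g i u) = U i *m u.
  by rewrite -(linear_colE (h i) u) /h/= lfunE.
have gU i u : g' i (U i *m u) = g i u by rewrite -hU g'K.
have UJU i : (U i)^T *m J i *m U i = J i.
  apply: bilinear_mx_inj => u v.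
  have := giso' i (U i *m u) (U i *m v); rewrite !gU giso /= /inertia_form => H.
  by rewrite [RHS]H trmx_mul !mulmxA.
have LEF2 := change_frame I_itv I_nontriv (N' := N) LEF' UJU.
apply: (normal_frame_unique I_itv I_nontriv dimW LEF) (LEF2 _ _) _ => //.
- move=> t a b It; have [ess|ess] := pselect (essential R a b); last first.
    have [_ /(_ t It)[_ _ nN _]] := LEF; have [_ /(_ t It)[_ _ nN' _]] := LEF'.
    by rewrite !normal_map_nonessential// mulmx0 !mul0mx.
  apply/matrixP => k l.
  have := gX t a b (delta_mx l 0) It ess.
  have := gX' t a b (U (level a) *m delta_mx l 0) It ess.
  rewrite gU !lfunE/= => <- H.
  have := congr1 (fun w => (g' (level b))^-1%VF w) H.
  rewrite hU gK' => /colP/(_ k).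
  by rewrite !mulmxA -!colE !mxE.
- by move=> t It; have [_ /(_ t It)[_ _ nN _]] := LEF.
Qed.

Lemma family_realization (X : quiver_family R D) :
  smooth_family I X -> compatible_family I rm X ->
  exists L, G_curve omega I rm L /\ has_curvature_quiver omega I rm L X.
Proof.
move=> Xs [Xdim Xneg Xsym Xskew].
have /fin_all_exists[g gP] (i : 'I_(depth D)) :
    exists g : 'Hom('cV[R]_(lheight D i), qf_space X i),
    bijective g /\ forall u v : 'cV[R]_(lheight D i),
      pe_form (qf_space X i) (g u) (g v) = inertia_form (rm i) u v.
  exact: pseudo_orthonormal_iso (@pe_nondeg _ (qf_space X i)) _ _ (Xdim i) (Xneg i).
have [gK hK] := family_iso_inverse (fun i => (gP i).1).
pose h t a b : {linear 'cV[R]_(lheight D (level a)) -> 'cV[R]_(lheight D (level b))} :=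
  ((g (level b))^-1 \o qf_map X t a b \o g (level a))%VF.
pose M t a b : 'M[R]_(lheight D (level b), lheight D (level a)) :=
  \matrix_(k, l) h t a b (delta_mx l 0) k 0.
(* The curvature map has matrix [N *m J] and [J] is an involution, so the matrix [M] of the given
   map is multiplied by [J]. *)
pose N t : compatible_map R D := fun a b =>
  if `[< essential R a b >] then M t a b *m J (level a) else 0.
have JJ (i : 'I_(depth D)) : J i *m J i = 1%:M by exact: inertia_mxK.
have JT (i : 'I_(depth D)) : (J i)^T = J i by exact: inertia_mxT.
have NJ t a b u : essential R a b -> g (level b) (N t a b *m J (level a) *m u) =
    qf_map X t a b (g (level a) u).
  move=> ess; rewrite /N asboolT// -[M t a b *m _ *m _]mulmxA JJ mulmx1.
  by rewrite -(linear_colE (h t a b) u) /h/= !lfunE/= lfunE/= hK.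
have Nsm a b k l : smooth_in I (fun t => N t a b k l).
  rewrite /N; case: asboolP => ess; last first.
    by under [X in smooth_in _ X]funext do rewrite mxE; exact: smooth_cst.
  under [X in smooth_in _ X]funext do rewrite mxE.
  apply: smooth_sum => // j _; apply: smoothM => //; last exact: smooth_cst.
  under [X in smooth_in _ X]funext do rewrite mxE /h/= !lfunE/= lfunE/=.
  pose e (v : qf_space X (level b)) : R^o := ((g (level b))^-1%VF v) k 0.
  have el : linear e by move=> c v w; rewrite /e linearD linearZ/= !mxE.
  pose eL := GRing.isLinear.Build _ _ _ _ e el.
  pose e' : {linear qf_space X (level b) -> R^o} := HB.pack e eL.
  apply: (smooth_linear_form I_itv I_nontriv (h := e')).
  exact: Xs.
have Nn t : I t -> normal_map (N t).
  move=> It; apply: essential_normal_map.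
  - move=> a b; have [ess|ess] := pselect (essential R a b); last first.
      rewrite /N !asboolF ?trmx0// => /essentialC //.
    have ess' := essentialC ess.
    (* Written in pseudo-orthonormal bases, adjointness of the two maps is the symmetry of [N] with
       a factor [J] on each side; these factors cancel. *)
    suff E : J (level a) *m N t b a *m J (level b) =
        J (level a) *m (N t a b)^T *m J (level b).
      have := congr1 (fun A => J (level a) *m A *m J (level b)) E.
      by rewrite !mulmxA !JJ !mul1mx -!mulmxA !JJ !mulmx1.
    apply: bilinear_mx_inj => u v.
    have := Xsym t a b (g (level a) u) (g (level b) v) It ess.
    rewrite -!NJ// (gP _).2 (gP _).2 /inertia_form => H.
    by rewrite -!mulmxA !mulmxA in H *; rewrite -H !trmx_mul JT !mulmxA.
  - by move=> a b ess; rewrite /N asboolF.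
  - move=> a sa ess.
    suff E : J (level a) *m (N t a (sbright a))^T *m J (level a) =
        J (level a) *m (- N t a (sbright a)) *m J (level a).
      have := congr1 (fun A => J (level a) *m A *m J (level a)) E.
      by rewrite !mulmxA !JJ !mul1mx -!mulmxA !JJ !mulmx1.
    apply: bilinear_mx_inj => u v.
    have := Xskew t a (g (level a) u) (g (level a) v) It sa ess.
    rewrite -!NJ// (gP _).2 (gP _).2 /inertia_form => H.
    rewrite mulmxN mulNmx mulmxN mulNmx [RHS]mxE.
    by rewrite -!mulmxA !mulmxA in H *; rewrite -H !trmx_mul JT !mulmxA.
have [L [E [F LEF]]] := normal_frame_ex I_itv I_nontriv rm nd dimW Nsm Nn.
exists L; split; first exact: moving_frame_G LEF.
exists E, F, N; split=> //; exists g; split=> [i|i u v|t a b v It ess].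
- exact: (gP i).1.
- exact: (gP i).2.
- by rewrite lfunE/= NJ.
Qed.

End Realization.

Theorem theorem4 (R : realType) (I : set R) (D : young_diagram)
    (rm : 'I_(depth D) -> nat) (W : vectType R) (omega : {skew_symmetric W}) :
  is_interval I -> (exists s t, [/\ I s, I t & s < t]) ->
  (forall i, (rm i <= lheight D i)%N) ->
  nondegenerate omega -> \dim {:W} = (2 * ysize D)%N ->
  (forall Xi : quiver_family R D,
     smooth_family I Xi -> compatible_family I rm Xi ->
     exists_unique_curve omega I (fun L =>
       G_curve omega I rm L /\ has_curvature_quiver omega I rm L Xi)) /\
  (uniq D ->
   forall rho : superbox D -> superbox D -> R -> R,
     (forall a b, essential R a b -> smooth_in I (rho a b)) ->
     (forall a b t, I t -> essential R a b -> rho a b t = rho b a t) ->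
     exists_unique_curve omega I (fun L =>
       G_curve omega I rm L /\ has_curvatures omega I rm L rho)).
Proof.
move=> I_itv I_nontriv rm_le nd dimW; split=> [Xi Xs Xc|uD rho rhos rhoC].
  split; first exact: family_realization.
  move=> L L' [_ LXi] [_ L'Xi].
  exact: family_realization_unique LXi L'Xi.
exact: scalar_realization.
Qed.
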